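(* Assume (A1)–(A4) and that the critical value is $0$. Let $u\in C(\overline\Omega)$ be a viscosity subsolution of \[ H(x,Du)=0\ \text{in }\Omega,\qquad \gamma(x)\cdot Du=g(x)\ \text{on }\partial\Omega. \] Let $T>0$, $I=[0,T]$, and let $\eta:I\to\mathbb R^n$ be absolutely continuous with $\eta(t)\in\overline\Omega$ for all $t\in I$. Set $I_\partial=\{t\in I:\eta(t)\in\partial\Omega\}$. Then there exists $p\in L^\infty(I,\mathbb R^n)$ such that \[ \frac{d}{dt}u(\eta(t))=p(t)\cdot\dot\eta(t)\ \text{a.e. } t\in I,\qquad H(\eta(t),p(t))\le 0\ \text{a.e. } t\in I,\qquad \gamma(\eta(t))\cdot p(t)\le g(\eta(t))\ \text{a.e. } t\in I_\partial. \]
   Context: $\Omega\subset\mathbb R^n$ is a bounded domain; $H\in C(\overline\Omega\times\mathbb R^n)$, $g\in C(\partial\Omega)$, $\gamma\in C(\partial\Omega,\mathbb R^n)$. (A1) $p\mapsto H(x,p)$ is convex for each $x$; (A2) $H(x,p)\to\infty$ as $|p|\to\infty$ for all $x\in\overline\Omega$; (A3) $\Omega$ is a $C^1$ domain; (A4) $\nu(x)\cdot\gamma(x)>0$ on $\partial\Omega$, $\nu$ the outer unit normal. A viscosity subsolution here means: $H(x,p)\le0$ for all $p\in D^+u(x)$, $x\in\Omega$, and $\min\{H(x,p),\gamma(x)\cdot p-g(x)\}\le 0$ for all $p\in D^+_{\overline\Omega}u(x)$, $x\in\partial\Omega$, where $D^+_Vu(x)$ is the set of $p$ with $u(y)\le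 u(x)+p\cdot(y-x)+o(|y-x|)$ as $y\to x$, $y\in V$. ''The critical value is $0$'' means this boundary problem admits a viscosity solution. *)

(* Defs.v *)
From Stdlib Require Import Reals Lra List.
From Stdlib Require Vectors.Fin.
Open Scope R_scope.

Definition vec (n : nat) := Fin.t n -> R.

Fixpoint sumFin (n : nat) : (Fin.t n -> R) -> R :=
  match n return (Fin.t n -> R) -> R with
  | O => fun _ => 0
  | S m => fun f => f Fin.F1 + sumFin m (fun i => f (Fin.FS i))
  end.

Definition dot {n} (x y : vec n) : R := sumFin n (fun i => x i * y i).
Definition vnorm {n} (x : vec n) : R := sqrt (dot x x).
Definition vsub {n} (x y : vec n) : vec n := fun i => x i - y i.
Definition vadd {n} (x y : vec n) : vec n := fun i => x i + y i.
Definition vscale {n} (c : R) (x : vec n) : vec n := fun i => c * x i.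
Definition dist {n} (x y : vec n) : R := vnorm (vsub x y).

Definition is_open {n} (U : vec n -> Prop) : Prop :=
  forall x, U x -> exists r, r > 0 /\ forall y, dist y x < r -> U y.

Definition is_bounded {n} (U : vec n -> Prop) : Prop :=
  exists M, forall x, U x -> vnorm x <= M.

Definition is_connected {n} (O : vec n -> Prop) : Prop :=
  forall U V : vec n -> Prop, is_open U -> is_open V ->
    (forall x, O x -> U x \/ V x) ->
    (forall x, ~ (O x /\ U x /\ V x)) ->
    (exists x, O x /\ U x) -> (exists x, O x /\ V x) -> False.

Definition is_domain {n} (O : vec n -> Prop) : Prop :=
  is_open O /\ is_connected O /\ exists x, O x.

Definition closure {n} (O : vec n -> Prop) : vec n -> Prop :=
  fun x => forall eps, eps > 0 -> exists y, O y /\ dist y x < eps.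

Definition boundary {n} (O : vec n -> Prop) : vec n -> Prop :=
  fun x => closure O x /\ ~ O x.

Definition cont_on {n} (S : vec n -> Prop) (f : vec n -> R) : Prop :=
  forall x, S x -> forall eps, eps > 0 -> exists d, d > 0 /\
    forall y, S y -> dist y x < d -> Rabs (f y - f x) < eps.

Definition vcont_on {n} (S : vec n -> Prop) (f : vec n -> vec n) : Prop :=
  forall x, S x -> forall eps, eps > 0 -> exists d, d > 0 /\
    forall y, S y -> dist y x < d -> dist (f y) (f x) < eps.

Definition cont_on_prod {n} (S : vec n -> Prop) (H : vec n -> vec n -> R) : Prop :=
  forall x p, S x -> forall eps, eps > 0 -> exists d, d > 0 /\
    forall y q, S y -> dist y x < d -> dist q p < d ->
      Rabs (H y q - H x p) < eps.

Definition has_gradient {n} (phi : vec n -> R) (x Dx : vec n) : Prop :=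
  forall eps, eps > 0 -> exists d, d > 0 /\ forall y, dist y x < d ->
    Rabs (phi y - phi x - dot Dx (vsub y x)) <= eps * dist y x.

Definition local_defining_fn {n} (O : vec n -> Prop) (x0 : vec n) (r : R)
    (phi : vec n -> R) (Dphi : vec n -> vec n) : Prop :=
  r > 0 /\
  (forall y, dist y x0 < r -> has_gradient phi y (Dphi y)) /\
  vcont_on (fun y => dist y x0 < r) Dphi /\
  (forall y, dist y x0 < r -> vnorm (Dphi y) <> 0) /\
  (forall y, dist y x0 < r -> (O y <-> phi y < 0)).

Definition is_C1_domain {n} (O : vec n -> Prop) : Prop :=
  forall x0, boundary O x0 ->
    exists r phi Dphi, local_defining_fn O x0 r phi Dphi.

Definition outer_unit_normal {n} (O : vec n -> Prop) (x0 nu : vec n) : Prop :=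
  exists r phi Dphi, local_defining_fn O x0 r phi Dphi /\
    nu = vscale (/ vnorm (Dphi x0)) (Dphi x0).

Definition superdiff {n} (V : vec n -> Prop) (u : vec n -> R) (x p : vec n) : Prop :=
  forall eps, eps > 0 -> exists d, d > 0 /\ forall y, V y -> dist y x < d ->
    u y <= u x + dot p (vsub y x) + eps * dist y x.

Definition subdiff {n} (V : vec n -> Prop) (u : vec n -> R) (x p : vec n) : Prop :=
  forall eps, eps > 0 -> exists d, d > 0 /\ forall y, V y -> dist y x < d ->
    u y >= u x + dot p (vsub y x) - eps * dist y x.

Definition whole {n} : vec n -> Prop := fun _ => True.

Definition visc_subsol {n} (O : vec n -> Prop) (H : vec n -> vec n -> R)
    (gamma : vec n -> vec n) (g : vec n -> R) (u : vec n -> R) : Prop :=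
  cont_on (closure O) u /\
  (forall x p, O x -> superdiff whole u x p -> H x p <= 0) /\
  (forall x p, boundary O x -> superdiff (closure O) u x p ->
     Rmin (H x p) (dot (gamma x) p - g x) <= 0).

Definition visc_supersol {n} (O : vec n -> Prop) (H : vec n -> vec n -> R)
    (gamma : vec n -> vec n) (g : vec n -> R) (u : vec n -> R) : Prop :=
  cont_on (closure O) u /\
  (forall x p, O x -> subdiff whole u x p -> H x p >= 0) /\
  (forall x p, boundary O x -> subdiff (closure O) u x p ->
     Rmax (H x p) (dot (gamma x) p - g x) >= 0).

Definition visc_sol {n} O H gamma g (u : vec n -> R) : Prop :=
  visc_subsol O H gamma g u /\ visc_supersol O H gamma g u.

Definition critical_value_zero {n} O H gamma g : Prop :=
  exists w : vec n -> R, visc_sol O H gamma g w.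

Definition null_set (A : R -> Prop) : Prop :=
  forall eps, eps > 0 -> exists a b : nat -> R,
    (forall k, a k <= b k) /\
    (forall x, A x -> exists k, a k < x < b k) /\
    (forall N, sum_f_R0 (fun k => b k - a k) N < eps).

Inductive lmeas : (R -> Prop) -> Prop :=
| lm_itv : forall a b, lmeas (fun x => a < x < b)
| lm_null : forall A, null_set A -> lmeas A
| lm_compl : forall A, lmeas A -> lmeas (fun x => ~ A x)
| lm_union : forall A : nat -> R -> Prop,
    (forall k, lmeas (A k)) -> lmeas (fun x => exists k, A k x)
| lm_ext : forall A B, lmeas A -> (forall x, A x <-> B x) -> lmeas B.

Definition ae_on (S : R -> Prop) (P : R -> Prop) : Prop :=
  null_set (fun t => S t /\ ~ P t).

Definition measurable_on (S : R -> Prop) (f : R -> R) : Prop :=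
  forall c, lmeas (fun t => S t /\ f t < c).

Definition Linf_on {n} (S : R -> Prop) (p : R -> vec n) : Prop :=
  (forall i, measurable_on S (fun t => p t i)) /\
  exists M, ae_on S (fun t => vnorm (p t) <= M).

Fixpoint itv_chain (lo : R) (l : list (R * R)) : Prop :=
  match l with
  | nil => True
  | (a, b) :: l' => lo <= a /\ a <= b /\ itv_chain b l'
  end.

Definition disjoint_itvs (T : R) (l : list (R * R)) : Prop :=
  itv_chain 0 l /\ Forall (fun ab => snd ab <= T) l.

Definition abs_cont_on {n} (T : R) (eta : R -> vec n) : Prop :=
  forall eps, eps > 0 -> exists d, d > 0 /\ forall l, disjoint_itvs T l ->
    fold_right (fun ab s => snd ab - fst ab + s) 0 l < d ->
    fold_right (fun ab s => dist (eta (snd ab)) (eta (fst ab)) + s) 0 l < eps.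

(* Main.v *)
(** The momentum [p] is found pointwise, without smoothing [u]. Coercivity makes [u] locally
    Lipschitz up to the boundary, so [eta] and [u o eta] are differentiable almost everywhere. Fix an
    interior time of differentiability, with [x = eta t], [v] the velocity and [d] the derivative of
    [u o eta]. Test functions [h Phi ((y - x) / h)], [h -> 0], touch [u] from above near [x] with
    gradients whose component along [v] is at least [d - delta]. If [x] is on the boundary then [v] is
    tangent to it (the curve stays in the closure on both sides of [t]), and [Phi] can be built in the
    coordinates dual to [(v, gamma x)] so that its derivative along [gamma] exceeds [g x] by [delta], up
    to a term proportional to the signed distance: at boundary contact points the boundary inequality
    fails and hence [H <= 0] holds; at interior ones the extra term is nonpositive up to [o(1)].
    Letting [delta -> 0], the convex set of admissible [p] has an element with [p . v >= d]; with [- v]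
    in place of [v] it has one with [p . v <= d], hence one with [p . v = d]. A measurable choice is the
    lexicographic minimum. *)

Require Import Defs.
From Stdlib Require Import ZArith Reals Lra Lia List Classical ClassicalChoice FunctionalExtensionality.
From Stdlib Require Import Arith.Cantor.
From Stdlib Require Vectors.Fin.
(* [Defs] again: [Reals] has its own [dist]. *)
Import ListNotations Defs.
Open Scope R_scope.

(** * Vectors *)

(** A subsolution controls only a minimum on the boundary, so [H <= 0] can be read off a boundary
    contact only by violating the oblique inequality, which the momentum sought must nevertheless
    satisfy. This conflict is why the excess slope along [gamma] has to be tunable and vanish in the
    limit. The Lipschitz bound does not face it: nothing about [g] has to survive there, so
    arbitrarily steep cones may be used. It has to be available before the blow-up, since it is what
    bounds [u] on the edges of the tested region and so keeps contact points off them. Coercivity is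
    assumed separately at each point; convexity along rays from the origin and compactness of the
    closure make it uniform. Differentiability almost everywhere comes from covering arguments
    alone, without integrals: Austin's proof for functions of bounded variation, applied on short
    windows. For the selection, the constraint [p . v = d] must be measurable in time for fixed [p];
    it is so because [p . v - d] is the derivative of the continuous function [p . eta - u o eta],
    hence a limit of difference quotients. *)

Lemma Rabs_le_inv a b : Rabs a <= b -> - b <= a <= b.
Proof. intro A; generalize (Rle_abs a) (Rle_abs (- a)); rewrite Rabs_Ropp; lra. Qed.

Lemma sumFin_ext n (f h : Fin.t n -> R) : (forall i, f i = h i) -> sumFin n f = sumFin n h.
Proof.
  intros E; replace h with f; [reflexivity|].
  apply functional_extensionality; exact E.
Qed.

Lemma sumFin_lin n (a b : R) (f h : Fin.t n -> R) :
  sumFin n (fun i => a * f i + b * h i) = a * sumFin n f + b * sumFin n h.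
Proof.
  induction n as [|n IH]; simpl; [ring|].
  rewrite (IH (fun i => f (Fin.FS i)) (fun i => h (Fin.FS i))); ring.
Qed.

Lemma sumFin_nonneg n (f : Fin.t n -> R) : (forall i, 0 <= f i) -> 0 <= sumFin n f.
Proof.
  induction n as [|n IH]; simpl; intros P; [lra|].
  specialize (IH (fun i => f (Fin.FS i)) (fun i => P (Fin.FS i))).
  specialize (P Fin.F1); lra.
Qed.

Lemma sumFin_ge n (f : Fin.t n -> R) (i : Fin.t n) : (forall j, 0 <= f j) -> f i <= sumFin n f.
Proof.
  revert f; induction i as [n|n i IH]; intros f P; simpl.
  - generalize (sumFin_nonneg n (fun i => f (Fin.FS i)) (fun i => P (Fin.FS i))); lra.
  - generalize (IH (fun i => f (Fin.FS i)) (fun i => P (Fin.FS i))).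
    specialize (P Fin.F1); lra.
Qed.

Lemma dot_comm n (x y : vec n) : dot x y = dot y x.
Proof. apply sumFin_ext; intro i; ring. Qed.

Lemma dot_add_r n (x y z : vec n) : dot x (vadd y z) = dot x y + dot x z.
Proof.
  unfold dot, vadd.
  rewrite (sumFin_ext n _ (fun i => 1 * (x i * y i) + 1 * (x i * z i))) by (intro; ring).
  rewrite sumFin_lin; ring.
Qed.

Lemma dot_scale_r n c (x y : vec n) : dot x (vscale c y) = c * dot x y.
Proof.
  unfold dot, vscale.
  rewrite (sumFin_ext n _ (fun i => c * (x i * y i) + 0 * (x i * y i))) by (intro; ring).
  rewrite sumFin_lin; ring.
Qed.

Lemma dot_sub_r n (x y z : vec n) : dot x (vsub y z) = dot x y - dot x z.
Proof.
  unfold dot, vsub.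
  rewrite (sumFin_ext n _ (fun i => 1 * (x i * y i) + (-1) * (x i * z i))) by (intro; ring).
  rewrite sumFin_lin; ring.
Qed.

Lemma dot_add_l n (x y z : vec n) : dot (vadd y z) x = dot y x + dot z x.
Proof. rewrite dot_comm, dot_add_r, !(dot_comm n x); ring. Qed.
Lemma dot_scale_l n c (x y : vec n) : dot (vscale c y) x = c * dot y x.
Proof. rewrite dot_comm, dot_scale_r, (dot_comm n x); ring. Qed.
Lemma dot_sub_l n (x y z : vec n) : dot (vsub y z) x = dot y x - dot z x.
Proof. rewrite dot_comm, dot_sub_r, !(dot_comm n x); ring. Qed.

Definition vzero {n} : vec n := fun _ => 0.

Lemma dot_0_r n (x : vec n) : dot x vzero = 0.
Proof.
  replace (@vzero n) with (vscale 0 x) by (apply functional_extensionality; intro; unfold vscale, vzero; ring).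
  rewrite dot_scale_r; ring.
Qed.
Lemma dot_0_l n (x : vec n) : dot vzero x = 0.
Proof. rewrite dot_comm; apply dot_0_r. Qed.

Ltac dots := repeat (progress rewrite ?dot_add_r, ?dot_add_l, ?dot_sub_r, ?dot_sub_l,
  ?dot_scale_r, ?dot_scale_l, ?dot_0_r, ?dot_0_l).
Ltac vext := apply functional_extensionality; intro;
  unfold vadd, vsub, vscale, vzero; try ring.

Lemma dot_self_nonneg n (x : vec n) : 0 <= dot x x.
Proof. apply sumFin_nonneg; intro i; apply Rle_0_sqr. Qed.

Lemma vnorm_nonneg n (x : vec n) : 0 <= vnorm x.
Proof. apply sqrt_pos. Qed.

Lemma vnorm_sq n (x : vec n) : vnorm x * vnorm x = dot x x.
Proof. apply sqrt_sqrt, dot_self_nonneg. Qed.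

Lemma vnorm_le_sq n (x : vec n) c : 0 <= c -> dot x x <= c * c -> vnorm x <= c.
Proof.
  intros Hc E. apply Rsqr_incr_0_var; [|exact Hc].
  unfold Rsqr; rewrite vnorm_sq; exact E.
Qed.

Lemma vnorm_0 n : vnorm (@vzero n) = 0.
Proof. unfold vnorm; rewrite dot_0_r; apply sqrt_0. Qed.

Lemma coord_le_vnorm n (x : vec n) i : Rabs (x i) <= vnorm x.
Proof.
  apply Rsqr_incr_0_var; [|apply vnorm_nonneg].
  rewrite <- Rsqr_abs; unfold Rsqr; rewrite vnorm_sq.
  apply (sumFin_ge n (fun i => x i * x i)); intro; apply Rle_0_sqr.
Qed.

Lemma vnorm_eq_0 n (x : vec n) : vnorm x = 0 -> x = vzero.
Proof.
  intros E; apply functional_extensionality; intro i.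
  generalize (coord_le_vnorm n x i); rewrite E; unfold vzero; intro A.
  destruct (Req_dec (x i) 0) as [|N]; [assumption|].
  generalize (Rabs_pos_lt _ N); lra.
Qed.

Lemma cauchy_schwarz n (x y : vec n) : dot x y <= vnorm x * vnorm y.
Proof.
  destruct (Req_dec (vnorm y) 0) as [E|N].
  - rewrite E, (vnorm_eq_0 n y E), dot_0_r; lra.
  - generalize (vnorm_nonneg n x) (vnorm_nonneg n y); intros Px Py.
    apply Rnot_lt_le; intro C.
    generalize (dot_self_nonneg n (vsub (vscale (dot y y) x) (vscale (dot x y) y))).
    dots. rewrite (dot_comm n y x).
    rewrite <- !vnorm_sq.
    set (a := vnorm x) in *; set (b := vnorm y) in *; set (d := dot x y) in *.
    intro K.
    assert (K2 : 0 <= (b * b) * ((a * b) * (a * b) - d * d)) by (ring_simplify in K; ring_simplify; lra).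
    assert (0 < b * b) by nra.
    assert (0 <= a * b) by nra.
    assert ((a * b) * (a * b) < d * d) by nra.
    nra.
Qed.

Lemma vnorm_scale n c (x : vec n) : vnorm (vscale c x) = Rabs c * vnorm x.
Proof.
  unfold vnorm; dots. replace (c * (c * dot x x)) with (Rsqr c * dot x x) by (unfold Rsqr; ring).
  rewrite sqrt_mult; [|apply Rle_0_sqr|apply dot_self_nonneg].
  now rewrite sqrt_Rsqr_abs.
Qed.

Lemma cauchy_schwarz_abs n (x y : vec n) : Rabs (dot x y) <= vnorm x * vnorm y.
Proof.
  apply Rabs_le; split; [|apply cauchy_schwarz].
  generalize (cauchy_schwarz n (vscale (-1) x) y).
  rewrite vnorm_scale, dot_scale_l, Rabs_left by lra; lra.
Qed.

Lemma vnorm_add n (x y : vec n) : vnorm (vadd x y) <= vnorm x + vnorm y.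
Proof.
  generalize (vnorm_nonneg n x) (vnorm_nonneg n y) (cauchy_schwarz n x y); intros.
  apply vnorm_le_sq; [lra|]. dots.
  generalize (vnorm_sq n x) (vnorm_sq n y). rewrite (dot_comm n y x). nra.
Qed.

Lemma vnorm_sub n (x y : vec n) : vnorm (vsub x y) <= vnorm x + vnorm y.
Proof.
  replace (vsub x y) with (vadd x (vscale (-1) y)) by vext.
  eapply Rle_trans; [apply vnorm_add|]. rewrite vnorm_scale, Rabs_left by lra; lra.
Qed.

Lemma dist_sym n (x y : vec n) : dist x y = dist y x.
Proof.
  unfold dist. replace (vsub x y) with (vscale (-1) (vsub y x)) by vext.
  rewrite vnorm_scale, Rabs_left by lra; ring.
Qed.

Lemma dist_tri n (x y z : vec n) : dist x z <= dist x y + dist y z.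
Proof.
  unfold dist. replace (vsub x z) with (vadd (vsub x y) (vsub y z)) by vext. apply vnorm_add.
Qed.

Lemma dist_refl n (x : vec n) : dist x x = 0.
Proof. unfold dist. replace (vsub x x) with (@vzero n) by vext. apply vnorm_0. Qed.

Lemma dist_nonneg n (x y : vec n) : 0 <= dist x y.
Proof. apply vnorm_nonneg. Qed.

Lemma vnorm_dist_le n (x y : vec n) : vnorm x <= vnorm y + dist x y.
Proof. unfold dist. replace x with (vadd y (vsub x y)) at 1 by vext. apply vnorm_add. Qed.

Lemma dist_coord n (x y : vec n) i : Rabs (x i - y i) <= dist x y.
Proof. exact (coord_le_vnorm n (vsub x y) i). Qed.

Lemma vnorm_coord_bound n (x : vec n) c : 0 <= c -> (forall i, Rabs (x i) <= c) -> vnorm x <= INR n * c.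
Proof.
  intros Hc P. apply vnorm_le_sq; [apply Rmult_le_pos; [apply pos_INR|exact Hc]|].
  apply Rle_trans with (INR n * (c * c)).
  - unfold dot; induction n as [|n IH]; [simpl; lra|].
    rewrite S_INR; simpl.
    specialize (IH (fun i => x (Fin.FS i)) (fun i => P (Fin.FS i))).
    specialize (P Fin.F1). apply Rabs_le_inv in P. nra.
  - destruct n as [|n]; [simpl; lra|].
    assert (1 <= INR (S n)) by (rewrite S_INR; generalize (pos_INR n); lra).
    assert (0 <= c * c) by nra. nra.
Qed.

(** * Compactness *)

Lemma inv_INR_S_pos k : 0 < / INR (S k).
Proof. apply Rinv_0_lt_compat, lt_0_INR; lia. Qed.

Lemma inv_INR_S_lt eps : 0 < eps -> exists N, forall k, (N <= k)%nat -> / INR (S k) < eps.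
Proof.
  intros He. destruct (archimed_cor1 eps He) as [N [HN Np]]. exists N; intros k Hk.
  apply Rle_lt_trans with (/ INR N); [|exact HN].
  apply Rinv_le_contravar; [apply lt_0_INR; exact Np|apply le_INR; lia].
Qed.

Lemma inv_INR_S_antitone j k : (j <= k)%nat -> / INR (S k) <= / INR (S j).
Proof. intros; apply Rinv_le_contravar; [apply lt_0_INR; lia|apply le_INR; lia]. Qed.

Lemma bolzano_weierstrass_R (x : nat -> R) M : (forall k, Rabs (x k) <= M) ->
  exists l (phi : nat -> nat), forall k, (k <= phi k)%nat /\ Rabs (x (phi k) - l) < / INR (S k).
Proof.
  intros HM.
  destruct (Bolzano_Weierstrass x (fun c => - M <= c <= M) (compact_P3 (- M) M)
    (fun k => Rabs_le_inv _ _ (HM k))) as [l Hl].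
  exists l.
  destruct (choice (fun k j => (k <= j)%nat /\ Rabs (x j - l) < / INR (S k))) as [phi Hphi].
  - intro k.
    assert (D : 0 < / INR (S k)) by apply inv_INR_S_pos.
    destruct (Hl (disc l (mkposreal _ D)) k) as [j [Hj Hd]].
    + exists (mkposreal _ D); intros y Hy; exact Hy.
    + exists j; split; [exact Hj|exact Hd].
  - exists phi; exact Hphi.
Qed.

Lemma bolzano_weierstrass_coords n (x : nat -> vec n) M : (forall k i, Rabs (x k i) <= M) ->
  exists (l : vec n) (phi : nat -> nat),
    forall k, (k <= phi k)%nat /\ forall i, Rabs (x (phi k) i - l i) < / INR (S k).
Proof.
  induction n as [|n IH]; intros HM.
  - exists vzero, (fun k => k); intro k; split; [lia|]. intro i; apply Fin.case0; exact i.
  - destruct (IH (fun k i => x k (Fin.FS i)) (fun k i => HM k (Fin.FS i))) as [l [phi Hphi]].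
    destruct (bolzano_weierstrass_R (fun k => x (phi k) Fin.F1) M (fun k => HM _ _)) as [l1 [psi Hpsi]].
    exists (fun i => Fin.caseS' i (fun _ => R) l1 l), (fun k => phi (psi k)).
    intro k. destruct (Hpsi k) as [P1 P2]. destruct (Hphi (psi k)) as [P3 P4].
    split; [lia|]. intro i. apply (Fin.caseS' i); simpl; [exact P2|].
    intro j. eapply Rlt_le_trans; [apply P4|]. apply inv_INR_S_antitone; exact P1.
Qed.

Lemma bolzano_weierstrass n (x : nat -> vec n) M : (forall k, vnorm (x k) <= M) ->
  exists (l : vec n) (phi : nat -> nat), forall eps, 0 < eps ->
    exists N, forall k, (N <= k)%nat -> (k <= phi k)%nat /\ dist (x (phi k)) l < eps.
Proof.
  intros HM.
  destruct (bolzano_weierstrass_coords n x M) as [l [phi Hphi]].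
  { intros k i; eapply Rle_trans; [apply coord_le_vnorm|apply HM]. }
  exists l, phi; intros eps He.
  destruct (inv_INR_S_lt (eps / (INR n + 1))) as [N HN].
  { apply Rdiv_lt_0_compat; [exact He|generalize (pos_INR n); lra]. }
  exists N; intros k Hk; destruct (Hphi k) as [P1 P2]; split; [exact P1|].
  assert (P := pos_INR n). specialize (HN k Hk).
  apply Rle_lt_trans with (INR n * / INR (S k)).
  - apply vnorm_coord_bound; [left; apply inv_INR_S_pos|]. intro i; left; apply P2.
  - assert (Q := inv_INR_S_pos k).
    apply (Rmult_lt_compat_r (INR n + 1)) in HN; [|lra].
    unfold Rdiv in HN; rewrite Rmult_assoc, Rinv_l in HN by lra. nra.
Qed.

Lemma compact_max n (P : vec n -> Prop) (f : vec n -> R) M :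
  (forall x, P x -> vnorm x <= M) ->
  (forall x, (forall eps, 0 < eps -> exists y, P y /\ dist y x < eps) -> P x) ->
  cont_on P f -> (exists x, P x) ->
  exists x, P x /\ forall y, P y -> f y <= f x.
Proof.
  intros HM Hcl Hc [x0 Hx0].
  assert (lim : forall x : nat -> vec n, (forall k, P (x k)) ->
    exists l, P l /\ forall eps, 0 < eps -> forall N, exists k, (N <= k)%nat /\ Rabs (f (x k) - f l) < eps).
  { intros x Hx. destruct (bolzano_weierstrass n x M (fun k => HM _ (Hx k))) as [l [phi Hphi]].
    assert (Hl : P l).
    { apply Hcl; intros eps He; destruct (Hphi eps He) as [N HN].
      exists (x (phi N)); split; [apply Hx|apply HN; lia]. }
    exists l; split; [exact Hl|]. intros eps He N.
    destruct (Hc l Hl eps He) as [d [Hd Hf]]. destruct (Hphi d Hd) as [N' HN'].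
    destruct (HN' (max N N') ltac:(lia)) as [A B].
    exists (phi (max N N')); split; [lia|]. apply Hf; [apply Hx|exact B]. }
  destruct (completeness (fun c => exists x, P x /\ c = f x)) as [s [Hs1 Hs2]].
  - destruct (classic (exists B, forall x, P x -> f x <= B)) as [[B HB]|N].
    + exists B; intros c [x [Hx ->]]; auto.
    + exfalso.
      destruct (choice (fun (k : nat) x => P x /\ INR k < f x)) as [x Hx].
      { intro k. apply NNPP; intro C; apply N; exists (INR k); intros x Hx.
        apply Rnot_lt_le; intro; apply C; exists x; auto. }
      destruct (lim x (fun k => proj1 (Hx k))) as [l [_ Hl]].
      destruct (INR_unbounded (f l + 1)) as [N1 HN1].
      destruct (Hl 1 ltac:(lra) N1) as [k [Hk Hk2]].
      apply Rabs_def2 in Hk2. destruct (Hx k) as [_ Hxk]. apply le_INR in Hk. lra.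
  - exists (f x0), x0; auto.
  - destruct (choice (fun (k : nat) x => P x /\ s - / INR (S k) < f x)) as [x Hx].
    { intro k. apply NNPP; intro C.
      assert (s <= s - / INR (S k)); [|generalize (inv_INR_S_pos k); lra].
      apply Hs2; intros c [x [Hx ->]]. apply Rnot_lt_le; intro; apply C; exists x; auto. }
    destruct (lim x (fun k => proj1 (Hx k))) as [l [Pl Hl]].
    exists l; split; [exact Pl|]. intros y Hy.
    assert (f y <= s) by (apply Hs1; exists y; auto).
    apply Rnot_lt_le; intro C.
    destruct (inv_INR_S_lt ((f y - f l) / 2)) as [N HN]; [lra|].
    destruct (Hl ((f y - f l) / 2) ltac:(lra) N) as [k [Hk Hk2]].
    specialize (HN k Hk). destruct (Hx k) as [_ Hxk]. apply Rabs_def2 in Hk2. lra.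
Qed.

(** * Test functions *)

Lemma cont_on_lin n (P : vec n -> Prop) f h a b :
  cont_on P f -> cont_on P h -> cont_on P (fun x => a * f x + b * h x).
Proof.
  intros Hf Hh x Px eps He.
  assert (Pa := Rabs_pos a). assert (Pb := Rabs_pos b).
  set (K := Rabs a + Rabs b + 1).
  assert (HK : 0 < K) by (unfold K; lra).
  destruct (Hf x Px (eps / K) (Rdiv_lt_0_compat _ _ He HK)) as [d1 [D1 F1]].
  destruct (Hh x Px (eps / K) (Rdiv_lt_0_compat _ _ He HK)) as [d2 [D2 F2]].
  exists (Rmin d1 d2); split; [apply Rmin_pos; assumption|].
  intros y Py Hy.
  specialize (F1 y Py (Rlt_le_trans _ _ _ Hy (Rmin_l _ _))).
  specialize (F2 y Py (Rlt_le_trans _ _ _ Hy (Rmin_r _ _))).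
  replace (a * f y + b * h y - (a * f x + b * h x)) with (a * (f y - f x) + b * (h y - h x)) by ring.
  eapply Rle_lt_trans; [apply Rabs_triang|]. rewrite !Rabs_mult.
  apply Rle_lt_trans with ((Rabs a + Rabs b) * (eps / K)).
  - rewrite Rmult_plus_distr_r. apply Rplus_le_compat; apply Rmult_le_compat_l; lra.
  - assert (E : K * (eps / K) = eps) by (field; lra).
    assert (0 < eps / K) by (apply Rdiv_lt_0_compat; assumption). unfold K at 1 in E. lra.
Qed.

Lemma cont_on_of_modulus n (P : vec n -> Prop) (f : vec n -> R) :
  (forall x, exists A B, 0 <= A /\ 0 <= B /\
     forall y, Rabs (f y - f x) <= A * dist y x + B * (dist y x * dist y x)) -> cont_on P f.
Proof.
  intros Hf x _ eps He. destruct (Hf x) as [A [B [PA [PB Hy]]]].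
  set (K := A + B + 1).
  exists (Rmin 1 (eps / K)). assert (HK : 0 < K) by (unfold K; lra).
  split; [apply Rmin_pos; [lra|apply Rdiv_lt_0_compat; assumption]|].
  intros y _ Hd. eapply Rle_lt_trans; [apply Hy|].
  assert (D1 := Rlt_le_trans _ _ _ Hd (Rmin_l _ _)).
  assert (D2 := Rlt_le_trans _ _ _ Hd (Rmin_r _ _)).
  assert (D0 := dist_nonneg n y x).
  apply (Rmult_lt_compat_l K) in D2; [|exact HK].
  replace (K * (eps / K)) with eps in D2 by (field; lra). unfold K in D2.
  assert (B * (dist y x * dist y x) <= B * dist y x) by (apply Rmult_le_compat_l; nra).
  nra.
Qed.

Lemma cont_on_dot n (P : vec n -> Prop) b : cont_on P (fun x => dot b x).
Proof.
  apply cont_on_of_modulus; intro x; exists (vnorm b), 0.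
  split; [apply vnorm_nonneg|split; [lra|]]. intro y.
  rewrite <- dot_sub_r, Rmult_0_l, Rplus_0_r. apply cauchy_schwarz_abs.
Qed.

Lemma cont_on_vnorm n (P : vec n -> Prop) : cont_on P vnorm.
Proof.
  apply cont_on_of_modulus; intro x; exists 1, 0. split; [lra|split; [lra|]]. intro y.
  generalize (vnorm_dist_le n x y) (vnorm_dist_le n y x). rewrite (dist_sym n x y).
  intros; apply Rabs_le; lra.
Qed.

Lemma cont_on_comp_R n (P : vec n -> Prop) f (k : R -> R) :
  cont_on P f -> (forall x, P x -> continuity_pt k (f x)) -> cont_on P (fun x => k (f x)).
Proof.
  intros Hf Hk x Px eps He.
  destruct (Hk x Px eps He) as [d [Hd Hkd]].
  destruct (Hf x Px d Hd) as [d' [Hd' Hfd]].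
  exists d'; split; [exact Hd'|]. intros y Py Hy. specialize (Hfd y Py Hy).
  destruct (Req_dec (f x) (f y)) as [E|N].
  - rewrite E, Rminus_diag, Rabs_R0; exact He.
  - apply Hkd. split; [split; [exact I|exact N]|exact Hfd].
Qed.

Lemma cont_on_ext n (P : vec n -> Prop) f h : (forall x, f x = h x) -> cont_on P f -> cont_on P h.
Proof. intros E; replace h with f; [auto|apply functional_extensionality; exact E]. Qed.

Lemma dist_translate n h (x w w' : vec n) : 0 <= h ->
  dist (vadd x (vscale h w')) (vadd x (vscale h w)) = h * dist w' w.
Proof.
  intros Hh. unfold dist.
  replace (vsub (vadd x (vscale h w')) (vadd x (vscale h w))) with (vscale h (vsub w' w)) by vext.
  rewrite vnorm_scale, Rabs_pos_eq; auto.
Qed.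

Lemma closure_incl n (O : vec n -> Prop) x : O x -> closure O x.
Proof. intros Ox eps He; exists x; rewrite dist_refl; auto. Qed.

Lemma closure_closed n (O : vec n -> Prop) x :
  (forall eps, 0 < eps -> exists y, closure O y /\ dist y x < eps) -> closure O x.
Proof.
  intros Hx eps He. destruct (Hx (eps / 2)) as [y [Hy Dy]]; [lra|].
  destruct (Hy (eps / 2)) as [z [Hz Dz]]; [lra|].
  exists z; split; [exact Hz|]. generalize (dist_tri n z y x); lra.
Qed.

Lemma nonneg_of_cont n (S : vec n -> R) x : cont_on whole S ->
  (forall eps, 0 < eps -> exists y, 0 <= S y /\ dist y x < eps) -> 0 <= S x.
Proof.
  intros HS Hx. apply Rnot_lt_le; intro C.
  destruct (HS x I (- S x)) as [d [Hd Hy]]; [lra|].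
  destruct (Hx d Hd) as [y [Sy Dy]]. specialize (Hy y I Dy). apply Rabs_def2 in Hy. lra.
Qed.

(* [Phi] is only required to be touched from above by a paraboloid where it touches [u]; this gives
   a superdifferential even though [Phi] may fail to be differentiable, or smooth, elsewhere. *)
Lemma superdiff_at_max n (O : vec n -> Prop) (u : vec n -> R) (x : vec n) (h R0 m : R)
  (Phi S : vec n -> R) (G : vec n -> vec n) (z1 : vec n) :
  cont_on (closure O) u -> 0 < h -> cont_on whole Phi -> cont_on whole S ->
  (forall w, 0 < S w -> exists C, 0 <= C /\ forall z,
     Phi z <= Phi w + dot (G w) (vsub z w) + C * dot (vsub z w) (vsub z w)) ->
  (forall w, vnorm w <= R0 -> 0 <= S w -> closure O (vadd x (vscale h w)) ->
     S w = 0 \/ vnorm w = R0 -> u (vadd x (vscale h w)) - h * Phi w <= u x + h * m) ->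
  vnorm z1 <= R0 -> 0 <= S z1 -> closure O (vadd x (vscale h z1)) ->
  u x + h * m < u (vadd x (vscale h z1)) - h * Phi z1 ->
  exists w, vnorm w < R0 /\ 0 < S w /\ closure O (vadd x (vscale h w)) /\
    superdiff (closure O) u (vadd x (vscale h w)) (G w).
Proof.
  intros Hu Hh HPhi HS Hsemi Hface N1 S1 C1 V1.
  set (T := fun w => vadd x (vscale h w)).
  change (vadd x (vscale h z1)) with (T z1) in C1, V1.
  (* [S] cuts the ball down to the region under test. In the uses below the norm removes the vertex
     of a cone, a linear form keeps a half-space, and a positive constant imposes nothing. *)
  set (D := fun w => vnorm w <= R0 /\ 0 <= S w /\ closure O (T w)).
  assert (HT : forall w w', dist (T w') (T w) = h * dist w' w)
    by (intros; apply dist_translate; lra).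
  destruct (compact_max n D (fun w => u (T w) - h * Phi w) R0) as [w [[W1 [W2 W3]] Wmax]].
  - intros w Hw; apply Hw.
  - intros w Hw; repeat split.
    + apply Rnot_lt_le; intro C. destruct (Hw (vnorm w - R0)) as [y [[Hy _] Dy]]; [lra|].
      generalize (vnorm_dist_le n w y). rewrite dist_sym. lra.
    + apply nonneg_of_cont; [exact HS|]. intros eps He. destruct (Hw eps He) as [y [[_ [Hy _]] Dy]].
      exists y; auto.
    + apply closure_closed; intros eps He.
      destruct (Hw (eps / h)) as [y [[_ [_ Hy]] Dy]]; [apply Rdiv_lt_0_compat; assumption|].
      exists (T y); split; [exact Hy|]. rewrite HT.
      apply (Rmult_lt_compat_l h) in Dy; [|exact Hh].
      replace (h * (eps / h)) with eps in Dy by (field; lra). exact Dy.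
  - apply (cont_on_ext n D (fun w => 1 * u (T w) + (- h) * Phi w)); [intro; ring|].
    apply cont_on_lin.
    + intros w [_ [_ Hw]] eps He. destruct (Hu (T w) Hw eps He) as [d [Hd Hf]].
      exists (d / h); split; [apply Rdiv_lt_0_compat; assumption|].
      intros y [_ [_ Hy]] Dy. apply Hf; [exact Hy|]. rewrite HT.
      apply (Rmult_lt_compat_l h) in Dy; [|exact Hh].
      replace (h * (d / h)) with d in Dy by (field; lra). exact Dy.
    + intros w _ eps He. destruct (HPhi w I eps He) as [d [Hd Hf]].
      exists d; split; [exact Hd|]; intros; apply Hf; [exact I|assumption].
  - exists z1; unfold D; auto.
  - assert (Wz := Wmax z1 ltac:(unfold D; auto)). cbv beta in Wz.
    (* [z1] lies above the level [u x + h * m], which no point of the two faces exceeds, so the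
       maximum is attained off them. *)
    assert (W1' : vnorm w < R0).
    { destruct W1 as [|E]; [assumption|]. specialize (Hface w ltac:(lra) W2 W3 (or_intror E)).
      change (vadd x (vscale h w)) with (T w) in Hface. lra. }
    assert (W2' : 0 < S w).
    { destruct W2 as [|E]; [assumption|].
      specialize (Hface w W1 ltac:(lra) W3 (or_introl (eq_sym E))).
      change (vadd x (vscale h w)) with (T w) in Hface. lra. }
    exists w; split; [exact W1'|split; [exact W2'|split; [exact W3|]]].
    change (vadd x (vscale h w)) with (T w).
    destruct (Hsemi w W2') as [C [HC HPw]].
    intros eps He.
    destruct (HS w I (S w) W2') as [d1 [Hd1 HS1]].
    (* The first two radii keep the rescaled point in the tested region; the third makes the
       quadratic error of the paraboloid at most [eps] times the distance. *)
    set (d := Rmin (Rmin (h * d1) (h * (R0 - vnorm w))) (eps * h / (C + 1))).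
    exists d; split.
    { unfold d; repeat apply Rmin_pos; try nra. apply Rdiv_lt_0_compat; nra. }
    intros y Hy Dy.
    set (z := vscale (/ h) (vsub y x)).
    assert (Ez : T z = y) by (unfold T, z; vext; field; lra).
    assert (Dz : h * dist z w = dist y (T w)) by (rewrite <- HT, Ez; reflexivity).
    assert (Dy1 : dist y (T w) < h * d1)
      by (eapply Rlt_le_trans; [exact Dy|]; eapply Rle_trans; [apply Rmin_l|apply Rmin_l]).
    assert (Dy2 : dist y (T w) < h * (R0 - vnorm w))
      by (eapply Rlt_le_trans; [exact Dy|]; eapply Rle_trans; [apply Rmin_l|apply Rmin_r]).
    assert (Dy3 : dist y (T w) < eps * h / (C + 1))
      by (eapply Rlt_le_trans; [exact Dy|]; apply Rmin_r).
    rewrite <- Dz in Dy1, Dy2.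
    apply Rmult_lt_reg_l in Dy1; [|exact Hh]. apply Rmult_lt_reg_l in Dy2; [|exact Hh].
    assert (Hz : D z).
    { unfold D; rewrite Ez; repeat split; [|specialize (HS1 z I Dy1); apply Rabs_def2 in HS1; lra|exact Hy].
      generalize (vnorm_dist_le n z w); lra. }
    specialize (Wmax z Hz). specialize (HPw z). cbv beta in Wmax. rewrite Ez in Wmax.
    replace (dot (G w) (vsub y (T w))) with (h * dot (G w) (vsub z w)).
    2:{ rewrite <- dot_scale_r; f_equal. unfold z, T; vext; field; lra. }
    rewrite <- (vnorm_sq n (vsub z w)) in HPw.
    change (vnorm (vsub z w)) with (dist z w) in HPw.
    assert (P0 := dist_nonneg n z w).
    assert (Q : h * (C * (dist z w * dist z w)) <= eps * dist y (T w)).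
    { rewrite <- Dz. rewrite <- Dz in Dy3.
      apply (Rmult_lt_compat_r (C + 1)) in Dy3; [|lra].
      replace (eps * h / (C + 1) * (C + 1)) with (h * eps) in Dy3 by (field; lra).
      assert (Dy4 : dist z w * (C + 1) < eps) by nra.
      replace (h * (C * (dist z w * dist z w))) with ((C * dist z w) * (h * dist z w)) by ring.
      apply Rmult_le_compat_r; nra. }
    apply (Rmult_le_compat_l h) in HPw; [|lra]. lra.
Qed.

Lemma superdiff_interior n (O : vec n -> Prop) u x p : is_open O -> O x ->
  superdiff (closure O) u x p -> superdiff whole u x p.
Proof.
  intros HO Ox Hp eps He. destruct (HO x Ox) as [r [Hr Hin]]. destruct (Hp eps He) as [d [Hd Hy]].
  exists (Rmin r d); split; [apply Rmin_pos; assumption|]. intros y _ Dy. apply Hy.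
  - apply closure_incl, Hin. eapply Rlt_le_trans; [exact Dy|apply Rmin_l].
  - eapply Rlt_le_trans; [exact Dy|apply Rmin_r].
Qed.

(** When the minimum of two quantities is nonpositive and the second is positive, the first is
    nonpositive; at interior points the closure is a full neighbourhood, so both kinds of
    superdifferential agree. *)
Lemma subsol_test n (O : vec n -> Prop) H gamma g u x p : is_open O ->
  visc_subsol O H gamma g u -> closure O x -> superdiff (closure O) u x p ->
  (boundary O x -> g x < dot (gamma x) p) -> H x p <= 0.
Proof.
  intros HO [_ [Hin Hbd]] Cx Hp Hg.
  destruct (classic (O x)) as [Ox|Nx].
  - apply Hin; [exact Ox|]. apply (superdiff_interior n O); assumption.
  - assert (Bx : boundary O x) by (split; assumption).
    specialize (Hbd x p Bx Hp). specialize (Hg Bx). revert Hbd. unfold Rmin.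
    destruct (Rle_dec _ _); lra.
Qed.

(** * Oblique coordinates *)

(* [oblE] projects along [span(v, c)] when [s, b] is the basis dual to [v, c]. *)
Definition oblE {n} (v s c b z : vec n) : vec n :=
  vsub z (vadd (vscale (dot s z) v) (vscale (dot b z) c)).
Definition oblEt {n} (v s c b q : vec n) : vec n :=
  vsub q (vadd (vscale (dot q v) s) (vscale (dot q c) b)).
(** For [s, b] dual to [v, c] this form vanishes exactly on the line of [v], so adding it to a test
    function penalises every other direction and leaves slopes along [v] unchanged. As [oblE] kills
    [c], its derivative along [c] is [2 * dot b z], a multiple of the signed distance. [oblQg] is
    its gradient and [oblEt] the adjoint of [oblE]. *)
Definition oblQ {n} (v s c b z : vec n) : R :=
  dot (oblE v s c b z) (oblE v s c b z) + dot b z * dot b z.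
Definition oblQg {n} (v s c b z : vec n) : vec n :=
  vscale 2 (vadd (oblEt v s c b (oblE v s c b z)) (vscale (dot b z) b)).

Lemma oblE_sub n (v s c b y z : vec n) :
  oblE v s c b (vsub y z) = vsub (oblE v s c b y) (oblE v s c b z).
Proof. unfold oblE; rewrite !dot_sub_r; vext. Qed.

Lemma oblEt_dot n (v s c b q z : vec n) : dot (oblEt v s c b q) z = dot q (oblE v s c b z).
Proof. unfold oblEt, oblE. dots. ring. Qed.

Lemma oblQg_dot n (v s c b z e : vec n) :
  dot (oblQg v s c b z) e = 2 * (dot (oblE v s c b z) (oblE v s c b e) + dot b z * dot b e).
Proof. unfold oblQg. dots. rewrite oblEt_dot. reflexivity. Qed.

Lemma oblQ_expand n (v s c b z w : vec n) :
  oblQ v s c b z = oblQ v s c b w + dot (oblQg v s c b w) (vsub z w) + oblQ v s c b (vsub z w).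
Proof.
  rewrite oblQg_dot. unfold oblQ. rewrite !oblE_sub. dots.
  rewrite (dot_comm n (oblE v s c b z) (oblE v s c b w)). ring.
Qed.

Lemma oblQ_nonneg n (v s c b z : vec n) : 0 <= oblQ v s c b z.
Proof. unfold oblQ. generalize (dot_self_nonneg n (oblE v s c b z)); nra. Qed.

Lemma oblE_bound n (v s c b z : vec n) :
  vnorm (oblE v s c b z) <= (1 + vnorm s * vnorm v + vnorm b * vnorm c) * vnorm z.
Proof.
  unfold oblE. eapply Rle_trans; [apply vnorm_sub|].
  assert (A := vnorm_add n (vscale (dot s z) v) (vscale (dot b z) c)).
  rewrite !vnorm_scale in A.
  assert (B1 := cauchy_schwarz_abs n s z). assert (B2 := cauchy_schwarz_abs n b z).
  assert (P1 := vnorm_nonneg n v). assert (P2 := vnorm_nonneg n c).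
  apply (Rmult_le_compat_r (vnorm v)) in B1; [|exact P1].
  apply (Rmult_le_compat_r (vnorm c)) in B2; [|exact P2]. lra.
Qed.

Lemma oblQ_bound n (v s c b : vec n) :
  exists K, 0 <= K /\ forall z, oblQ v s c b z <= K * dot z z.
Proof.
  set (k := 1 + vnorm s * vnorm v + vnorm b * vnorm c).
  assert (Hk : 0 <= k).
  { unfold k. assert (0 <= vnorm s * vnorm v) by (apply Rmult_le_pos; apply vnorm_nonneg).
    assert (0 <= vnorm b * vnorm c) by (apply Rmult_le_pos; apply vnorm_nonneg). lra. }
  exists (k * k + vnorm b * vnorm b). split; [generalize (vnorm_nonneg n b); nra|]. intro z.
  unfold oblQ. rewrite <- !vnorm_sq.
  assert (A := oblE_bound n v s c b z). fold k in A.
  assert (B := cauchy_schwarz_abs n b z).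
  assert (P1 := vnorm_nonneg n (oblE v s c b z)).
  assert (C : dot b z * dot b z = Rabs (dot b z) * Rabs (dot b z)).
  { rewrite <- Rabs_mult, Rabs_pos_eq; [reflexivity|apply Rle_0_sqr]. }
  rewrite C. assert (P2 := Rabs_pos (dot b z)).
  assert (E1 := Rmult_le_compat _ _ _ _ P1 P1 A A).
  assert (E2 := Rmult_le_compat _ _ _ _ P2 P2 B B). lra.
Qed.

Lemma oblEt_bound n (v s c b q : vec n) :
  vnorm (oblEt v s c b q) <= (1 + vnorm s * vnorm v + vnorm b * vnorm c) * vnorm q.
Proof.
  unfold oblEt. eapply Rle_trans; [apply vnorm_sub|].
  assert (A := vnorm_add n (vscale (dot q v) s) (vscale (dot q c) b)).
  rewrite !vnorm_scale in A.
  assert (B1 := cauchy_schwarz_abs n q v). assert (B2 := cauchy_schwarz_abs n q c).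
  assert (P1 := vnorm_nonneg n s). assert (P2 := vnorm_nonneg n b).
  apply (Rmult_le_compat_r (vnorm s)) in B1; [|exact P1].
  apply (Rmult_le_compat_r (vnorm b)) in B2; [|exact P2]. lra.
Qed.

(* Both summands of [oblQ] are squares, so the gradient is controlled by the square root of [oblQ]. *)
Lemma oblQg_bound n (v s c b : vec n) :
  exists K, 0 <= K /\ forall z, vnorm (oblQg v s c b z) <= K * sqrt (oblQ v s c b z).
Proof.
  set (k := 1 + vnorm s * vnorm v + vnorm b * vnorm c).
  assert (Hk : 0 <= k).
  { unfold k. assert (0 <= vnorm s * vnorm v) by (apply Rmult_le_pos; apply vnorm_nonneg).
    assert (0 <= vnorm b * vnorm c) by (apply Rmult_le_pos; apply vnorm_nonneg). lra. }
  assert (Pb := vnorm_nonneg n b).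
  exists (2 * (k + vnorm b)). split; [lra|]. intro z.
  unfold oblQg. rewrite vnorm_scale, (Rabs_pos_eq 2) by lra.
  assert (A := vnorm_add n (oblEt v s c b (oblE v s c b z)) (vscale (dot b z) b)).
  rewrite vnorm_scale in A.
  assert (B := oblEt_bound n v s c b (oblE v s c b z)). fold k in B.
  assert (Q1 : vnorm (oblE v s c b z) <= sqrt (oblQ v s c b z)).
  { apply sqrt_le_1_alt. unfold oblQ. nra. }
  assert (Q2 : Rabs (dot b z) <= sqrt (oblQ v s c b z)).
  { rewrite <- sqrt_Rsqr_abs. apply sqrt_le_1_alt. unfold oblQ, Rsqr.
    generalize (dot_self_nonneg n (oblE v s c b z)); lra. }
  apply (Rmult_le_compat_l k) in Q1; [|exact Hk].
  apply (Rmult_le_compat_r (vnorm b)) in Q2; [|exact Pb]. lra.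
Qed.

Lemma oblE_decomp n (v s c b z : vec n) :
  vnorm z <= Rabs (dot s z) * vnorm v + Rabs (dot b z) * vnorm c + vnorm (oblE v s c b z).
Proof.
  replace z with (vadd (vadd (vscale (dot s z) v) (vscale (dot b z) c)) (oblE v s c b z)) at 1
    by (unfold oblE; vext).
  eapply Rle_trans; [apply vnorm_add|].
  assert (A := vnorm_add n (vscale (dot s z) v) (vscale (dot b z) c)).
  rewrite !vnorm_scale in A. lra.
Qed.

Lemma cont_on_oblQ n (P : vec n -> Prop) (v s c b : vec n) : cont_on P (oblQ v s c b).
Proof.
  destruct (oblQ_bound n v s c b) as [K [HK HQ]].
  apply cont_on_of_modulus; intro x. exists (vnorm (oblQg v s c b x)), K.
  split; [apply vnorm_nonneg|split; [exact HK|]]. intro y.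
  rewrite (oblQ_expand n v s c b y x).
  replace (_ - _) with (dot (oblQg v s c b x) (vsub y x) + oblQ v s c b (vsub y x)) by ring.
  eapply Rle_trans; [apply Rabs_triang|]. apply Rplus_le_compat; [apply cauchy_schwarz_abs|].
  rewrite Rabs_pos_eq by apply oblQ_nonneg.
  unfold dist; rewrite vnorm_sq; apply HQ.
Qed.

(** * The domain near a point of its closure *)

(* At a boundary point [x], [c] is [gamma x] and [b] the outer normal scaled so that [b . c = 1];
   the last clause says that the boundary lies above the closure up to an [o(|z - y|)] error.
   At an interior point all the data vanish. *)
Definition frame {n} (O : vec n -> Prop) (gamma : vec n -> vec n) (g : vec n -> R)
    (x b c : vec n) (k : R) : Prop :=
  ((O x /\ b = vzero /\ c = vzero /\ k = 0) \/
   (boundary O x /\ dot b c = 1 /\ c = gamma x /\ k = g x)) /\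
  forall eps, 0 < eps -> exists r, 0 < r /\ forall z, boundary O z -> dist z x < r ->
    dot b c = 1 /\ dist (gamma z) c < eps /\ Rabs (g z - k) < eps /\
    forall y, closure O y -> dist y x < r -> - (eps * dist z y) <= dot b (vsub z y).

Lemma gradient_cont n (phi : vec n -> R) x Dx : has_gradient phi x Dx ->
  forall eps, 0 < eps -> exists d, 0 < d /\ forall y, dist y x < d -> Rabs (phi y - phi x) < eps.
Proof.
  intros Hg eps He. destruct (Hg 1 ltac:(lra)) as [d [Hd Hy]].
  assert (P := vnorm_nonneg n Dx).
  exists (Rmin d (eps / (vnorm Dx + 1))). split.
  { apply Rmin_pos; [exact Hd|apply Rdiv_lt_0_compat; lra]. }
  intros y Dy. specialize (Hy y (Rlt_le_trans _ _ _ Dy (Rmin_l _ _))).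
  assert (D2 := Rlt_le_trans _ _ _ Dy (Rmin_r _ _)).
  apply (Rmult_lt_compat_r (vnorm Dx + 1)) in D2; [|lra].
  replace (eps / (vnorm Dx + 1) * (vnorm Dx + 1)) with eps in D2 by (field; lra).
  assert (C := cauchy_schwarz_abs n Dx (vsub y x)).
  apply Rabs_le_inv in Hy. apply Rabs_le_inv in C.
  change (vnorm (vsub y x)) with (dist y x) in C. apply Rabs_def1; lra.
Qed.

Lemma segment_derivable n (phi : vec n -> R) (Dphi : vec n -> vec n) (y z : vec n) t :
  has_gradient phi (vadd y (vscale t (vsub z y))) (Dphi (vadd y (vscale t (vsub z y)))) ->
  derivable_pt_lim (fun t => phi (vadd y (vscale t (vsub z y)))) t
    (dot (Dphi (vadd y (vscale t (vsub z y)))) (vsub z y)).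
Proof.
  intros Hg eps He. set (q := vsub z y). fold q in Hg. set (w := vadd y (vscale t q)) in *.
  assert (P := vnorm_nonneg n q).
  destruct (Hg (eps / (2 * (vnorm q + 1)))) as [d [Hd Hy]]; [apply Rdiv_lt_0_compat; lra|].
  assert (Hd' : 0 < d / (vnorm q + 1)) by (apply Rdiv_lt_0_compat; lra).
  exists (mkposreal _ Hd'). intros h Hh0 Hh. simpl in Hh.
  assert (Pv : vsub (vadd y (vscale (t + h) q)) w = vscale h q) by (unfold w; vext).
  assert (Dv : dist (vadd y (vscale (t + h) q)) w = Rabs h * vnorm q).
  { unfold dist; rewrite Pv; apply vnorm_scale. }
  assert (Ph := Rabs_pos_lt h Hh0).
  apply (Rmult_lt_compat_r (vnorm q + 1)) in Hh; [|lra].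
  replace (d / (vnorm q + 1) * (vnorm q + 1)) with d in Hh by (field; lra).
  specialize (Hy (vadd y (vscale (t + h) q)) ltac:(rewrite Dv; lra)).
  rewrite Pv, Dv, dot_scale_r in Hy.
  set (a := phi (vadd y (vscale (t + h) q)) - phi w) in *.
  replace (a / h - dot (Dphi w) q) with ((a - h * dot (Dphi w) q) / h) by (field; assumption).
  unfold Rdiv; rewrite Rabs_mult, Rabs_inv.
  apply (Rmult_lt_reg_r (Rabs h)); [exact Ph|].
  rewrite Rmult_assoc, Rinv_l, Rmult_1_r by lra.
  eapply Rle_lt_trans; [exact Hy|].
  assert (E : eps / (2 * (vnorm q + 1)) * (Rabs h * (2 * (vnorm q + 1))) = eps * Rabs h) by (field; lra).
  assert (0 < eps / (2 * (vnorm q + 1))) by (apply Rdiv_lt_0_compat; lra).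
  apply Rlt_le_trans with (eps / (2 * (vnorm q + 1)) * (Rabs h * (2 * (vnorm q + 1)))); [|lra].
  apply Rmult_lt_compat_l; [assumption|]. apply Rmult_lt_compat_l; lra.
Qed.

Lemma ball_convex n (x y z : vec n) r t : 0 <= t <= 1 -> dist y x < r -> dist z x < r ->
  dist (vadd y (vscale t (vsub z y))) x < r.
Proof.
  intros Ht Hy Hz. unfold dist.
  replace (vsub (vadd y (vscale t (vsub z y))) x)
    with (vadd (vscale (1 - t) (vsub y x)) (vscale t (vsub z x))) by vext.
  eapply Rle_lt_trans; [apply vnorm_add|]. rewrite !vnorm_scale, !Rabs_pos_eq by lra.
  fold (dist y x) (dist z x).
  destruct (Rle_lt_dec t (/ 2)).
  - apply Rlt_le_trans with ((1 - t) * r + t * r); [|lra].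
    apply Rplus_lt_le_compat; [apply Rmult_lt_compat_l; lra|apply Rmult_le_compat_l; lra].
  - apply Rlt_le_trans with ((1 - t) * r + t * r); [|lra].
    apply Rplus_le_lt_compat; [apply Rmult_le_compat_l; lra|apply Rmult_lt_compat_l; lra].
Qed.

(** At a boundary point [b] is the gradient of the defining function divided by its product with
    [gamma x], which is positive by obliqueness. For the last clause, the defining function is
    nonnegative at [z] and, by continuity, nonpositive at [y]; the mean value theorem on the segment
    and the continuity of the gradient turn this into the bound with error [eps]. Near an interior
    point there is no boundary point to consider. *)
Lemma frame_exists n (O : vec n -> Prop) gamma g x :
  is_open O -> is_C1_domain O -> cont_on (boundary O) g -> vcont_on (boundary O) gamma ->
  (forall x nu, boundary O x -> outer_unit_normal O x nu -> dot nu (gamma x) > 0) ->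
  closure O x -> exists b c k, frame O gamma g x b c k.
Proof.
  intros HO HC1 Hg Hgam Hobl Cx.
  destruct (classic (O x)) as [Ox|Nx].
  { exists vzero, vzero, 0. split; [left; auto|]. intros eps He.
    destruct (HO x Ox) as [r [Hr Hin]]. exists r; split; [exact Hr|].
    intros z [_ Nz] Dz. exfalso; apply Nz, Hin, Dz. }
  assert (Bx : boundary O x) by (split; assumption).
  destruct (HC1 x Bx) as [r [phi [Dphi HL]]].
  assert (HL' := HL). destruct HL' as [Hr [Hgrad [HDc [HDn Hlt]]]].
  assert (D0 : dist x x < r) by (rewrite dist_refl; exact Hr).
  assert (PN : 0 < vnorm (Dphi x)).
  { destruct (vnorm_nonneg n (Dphi x)) as [|E]; [assumption|]. exfalso; apply (HDn x D0); auto. }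
  assert (Pg : 0 < dot (Dphi x) (gamma x)).
  { assert (A := Hobl x _ Bx (ex_intro _ r (ex_intro _ phi (ex_intro _ Dphi (conj HL eq_refl))))).
    rewrite dot_scale_l in A. apply Rinv_0_lt_compat in PN.
    apply Rnot_le_lt; intro. nra. }
  set (D := dot (Dphi x) (gamma x)) in *.
  exists (vscale (/ D) (Dphi x)), (gamma x), (g x).
  assert (E1 : dot (vscale (/ D) (Dphi x)) (gamma x) = 1).
  { rewrite dot_scale_l. fold D. field. lra. }
  split; [right; auto|]. intros eps He.
  destruct (Hg x Bx eps He) as [r1 [Hr1 H1]].
  destruct (Hgam x Bx eps He) as [r2 [Hr2 H2]].
  destruct (HDc x D0 (eps * D)) as [r3 [Hr3 H3]]; [nra|].
  exists (Rmin (Rmin r r1) (Rmin r2 r3)). split; [repeat apply Rmin_pos; assumption|].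
  intros z Bz Dz.
  assert (Rm : forall d, d < Rmin (Rmin r r1) (Rmin r2 r3) -> d < r /\ d < r1 /\ d < r2 /\ d < r3).
  { intros d Hd. generalize (Rmin_l (Rmin r r1) (Rmin r2 r3)) (Rmin_r (Rmin r r1) (Rmin r2 r3))
      (Rmin_l r r1) (Rmin_r r r1) (Rmin_l r2 r3) (Rmin_r r2 r3). lra. }
  destruct (Rm _ Dz) as [Z0 [Z1 [Z2 Z3]]].
  split; [exact E1|]. split; [apply H2; assumption|]. split; [apply H1; assumption|].
  intros y Cy Dy. destruct (Rm _ Dy) as [Y0 [Y1 [Y2 Y3]]].
  assert (Pz : 0 <= phi z).
  { apply Rnot_lt_le; intro C. apply (Hlt z Z0) in C. destruct Bz as [_ Nz]; auto. }
  assert (Py : phi y <= 0).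
  { apply Rnot_lt_le; intro C.
    destruct (gradient_cont n phi y _ (Hgrad y Y0) (phi y) C) as [d [Hd Hc]].
    destruct (Cy (Rmin d (r - dist y x))) as [w [Ow Dw]]; [apply Rmin_pos; lra|].
    assert (W1 := Rlt_le_trans _ _ _ Dw (Rmin_l _ _)).
    assert (W2 := Rlt_le_trans _ _ _ Dw (Rmin_r _ _)).
    assert (W3 : dist w x < r) by (generalize (dist_tri n w y x); lra).
    apply (Hlt w W3) in Ow. specialize (Hc w W1). apply Rabs_def2 in Hc. lra. }
  set (f := fun t => phi (vadd y (vscale t (vsub z y)))).
  set (f' := fun t => dot (Dphi (vadd y (vscale t (vsub z y)))) (vsub z y)).
  destruct (MVT_cor2 f f' 0 1 ltac:(lra)) as [t [Et Ht]].
  { intros t Ht. apply segment_derivable, Hgrad, ball_convex; auto. }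
  assert (F1 : f 1 = phi z) by (unfold f; f_equal; vext).
  assert (F0 : f 0 = phi y) by (unfold f; f_equal; vext).
  rewrite F1, F0 in Et.
  set (w := vadd y (vscale t (vsub z y))) in *.
  assert (W0 : dist w x < r) by (apply ball_convex; [lra|assumption|assumption]).
  assert (W3 : dist w x < r3) by (apply ball_convex; [lra|assumption|assumption]).
  specialize (H3 w W0 W3).
  assert (K := cauchy_schwarz n (vsub (Dphi w) (Dphi x)) (vsub z y)).
  change (vnorm (vsub (Dphi w) (Dphi x))) with (dist (Dphi w) (Dphi x)) in K.
  change (vnorm (vsub z y)) with (dist z y) in K.
  rewrite dot_sub_l in K. unfold f' in Et. fold w in Et.
  assert (P0 := dist_nonneg n z y).
  rewrite dot_scale_l.
  apply (Rmult_le_reg_l D); [exact Pg|]. rewrite <- Rmult_assoc, Rinv_r, Rmult_1_l by lra.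
  assert (dist (Dphi w) (Dphi x) * dist z y <= eps * D * dist z y) by (apply Rmult_le_compat_r; lra).
  lra.
Qed.

(** * Coercivity and Lipschitz continuity *)

Lemma closure_bounded n (O : vec n -> Prop) : is_bounded O ->
  exists B, forall x, closure O x -> vnorm x <= B.
Proof.
  intros [B HB]; exists (B + 1); intros x Hx. destruct (Hx 1 ltac:(lra)) as [y [Oy Dy]].
  specialize (HB y Oy). generalize (vnorm_dist_le n x y). rewrite (dist_sym n x y). lra.
Qed.

Lemma closure_seq_limit n (O : vec n -> Prop) (x : nat -> vec n) l (phi : nat -> nat) :
  (forall k, closure O (x k)) ->
  (forall eps, 0 < eps -> exists N, forall k, (N <= k)%nat -> (k <= phi k)%nat /\ dist (x (phi k)) l < eps) ->
  closure O l.
Proof.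
  intros Hx Hl. apply closure_closed; intros eps He. destruct (Hl eps He) as [N HN].
  exists (x (phi N)); split; [apply Hx|apply HN; lia].
Qed.

(** Suppose zeros or negative values of [H] occur at momenta of unbounded norm. Shrinking these
    momenta to a fixed norm [R1], convexity between [0] and the momentum bounds [H] there by its
    values at [0]. Base points and shrunk momenta accumulate, and at the limit pointwise coercivity
    says the opposite. *)
Lemma coercive_uniform n (O : vec n -> Prop) (H : vec n -> vec n -> R) :
  is_bounded O -> cont_on_prod (closure O) H ->
  (forall x p q lam, closure O x -> 0 <= lam <= 1 ->
     H x (vadd (vscale lam p) (vscale (1 - lam) q)) <= lam * H x p + (1 - lam) * H x q) ->
  (forall x, closure O x -> forall B, exists Rad, forall p, vnorm p >= Rad -> H x p >= B) ->
  exists M, 0 < M /\ forall y p, closure O y -> H y p <= 0 -> vnorm p <= M.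
Proof.
  intros HB HH A1 A2. destruct (closure_bounded n O HB) as [B0 HB0].
  apply NNPP; intro Hno.
  destruct (choice (fun (k : nat) (yp : vec n * vec n) =>
    closure O (fst yp) /\ H (fst yp) (snd yp) <= 0 /\ INR (S k) < vnorm (snd yp))) as [yp Hyp].
  { intro k. apply NNPP; intro C. apply Hno. exists (INR (S k)).
    split; [apply lt_0_INR; lia|]. intros y p Cy Hp. apply Rnot_lt_le; intro L.
    apply C. exists (y, p); auto. }
  destruct (bolzano_weierstrass n (fun k => fst (yp k)) B0 (fun k => HB0 _ (proj1 (Hyp k))))
    as [x0 [phi Hphi]].
  assert (Cx : closure O x0) by (apply (closure_seq_limit n O (fun k => fst (yp k)) x0 phi); [intro k; apply Hyp|exact Hphi]).
  (* The [1] absorbs the continuity error of [H] at [vzero], and truncation at [0] gives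
     [(1 - lam) * B <= B]. Asking for [B + 2] below leaves [B + 1] after the continuity error at
     [q0], which is still too large. *)
  set (B := Rmax (H x0 vzero + 1) 0).
  assert (HB1 : H x0 vzero + 1 <= B) by apply Rmax_l.
  assert (HB2 : 0 <= B) by apply Rmax_r.
  destruct (A2 x0 Cx (B + 2)) as [Rad HRad].
  set (R1 := Rmax Rad 1).
  assert (HR1 : 1 <= R1) by apply Rmax_r. assert (HR2 : Rad <= R1) by apply Rmax_l.
  set (q := fun k => vscale (R1 / vnorm (snd (yp (phi k)))) (snd (yp (phi k)))).
  destruct (INR_unbounded R1) as [N1 HN1].
  assert (Pk : forall k, 0 < vnorm (snd (yp k))).
  { intro k. destruct (Hyp k) as [_ [_ A]]. generalize (lt_0_INR (S k) ltac:(lia)); lra. }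
  assert (Nq : forall k, vnorm (q k) = R1).
  { intro k. unfold q. rewrite vnorm_scale, Rabs_pos_eq.
    - field. specialize (Pk (phi k)); lra.
    - left; apply Rdiv_lt_0_compat; [lra|apply Pk]. }
  destruct (bolzano_weierstrass n q R1 (fun k => Req_le _ _ (Nq k))) as [q0 [psi Hpsi]].
  assert (Nq0 : R1 <= vnorm q0).
  { apply Rnot_lt_le; intro C. destruct (Hpsi (R1 - vnorm q0)) as [N HN]; [lra|].
    destruct (HN N ltac:(lia)) as [_ D]. generalize (vnorm_dist_le n (q (psi N)) q0).
    rewrite Nq. lra. }
  specialize (HRad q0 ltac:(lra)).
  destruct (HH x0 q0 Cx 1 ltac:(lra)) as [d1 [Hd1 H1]].
  destruct (HH x0 vzero Cx 1 ltac:(lra)) as [d2 [Hd2 H2]].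
  destruct (Hpsi d1 Hd1) as [N2 HN2].
  destruct (Hphi (Rmin d1 d2) ltac:(apply Rmin_pos; assumption)) as [N3 HN3].
  set (k := max N1 (max N2 N3)).
  destruct (HN2 k ltac:(lia)) as [K1 K2]. destruct (HN3 (psi k) ltac:(lia)) as [K3 K4].
  set (j := phi (psi k)) in *. destruct (Hyp j) as [J1 [J2 J3]].
  assert (D1 := Rlt_le_trans _ _ _ K4 (Rmin_l _ _)). assert (D2 := Rlt_le_trans _ _ _ K4 (Rmin_r _ _)).
  specialize (H1 _ _ J1 D1 K2).
  specialize (H2 _ vzero J1 D2 ltac:(rewrite dist_refl; exact Hd2)).
  apply Rabs_def2 in H1. apply Rabs_def2 in H2.
  assert (Big : R1 < vnorm (snd (yp j))).
  { eapply Rlt_trans; [|exact J3]. eapply Rlt_le_trans; [apply HN1|]. apply le_INR; lia. }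
  set (lam := R1 / vnorm (snd (yp j))).
  assert (Hlam : 0 <= lam <= 1).
  { unfold lam; split; [left; apply Rdiv_lt_0_compat; lra|].
    apply Rmult_le_reg_r with (vnorm (snd (yp j))); [lra|].
    unfold Rdiv; rewrite Rmult_assoc, Rinv_l by lra. lra. }
  assert (A := A1 (fst (yp j)) (snd (yp j)) vzero lam J1 Hlam).
  replace (vadd (vscale lam (snd (yp j))) (vscale (1 - lam) vzero)) with (q (psi k)) in A
    by (unfold q, lam; fold j; vext).
  assert (lam * H (fst (yp j)) (snd (yp j)) <= 0) by nra.
  assert ((1 - lam) * H (fst (yp j)) vzero <= (1 - lam) * B) by (apply Rmult_le_compat_l; lra).
  nra.
Qed.

Lemma dist_shift n h (x w : vec n) : 0 <= h -> dist (vadd x (vscale h w)) x = h * vnorm w.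
Proof.
  intros Hh. unfold dist. replace (vsub (vadd x (vscale h w)) x) with (vscale h w) by vext.
  rewrite vnorm_scale, Rabs_pos_eq; auto.
Qed.

(* Test functions [Lam (N + (b . z) / 2)] with [N] a norm equivalent to the Euclidean one: the tilt
   by [b] makes the derivative along [gamma] of order [Lam] at the boundary, so that the boundary
   condition cannot be the one satisfied. *)
Lemma lipschitz_near n (O : vec n -> Prop) H gamma g u x0 b c k M :
  is_open O -> visc_subsol O H gamma g u -> frame O gamma g x0 b c k -> closure O x0 ->
  0 < M -> (forall y p, closure O y -> H y p <= 0 -> vnorm p <= M) ->
  exists r L, 0 < r /\ forall x y, closure O x -> closure O y -> dist x x0 < r -> dist y x0 < r ->
    u y <= u x + L * dist y x.
Proof.
  intros HO Hsub [_ Hfr] Cx0 HM Hco.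
  (* With [v = s = 0] the form is positive definite: it splits [z] into a multiple of [c] and a
     remainder. At an interior point, where [b = c = 0], it is the Euclidean square, so both cases
     run together. *)
  set (Q := oblQ vzero vzero c b). set (Qg := oblQg vzero vzero c b).
  set (N := fun z => sqrt (Q z)).
  assert (Q0 : forall z, 0 <= Q z) by (intro; apply oblQ_nonneg).
  assert (N0 : forall z, 0 <= N z) by (intro; apply sqrt_pos).
  assert (NN : forall z, N z * N z = Q z) by (intro; apply sqrt_sqrt, Q0).
  assert (Nt : forall z, Rabs (dot b z) <= N z).
  { intro z. rewrite <- sqrt_Rsqr_abs. apply sqrt_le_1_alt. unfold Q, oblQ, Rsqr.
    generalize (dot_self_nonneg n (oblE vzero vzero c b z)); lra. }
  assert (NE : forall z, vnorm (oblE vzero vzero c b z) <= N z).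
  { intro z. apply sqrt_le_1_alt. unfold Q, oblQ. nra. }
  assert (Pc := vnorm_nonneg n c). assert (Pb := vnorm_nonneg n b).
  set (kap := 1 + vnorm c).
  assert (Nk : forall z, vnorm z <= kap * N z).
  { intro z. generalize (oblE_decomp n vzero vzero c b z). rewrite vnorm_0.
    specialize (Nt z). specialize (NE z).
    apply (Rmult_le_compat_r (vnorm c)) in Nt; [|exact Pc]. unfold kap. lra. }
  destruct (oblQg_bound n vzero vzero c b) as [K3 [HK3 HQg]]. fold Q Qg in HQg.
  destruct (oblQ_bound n vzero vzero c b) as [KQ [HKQ HQb]]. fold Q in HQb.
  assert (NQ : forall z, N z <= sqrt KQ * vnorm z).
  { intro z. unfold N, vnorm. rewrite <- sqrt_mult; [|exact HKQ|apply dot_self_nonneg].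
    apply sqrt_le_1_alt, HQb. }
  set (P := K3 + vnorm b + 1).
  assert (HP : 0 < P) by (unfold P; lra). assert (Hkap : 0 < kap) by (unfold kap; lra).
  (* At a boundary contact the tilt gives slope [Lam / 2] along [c]. The first bound limits the loss
     from the cone to [Lam / 4], the second the loss from replacing [c] by [gamma y'] to [Lam / 8],
     and the third keeps [g y'] within [1] of [k]. *)
  set (e1 := Rmin (Rmin (/ (4 * kap)) (/ (8 * P))) 1).
  assert (He1 : 0 < e1).
  { unfold e1; repeat apply Rmin_pos; try lra; apply Rinv_0_lt_compat; lra. }
  assert (E1 : e1 * kap <= / 4).
  { apply Rle_trans with (/ (4 * kap) * kap); [|right; field; lra].
    apply Rmult_le_compat_r; [lra|]. eapply Rle_trans; [apply Rmin_l|apply Rmin_l]. }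
  assert (E2 : e1 * P <= / 8).
  { apply Rle_trans with (/ (8 * P) * P); [|right; field; lra].
    apply Rmult_le_compat_r; [lra|]. eapply Rle_trans; [apply Rmin_l|apply Rmin_r]. }
  assert (E3 : e1 <= 1) by apply Rmin_r.
  destruct (Hfr e1 He1) as [r1 [Hr1 Hgeo]].
  assert (Hu : cont_on (closure O) u) by apply Hsub.
  destruct (Hu x0 Cx0 1 ltac:(lra)) as [r2 [Hr2 Hu2]].
  set (rho := Rmin r1 r2 / 2).
  assert (Hrho : 0 < rho) by (unfold rho; generalize (Rmin_pos r1 r2 Hr1 Hr2); lra).
  assert (Hrho1 : 2 * rho <= r1) by (unfold rho; generalize (Rmin_l r1 r2); lra).
  assert (Hrho2 : 2 * rho <= r2) by (unfold rho; generalize (Rmin_r r1 r2); lra).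
  assert (Pk := Rabs_pos k).
  (* The first summand makes [Phi >= 2] on the sphere of radius [rho], more than the oscillation of
     [u] there; the second forces every contact gradient beyond the norm bound [M]; the third lets
     the remaining slope [Lam / 8] beat [g]. *)
  set (Lam := 4 * kap / rho + 2 * kap * (M + 1) + 8 * (Rabs k + 2)).
  assert (P1 : 0 < 4 * kap / rho) by (apply Rdiv_lt_0_compat; lra).
  assert (P2 : 0 < 2 * kap * (M + 1)) by (apply Rmult_lt_0_compat; lra).
  assert (HLam : 0 < Lam) by (unfold Lam; lra).
  assert (L1 : 2 * (2 * kap) <= Lam * rho).
  { unfold Lam. replace (2 * (2 * kap)) with (4 * kap / rho * rho) by (field; lra).
    apply Rmult_le_compat_r; lra. }
  assert (L2 : 2 * kap * M < Lam) by (unfold Lam; lra).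
  assert (L3 : 8 * (Rabs k + 2) <= Lam) by (unfold Lam; lra).
  set (Phi := fun z => Lam * (N z + dot b z / 2)).
  set (G := fun w => vscale Lam (vadd (vscale (/ (2 * N w)) (Qg w)) (vscale (/ 2) b))).
  assert (PhiL : forall z, Lam * N z / 2 <= Phi z).
  { intro z. unfold Phi. specialize (Nt z). apply Rabs_le_inv in Nt. nra. }
  assert (Npos : forall w, 0 < vnorm w -> 0 < N w).
  { intros w Hw. specialize (Nk w). destruct (N0 w) as [|E]; [assumption|]. rewrite <- E in Nk. lra. }
  exists (rho / 2), (2 * Lam * sqrt KQ). split; [lra|].
  intros x y Cx Cy Dx Dy.
  assert (PhiU : Phi (vsub y x) <= 2 * Lam * sqrt KQ * dist y x).
  { unfold Phi. specialize (Nt (vsub y x)). apply Rabs_le_inv in Nt. specialize (NQ (vsub y x)).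
    change (vnorm (vsub y x)) with (dist y x) in NQ. specialize (N0 (vsub y x)).
    replace (2 * Lam * sqrt KQ * dist y x) with (Lam * (2 * (sqrt KQ * dist y x))) by ring.
    apply Rmult_le_compat_l; lra. }
  apply Rnot_lt_le; intro Hviol.
  assert (Dyx : dist y x < rho).
  { generalize (dist_tri n y x0 x). rewrite (dist_sym n x0 x). lra. }
  assert (Ey : vadd x (vscale 1 (vsub y x)) = y) by vext.
  (* The choice [S = vnorm] excludes the vertex, where the cone is not differentiable; the value
     there is [u x], which is the level [m = 0]. *)
  destruct (superdiff_at_max n O u x 1 rho 0 Phi vnorm G (vsub y x)) as [w [W1 [W2 [W3 W4]]]].
  - exact Hu.
  - lra.
  - apply (cont_on_ext n _ (fun z => Lam * N z + (Lam / 2) * dot b z)); [intro z; unfold Phi; field|].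
    apply cont_on_lin; [|apply cont_on_dot].
    apply cont_on_comp_R; [apply cont_on_oblQ|]. intros z _. apply continuity_pt_sqrt, Q0.
  - apply cont_on_vnorm.
  - intros w Hw. specialize (Npos w Hw).
    exists (Lam * (KQ / (2 * N w))). split.
    { apply Rmult_le_pos; [lra|]. apply Rmult_le_pos; [exact HKQ|].
      left; apply Rinv_0_lt_compat; lra. }
    intro z.
    (* By the arithmetic-geometric mean inequality the square root lies below its tangent at [Q w],
       which turns the exact expansion of [Q] into a paraboloid touching [N] from above. *)
    assert (A : N z <= (Q z + Q w) / (2 * N w)).
    { apply Rmult_le_reg_r with (2 * N w); [lra|].
      replace ((Q z + Q w) / (2 * N w) * (2 * N w)) with (Q z + Q w) by (field; lra).
      rewrite <- (NN z), <- (NN w). generalize (Rle_0_sqr (N z - N w)); unfold Rsqr; lra. }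
    assert (B : Q z + Q w <= 2 * Q w + dot (Qg w) (vsub z w) + KQ * dot (vsub z w) (vsub z w)).
    { unfold Q at 1. rewrite (oblQ_expand n vzero vzero c b z w). fold Q Qg.
      specialize (HQb (vsub z w)). lra. }
    assert (C : N z <= N w + / (2 * N w) * dot (Qg w) (vsub z w) + KQ / (2 * N w) * dot (vsub z w) (vsub z w)).
    { eapply Rle_trans; [exact A|].
      apply Rle_trans with ((2 * Q w + dot (Qg w) (vsub z w) + KQ * dot (vsub z w) (vsub z w)) / (2 * N w)).
      - apply Rmult_le_compat_r; [left; apply Rinv_0_lt_compat; lra|exact B].
      - right. rewrite <- (NN w). field. lra. }
    unfold Phi, G. rewrite dot_scale_l, dot_add_l, !dot_scale_l, (dot_sub_r n b).
    apply (Rmult_le_compat_l Lam) in C; [|lra]. lra.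
  - intros w Hw _ Cw Hface.
    assert (Hwn := vnorm_nonneg n w).
    destruct Hface as [E|E].
    + apply vnorm_eq_0 in E; subst w.
      replace (vadd x (vscale 1 vzero)) with x by vext.
      specialize (PhiL vzero). specialize (N0 vzero). nra.
    + assert (D1 : dist (vadd x (vscale 1 w)) x0 < r2).
      { generalize (dist_tri n (vadd x (vscale 1 w)) x x0). rewrite dist_shift by lra. lra. }
      assert (U1 := Hu2 _ Cw D1). assert (U2 := Hu2 x Cx ltac:(lra)).
      apply Rabs_def2 in U1. apply Rabs_def2 in U2.
      assert (2 <= Phi w); [|lra].
      specialize (PhiL w). specialize (Nk w). rewrite E in Nk.
      apply Rle_trans with (Lam * N w / 2); [|exact PhiL].
      apply Rmult_le_reg_l with (2 * kap); [lra|].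
      replace (2 * kap * (Lam * N w / 2)) with (Lam * (kap * N w)) by field.
      apply Rle_trans with (Lam * rho); [lra|]. apply Rmult_le_compat_l; lra.
  - change (vnorm (vsub y x)) with (dist y x); lra.
  - apply vnorm_nonneg.
  - rewrite Ey; exact Cy.
  - rewrite Ey; lra.
  - set (y' := vadd x (vscale 1 w)) in *. set (p := G w) in *.
    specialize (Npos w W2). set (Nw := N w) in *.
    assert (Dy' : dist y' x0 < r1).
    { unfold y'. generalize (dist_tri n (vadd x (vscale 1 w)) x x0). rewrite dist_shift by lra. lra. }
    assert (Bp : Lam <= 2 * kap * vnorm p).
    (* [Phi] is positively homogeneous of degree one, so Euler's identity gives [dot p w = Phi w],
       and the gradient cannot be small. *)
    { assert (A : Lam * Nw / 2 <= dot p w).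
      { replace (dot p w) with (Phi w); [apply PhiL|].
        unfold p, G. dots. unfold Qg. rewrite oblQg_dot.
        change (dot (oblE vzero vzero c b w) (oblE vzero vzero c b w) + dot b w * dot b w) with (Q w).
        unfold Phi. fold Nw. rewrite <- (NN w). fold Nw. field. lra. }
      assert (B := cauchy_schwarz n p w). specialize (Nk w). fold Nw in Nk.
      assert (Pp := vnorm_nonneg n p).
      apply (Rmult_le_compat_l (vnorm p)) in Nk; [|exact Pp].
      apply Rmult_le_reg_r with Nw; [exact Npos|]. lra. }
    assert (Hp : vnorm p <= M).
    { apply (Hco y' p W3). apply (subsol_test n O H gamma g u); try assumption.
      intro By. destruct (Hgeo y' By Dy') as [G1 [G2 [G3 G4]]].
      specialize (G4 x Cx ltac:(lra)).
      replace (vsub y' x) with w in G4 by (unfold y'; vext).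
      replace (dist y' x) with (vnorm w) in G4 by (unfold y'; rewrite dist_shift by lra; ring).
      assert (Ec : oblE vzero vzero c b c = vzero) by (unfold oblE; rewrite G1; vext).
      assert (Pcp : Lam / 4 <= dot p c).
      { unfold p, G. dots. unfold Qg. rewrite oblQg_dot, Ec, dot_0_r, G1. fold Nw.
        replace (Lam * (/ (2 * Nw) * (2 * (0 + dot b w * 1)) + / 2 * 1))
          with (Lam * (dot b w / Nw + / 2)) by (field; lra).
        apply Rmult_le_compat_l; [lra|].
        assert (- / 4 <= dot b w / Nw); [|lra].
        apply Rmult_le_reg_r with Nw; [exact Npos|].
        unfold Rdiv at 1; rewrite Rmult_assoc, Rinv_l, Rmult_1_r by lra.
        specialize (Nk w). fold Nw in Nk.
        apply (Rmult_le_compat_l e1) in Nk; [|lra].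
        apply (Rmult_le_compat_r Nw) in E1; lra. }
      assert (Np : vnorm p <= Lam * P).
      { unfold p, G. rewrite vnorm_scale, Rabs_pos_eq by lra. apply Rmult_le_compat_l; [lra|].
        eapply Rle_trans; [apply vnorm_add|]. rewrite !vnorm_scale. fold Nw.
        assert (I2 : 0 < / (2 * Nw)) by (apply Rinv_0_lt_compat; lra).
        rewrite !Rabs_pos_eq by lra.
        specialize (HQg w). fold (N w) in HQg. fold Nw in HQg.
        apply (Rmult_le_compat_l (/ (2 * Nw))) in HQg; [|lra].
        replace (/ (2 * Nw) * (K3 * Nw)) with (K3 / 2) in HQg by (field; lra).
        unfold P. lra. }
      assert (CS := cauchy_schwarz_abs n (vsub (gamma y') c) p).
      rewrite dot_sub_l, (dot_comm n c p) in CS. apply Rabs_le_inv in CS.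
      change (vnorm (vsub (gamma y') c)) with (dist (gamma y') c) in CS.
      assert (dist (gamma y') c * vnorm p <= e1 * (Lam * P)).
      { apply Rmult_le_compat; [apply dist_nonneg|apply vnorm_nonneg|lra|exact Np]. }
      assert (Lam * (e1 * P) <= Lam * / 8) by (apply Rmult_le_compat_l; lra).
      apply Rabs_def2 in G3. generalize (Rle_abs k). lra. }
    apply (Rmult_le_compat_l (2 * kap)) in Hp; lra.
Qed.

(** Pairs violating the bound with constants tending to infinity and distances tending to zero would
    accumulate at one point of the compact closure, against the local estimate there. Exchanging the
    two points gives the absolute value. *)
Lemma lipschitz_uniform n (O : vec n -> Prop) u :
  is_bounded O ->
  (forall x0, closure O x0 -> exists r L, 0 < r /\ forall x y, closure O x -> closure O y ->
     dist x x0 < r -> dist y x0 < r -> u y <= u x + L * dist y x) ->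
  exists r L, 0 < r /\ 0 <= L /\ forall x y, closure O x -> closure O y -> dist y x < r ->
    Rabs (u y - u x) <= L * dist y x.
Proof.
  intros HB Hloc. destruct (closure_bounded n O HB) as [B0 HB0].
  apply NNPP; intro Hno.
  destruct (choice (fun (k : nat) (xy : vec n * vec n) =>
    closure O (fst xy) /\ closure O (snd xy) /\ dist (snd xy) (fst xy) < / INR (S k) /\
    u (fst xy) + INR (S k) * dist (snd xy) (fst xy) < u (snd xy))) as [xy Hxy].
  { intro k. apply NNPP; intro C. apply Hno. exists (/ INR (S k)), (INR (S k)).
    split; [apply inv_INR_S_pos|]. split; [apply pos_INR|]. intros x y Cx Cy D.
    assert (D' : dist x y < / INR (S k)) by (rewrite dist_sym; exact D).
    apply Rabs_le; split; apply Rnot_lt_le; intro L; apply C.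
    - exists (y, x); simpl fst; simpl snd. rewrite (dist_sym n x y). repeat split; auto. lra.
    - exists (x, y); simpl fst; simpl snd. repeat split; auto. lra. }
  destruct (bolzano_weierstrass n (fun k => fst (xy k)) B0 (fun k => HB0 _ (proj1 (Hxy k))))
    as [x0 [phi Hphi]].
  assert (Cx : closure O x0)
    by (apply (closure_seq_limit n O (fun k => fst (xy k)) x0 phi); [intro k; apply Hxy|exact Hphi]).
  destruct (Hloc x0 Cx) as [r [L [Hr HL]]].
  destruct (Hphi (r / 2)) as [N1 HN1]; [lra|].
  destruct (inv_INR_S_lt (r / 2)) as [N2 HN2]; [lra|].
  destruct (INR_unbounded L) as [N3 HN3].
  destruct (HN1 (max N1 (max N2 N3)) ltac:(lia)) as [K1 K2].
  set (j := phi (max N1 (max N2 N3))) in *.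
  destruct (Hxy j) as [J1 [J2 [J3 J4]]]. specialize (HN2 j ltac:(lia)).
  assert (D2 : dist (snd (xy j)) x0 < r) by (generalize (dist_tri n (snd (xy j)) (fst (xy j)) x0); lra).
  specialize (HL _ _ J1 J2 ltac:(lra) D2).
  assert (LJ : L <= INR (S j)) by (apply Rle_trans with (INR N3); [lra|apply le_INR; lia]).
  apply (Rmult_le_compat_r (dist (snd (xy j)) (fst (xy j)))) in LJ; [lra|apply dist_nonneg].
Qed.

(** * Directional derivatives *)

(* [d] is at most the upper derivative of [u] at [x] in the direction [v] along points of the closure. *)
Definition ascends {n} (O : vec n -> Prop) (u : vec n -> R) (x v : vec n) (d : R) : Prop :=
  forall eps, 0 < eps -> exists h z, 0 < h < eps /\ dist z v < eps /\
    closure O (vadd x (vscale h z)) /\ h * (d - eps) <= u (vadd x (vscale h z)) - u x.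

(** If [dot b v] were positive, the points [x + h z] of the closure with [z] near [v] would lie
    above the tangent plane by an amount of order [h], whereas the frame at [x] allows only [o(h)].
    Half of [dot b v] is spent on the frame error and half on [z - v]. *)
Lemma ascends_tangent n (O : vec n -> Prop) gamma g u x b c k v d :
  frame O gamma g x b c k -> ascends O u x v d -> dot b v <= 0.
Proof.
  intros [[[Ox [-> _]]|[Bx _]] Hfr] Hasc; [rewrite dot_0_l; lra|].
  apply Rnot_lt_le; intro Hpos. assert (Pb := vnorm_nonneg n b). assert (Pv := vnorm_nonneg n v).
  set (e := dot b v / (2 * (vnorm v + 1))).
  assert (He : 0 < e) by (apply Rdiv_lt_0_compat; lra).
  assert (Ee : e * (vnorm v + 1) = dot b v / 2) by (unfold e; field; lra).
  destruct (Hfr e He) as [r [Hr Hg]].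
  destruct (Hg x Bx ltac:(rewrite dist_refl; exact Hr)) as [_ [_ [_ G]]].
  set (e2 := Rmin 1 (Rmin (dot b v / (2 * (vnorm b + 1))) (r / (vnorm v + 1)))).
  assert (He2 : 0 < e2).
  { unfold e2; repeat apply Rmin_pos; try lra; apply Rdiv_lt_0_compat; lra. }
  assert (M1 : e2 <= 1) by apply Rmin_l.
  assert (M2 : e2 * (vnorm b + 1) <= dot b v / 2).
  { replace (dot b v / 2) with (dot b v / (2 * (vnorm b + 1)) * (vnorm b + 1)) by (field; lra).
    apply Rmult_le_compat_r; [lra|]. eapply Rle_trans; [apply Rmin_r|apply Rmin_l]. }
  assert (M3 : e2 * (vnorm v + 1) <= r).
  { apply Rle_trans with (r / (vnorm v + 1) * (vnorm v + 1)); [|right; field; lra].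
    apply Rmult_le_compat_r; [lra|]. eapply Rle_trans; [apply Rmin_r|apply Rmin_r]. }
  destruct (Hasc e2 He2) as [h [z [Hh [Dz [Cz _]]]]].
  assert (Nz : vnorm z <= vnorm v + 1) by (generalize (vnorm_dist_le n z v); lra).
  assert (Pz := vnorm_nonneg n z).
  specialize (G _ Cz). rewrite dist_shift in G by lra.
  assert (Hr' : h * vnorm z < r).
  { apply Rle_lt_trans with (h * (vnorm v + 1)); [apply Rmult_le_compat_l; lra|].
    apply Rlt_le_trans with (e2 * (vnorm v + 1)); [apply Rmult_lt_compat_r; lra|exact M3]. }
  specialize (G Hr').
  rewrite (dist_sym n x), dist_shift in G by lra.
  replace (vsub x (vadd x (vscale h z))) with (vscale (- h) z) in G by vext.
  rewrite dot_scale_r in G.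
  assert (A : dot b z <= e * vnorm z) by nra.
  assert (e * vnorm z <= e * (vnorm v + 1)) by (apply Rmult_le_compat_l; lra).
  assert (CS := cauchy_schwarz n b (vsub v z)). rewrite dot_sub_r in CS.
  change (vnorm (vsub v z)) with (dist v z) in CS. rewrite (dist_sym n v z) in CS.
  assert (vnorm b * dist z v <= vnorm b * e2) by (apply Rmult_le_compat_l; lra).
  nra.
Qed.

(* The test function is [u x + h Phi ((y - x) / h)] with [h -> 0]. *)
Lemma blowup_test n (O : vec n -> Prop) H gamma g u x b c k v d delta r L P R0 m C2
  (Phi S : vec n -> R) (G : vec n -> vec n) :
  is_open O -> visc_subsol O H gamma g u -> frame O gamma g x b c k -> closure O x ->
  0 < r -> 0 <= L -> (forall y, closure O y -> dist y x < r -> Rabs (u y - u x) <= L * dist y x) ->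
  ascends O u x v d ->
  0 < delta -> 0 < R0 -> 0 <= C2 -> 0 <= P -> vnorm v < R0 ->
  cont_on whole Phi -> cont_on whole S ->
  (forall w, 0 < S w -> exists C, 0 <= C /\ forall z,
     Phi z <= Phi w + dot (G w) (vsub z w) + C * dot (vsub z w) (vsub z w)) ->
  (forall w, vnorm w <= R0 -> vnorm (G w) <= P) ->
  (forall w, d - delta <= dot (G w) v) ->
  (forall w, dot c (G w) = dot b c * (k + delta + C2 * dot b w)) ->
  (forall w, vnorm w <= R0 -> 0 <= S w -> S w = 0 \/ vnorm w = R0 -> L * vnorm w - Phi w <= m) ->
  m < d - Phi v -> 0 < S v ->
  forall eps, 0 < eps -> exists y p, closure O y /\ dist y x < eps /\
    H y p <= 0 /\ dot c p <= k + 2 * delta /\ d - delta <= dot p v.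
Proof.
  intros HO Hsub Hfr Cx Hr HL Hlip Hasc Hdel HR0 HC2 HP Hv HPhi HS Hsemi HGb HGv HGc Hface Hgap HSv eps He.
  destruct Hfr as [Hcase Hfr].
  assert (PCR : 0 <= C2 * R0) by (apply Rmult_le_pos; lra).
  (* Collects the errors at a contact point: the signed-distance term, the change of [gamma] against
     a gradient of norm at most [P], and the change of [g]. With [e1 * K = delta] their sum stays
     within the margin [delta]. *)
  set (K := C2 * R0 + P + 2). assert (HK : 0 < K) by (unfold K; lra).
  set (e1 := delta / K).
  assert (He1 : 0 < e1) by (apply Rdiv_lt_0_compat; assumption).
  assert (E1 : e1 * K = delta) by (unfold e1; field; lra).
  destruct (Hfr e1 He1) as [r1 [Hr1 Hgeo]].
  (* Half of this slack pays for replacing [v] by [z] in [Phi], the other half for the error [e2] in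
     the increment of [u]. *)
  set (gap := d - Phi v - m).
  assert (Hgap' : 0 < gap) by (unfold gap; lra).
  destruct (HPhi v I (gap / 2)) as [d1 [Hd1 HPhi1]]; [lra|].
  destruct (HS v I (S v) HSv) as [d2 [Hd2 HS2]].
  set (rr := Rmin r (Rmin r1 eps)).
  assert (Hrr : 0 < rr) by (unfold rr; repeat apply Rmin_pos; assumption).
  set (e2 := Rmin (Rmin d1 d2) (Rmin (gap / 2) (Rmin (R0 - vnorm v) (rr / R0)))).
  assert (He2 : 0 < e2).
  { unfold e2; repeat apply Rmin_pos; try lra. apply Rdiv_lt_0_compat; lra. }
  assert (M0 : e2 <= d1 /\ e2 <= d2 /\ e2 <= gap / 2 /\ e2 <= R0 - vnorm v /\ e2 <= rr / R0).
  { unfold e2. generalize (Rmin_l (Rmin d1 d2) (Rmin (gap / 2) (Rmin (R0 - vnorm v) (rr / R0))))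
      (Rmin_r (Rmin d1 d2) (Rmin (gap / 2) (Rmin (R0 - vnorm v) (rr / R0))))
      (Rmin_l d1 d2) (Rmin_r d1 d2) (Rmin_l (gap / 2) (Rmin (R0 - vnorm v) (rr / R0)))
      (Rmin_r (gap / 2) (Rmin (R0 - vnorm v) (rr / R0)))
      (Rmin_l (R0 - vnorm v) (rr / R0)) (Rmin_r (R0 - vnorm v) (rr / R0)). lra. }
  destruct M0 as [M1 [M2 [M3 [M4 M5]]]].
  destruct (Hasc e2 He2) as [h [z [Hh [Dz [Cz Uz]]]]].
  assert (HhR : h * R0 < rr).
  { apply Rlt_le_trans with (e2 * R0); [apply Rmult_lt_compat_r; lra|].
    apply Rle_trans with (rr / R0 * R0); [apply Rmult_le_compat_r; lra|right; field; lra]. }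
  assert (RR : rr <= r /\ rr <= r1 /\ rr <= eps).
  { unfold rr. generalize (Rmin_l r (Rmin r1 eps)) (Rmin_r r (Rmin r1 eps)) (Rmin_l r1 eps) (Rmin_r r1 eps). lra. }
  specialize (HPhi1 z I ltac:(lra)). apply Rabs_def2 in HPhi1.
  specialize (HS2 z I ltac:(lra)). apply Rabs_def2 in HS2.
  assert (Near : forall w, vnorm w <= R0 -> dist (vadd x (vscale h w)) x < rr).
  { intros w Hw. rewrite dist_shift by lra. eapply Rle_lt_trans; [|exact HhR].
    apply Rmult_le_compat_l; lra. }
  destruct (superdiff_at_max n O u x h R0 m Phi S G z) as [w [W1 [W2 [W3 W4]]]].
  - apply Hsub.
  - lra.
  - exact HPhi.
  - exact HS.
  - exact Hsemi.
  - intros w Hw Sw Cw Hor. specialize (Hface w Hw Sw Hor).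
    specialize (Hlip _ Cw ltac:(specialize (Near w Hw); lra)). rewrite dist_shift in Hlip by lra.
    apply Rabs_le_inv in Hlip. apply (Rmult_le_compat_l h) in Hface; lra.
  - generalize (vnorm_dist_le n z v); lra.
  - lra.
  - exact Cz.
  - assert (h * (m + Phi z) < h * (d - e2)) by (apply Rmult_lt_compat_l; unfold gap in *; lra). lra.
  - set (y := vadd x (vscale h w)) in *.
    assert (Ny := Near w (Rlt_le _ _ W1)). fold y in Ny.
    assert (NG := HGb w (Rlt_le _ _ W1)).
    assert (Pw := vnorm_nonneg n w).
    assert (Cw : e1 * (C2 * vnorm w) <= e1 * (C2 * R0)).
    { apply Rmult_le_compat_l; [lra|]. apply Rmult_le_compat_l; lra. }
    exists y, (G w). split; [exact W3|]. split; [lra|]. split; [|split; [|apply HGv]].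
    + apply (subsol_test n O H gamma g u); try assumption. intro By.
      destruct (Hgeo y By ltac:(lra)) as [G1 [G2 [G3 G4]]].
      (* The frame is used with the contact point as boundary point and [x] as point of the closure:
         [dot b w] is almost nonnegative, so the slope along [gamma y] stays above [g y]. *)
      specialize (G4 x Cx ltac:(rewrite dist_refl; lra)).
      replace (vsub y x) with (vscale h w) in G4 by (unfold y; vext).
      replace (dist y x) with (h * vnorm w) in G4 by (unfold y; rewrite dist_shift; lra).
      rewrite dot_scale_r in G4.
      assert (T : - (e1 * vnorm w) <= dot b w) by nra.
      assert (T2 := Rmult_le_compat_l C2 _ _ HC2 T).
      specialize (HGc w). rewrite G1 in HGc.
      assert (CS := cauchy_schwarz_abs n (vsub (gamma y) c) (G w)).
      rewrite dot_sub_l in CS. apply Rabs_le_inv in CS.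
      change (vnorm (vsub (gamma y) c)) with (dist (gamma y) c) in CS.
      assert (dist (gamma y) c * vnorm (G w) <= e1 * P).
      { apply Rmult_le_compat; [apply dist_nonneg|apply vnorm_nonneg|lra|exact NG]. }
      apply Rabs_def2 in G3. unfold K in E1. lra.
    (* Here the roles are exchanged: with [x] as boundary point and the contact point in the
       closure, [dot b w] is almost nonpositive, which bounds the slope along [c] from above. If [x]
       is interior, [b], [c] and [k] vanish. *)
    + rewrite HGc. destruct Hcase as [[Ox [-> [-> ->]]]|[Bx [G1 _]]].
      { rewrite dot_0_l. lra. }
      rewrite G1. destruct (Hgeo x Bx ltac:(rewrite dist_refl; lra)) as [_ [_ [_ G4]]].
      specialize (G4 y W3 ltac:(lra)).
      replace (vsub x y) with (vscale (- h) w) in G4 by (unfold y; vext).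
      replace (dist x y) with (h * vnorm w) in G4 by (rewrite dist_sym; unfold y; rewrite dist_shift; lra).
      rewrite dot_scale_r in G4.
      assert (T : dot b w <= e1 * vnorm w) by nra.
      assert (T2 := Rmult_le_compat_l C2 _ _ HC2 T).
      assert (0 <= e1 * P) by (apply Rmult_le_pos; lra). unfold K in E1. lra.
Qed.

(** A convex function with Lipschitz derivative [2 * Rmax t 0]. Evaluated at [dot s z - 1] it
    vanishes at [z = v], so it costs nothing in the gap; its slope along [v] is nonnegative, and its
    growth confines the maximum ahead of [v]. *)
Definition pos2 (t : R) : R := Rmax t 0 * Rmax t 0.

Lemma pos2_upper t t' : pos2 t' <= pos2 t + 2 * Rmax t 0 * (t' - t) + (t' - t) * (t' - t).
Proof. unfold pos2, Rmax. destruct (Rle_dec t' 0) as [A|A%Rnot_le_lt], (Rle_dec t 0) as [B|B%Rnot_le_lt];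
    generalize (Rle_0_sqr (t' - t)) (Rle_0_sqr t') (Rle_0_sqr t); unfold Rsqr; nra. Qed.

Lemma pos2_lower t t' : pos2 t + 2 * Rmax t 0 * (t' - t) <= pos2 t'.
Proof. unfold pos2, Rmax. destruct (Rle_dec t' 0) as [A|A%Rnot_le_lt], (Rle_dec t 0) as [B|B%Rnot_le_lt];
    generalize (Rle_0_sqr (t' - t)) (Rle_0_sqr t') (Rle_0_sqr t); unfold Rsqr; nra. Qed.

Lemma growth_linear K t : K * t - t * t <= (K + 1) * (K + 1) / 4 - t.
Proof. generalize (Rle_0_sqr (t - (K + 1) / 2)); unfold Rsqr; lra. Qed.

Lemma growth_small K C del t : 0 < C -> K * K <= 4 * C * del -> K * t - C * (t * t) <= del.
Proof.
  intros HC HK. apply Rmult_le_reg_l with (4 * C); [lra|].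
  generalize (Rle_0_sqr (2 * C * t - K)); unfold Rsqr; intro. lra.
Qed.

(** [Phi] has slope [d - del] along [v] and [k + del] along [c], plus two confining terms. On the
    hyperplane [dot s z = 0] the penalty [C * Q] absorbs the Lipschitz growth of [u] up to
    [del / 2], while at [v] the increment [d] exceeds [Phi v = d - del] by [del]; this difference is
    the gap. On a large sphere the quadratic growth wins. Slopes along [v] never drop below
    [d - del], and those along [c] change only through [2 * C * dot b w], because [oblE] annihilates
    both vectors. *)
Lemma directional_test n (O : vec n -> Prop) H gamma g u x b c k v d r L :
  is_open O -> visc_subsol O H gamma g u -> frame O gamma g x b c k -> closure O x ->
  0 < r -> 0 <= L -> (forall y, closure O y -> dist y x < r -> Rabs (u y - u x) <= L * dist y x) ->
  ascends O u x v d -> dot b v = 0 -> (v = vzero -> d = 0) ->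
  forall eps, 0 < eps -> exists y p, closure O y /\ dist y x < eps /\
    H y p <= 0 /\ dot c p <= k + eps /\ d - eps <= dot p v.
Proof.
  intros HO Hsub Hfr Cx Hr HL Hlip Hasc Htan Hv0 eps He.
  (* Removing a multiple of [b] from [v] gives [dot s c = 0], as [dot b c = 1]; tangency of [v] then
     gives [dot s v = 1]. For [v = 0] this is the zero vector. *)
  set (s := vscale (/ dot v v) (vsub v (vscale (dot v c) b))).
  assert (Hbc : dot b c = 1 \/ c = vzero).
  { destruct Hfr as [[[_ [_ [E _]]]|[_ [E _]]] _]; auto. }
  assert (Hsc : dot s c = 0).
  { destruct Hbc as [E| ->]; [|apply dot_0_r]. unfold s; dots. rewrite E. ring. }
  assert (Hsv : (v = vzero /\ s = vzero) \/ dot s v = 1).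
  { destruct (classic (v = vzero)) as [E|N].
    - left; split; [exact E|]. unfold s. rewrite E, (dot_0_l n c). vext.
    - right. unfold s; dots. rewrite Htan, Rmult_0_r, Rminus_0_r. apply Rinv_l.
      intro E. apply N, vnorm_eq_0. unfold vnorm; rewrite E; apply sqrt_0. }
  assert (HEv : oblE v s c b v = vzero).
  { unfold oblE. rewrite Htan. destruct Hsv as [[-> ->]| ->]; vext. }
  assert (HEc : oblE v s c b c = vzero).
  { unfold oblE. rewrite Hsc. destruct Hbc as [-> | ->]; vext. }
  set (del := eps / 2). assert (Hdel : 0 < del) by (unfold del; lra).
  set (a := d - del). set (kk := k + del).
  assert (Pv := vnorm_nonneg n v). assert (Pc := vnorm_nonneg n c).
  set (K := L * vnorm c + Rabs kk).
  set (K2 := L * vnorm v + Rabs a).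
  (* Completing the square, a linear growth [K t] or [L t] exceeds [C t^2] by at most [del / 4]; the
     two transverse terms together cost [del / 2]. *)
  set (C := 1 + (K * K + L * L) / del).
  assert (HC : 1 <= C).
  { unfold C. assert (0 <= (K * K + L * L) / del); [|lra].
    apply Rmult_le_pos; [nra|left; apply Rinv_0_lt_compat; exact Hdel]. }
  assert (HCd : K * K <= 4 * C * (del / 4) /\ L * L <= 4 * C * (del / 4)).
  { replace (4 * C * (del / 4)) with (del + (K * K + L * L)) by (unfold C; field; lra). nra. }
  set (Q := oblQ v s c b). set (Qg := oblQg v s c b).
  set (Phi := fun z => a * dot s z + kk * dot b z + (pos2 (dot s z - 1) + C * Q z)).
  set (G := fun w => vadd (vadd (vscale (a + 2 * Rmax (dot s w - 1) 0) s) (vscale kk b)) (vscale C (Qg w))).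
  assert (HQe : forall z, Q z = vnorm (oblE v s c b z) * vnorm (oblE v s c b z)
                               + Rabs (dot b z) * Rabs (dot b z)).
  { intro z. unfold Q, oblQ. rewrite vnorm_sq, <- Rabs_mult, (Rabs_pos_eq (dot b z * _)); [reflexivity|].
    apply Rle_0_sqr. }
  assert (Hvert : forall z, 0 <= dot s z -> L * vnorm z - Phi z <=
     (K2 * dot s z - pos2 (dot s z - 1)) + (K * Rabs (dot b z) - C * (Rabs (dot b z) * Rabs (dot b z)))
     + (L * vnorm (oblE v s c b z) - C * (vnorm (oblE v s c b z) * vnorm (oblE v s c b z)))).
  { intros z Hz. unfold Phi. rewrite HQe.
    assert (D := oblE_decomp n v s c b z). rewrite (Rabs_pos_eq (dot s z)) in D by exact Hz.
    apply (Rmult_le_compat_l L) in D; [|exact HL].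
    assert (A1 : - a * dot s z <= Rabs a * dot s z).
    { apply Rmult_le_compat_r; [exact Hz|]. rewrite <- Rabs_Ropp. apply Rle_abs. }
    assert (A2 : - kk * dot b z <= Rabs kk * Rabs (dot b z)).
    { rewrite <- Rabs_mult. replace (- kk * dot b z) with (- (kk * dot b z)) by ring.
      rewrite <- Rabs_Ropp. apply Rle_abs. }
    unfold K, K2. lra. }
  (* On the sphere each growth estimate leaves a constant minus the coordinate it controls, and [B]
     is the sum of the constants. The radius [R0] makes the coordinates add up to at least
     [Rabs B + 1] and keeps [v] inside. *)
  set (B := K2 + 1 + (K2 + 1) * (K2 + 1) / 4 + (K + 1) * (K + 1) / 4 + (L + 1) * (L + 1) / 4).
  set (kap := vnorm v + vnorm c + 1).
  set (R0 := kap * (Rabs B + 1) + vnorm v).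
  assert (PB := Rabs_pos B).
  assert (HR0 : vnorm v < R0) by (unfold R0, kap; nra).
  assert (Hface1 : forall z, 0 <= dot s z -> vnorm z = R0 -> L * vnorm z - Phi z <= -1 / 2).
  { intros z Hz Nz. eapply Rle_trans; [apply Hvert, Hz|].
    set (e := vnorm (oblE v s c b z)). set (t := Rabs (dot b z)).
    assert (Pe : 0 <= e) by apply vnorm_nonneg. assert (Pt : 0 <= t) by apply Rabs_pos.
    assert (PK2 : 0 <= K2) by (unfold K2; generalize (Rabs_pos a); nra).
    assert (F1 : K2 * dot s z - pos2 (dot s z - 1) <= K2 + 1 + (K2 + 1) * (K2 + 1) / 4 - dot s z).
    { unfold pos2. generalize (growth_linear K2 (Rmax (dot s z - 1) 0)) (Rmax_l (dot s z - 1) 0). nra. }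
    assert (F2 := growth_linear K t). assert (F3 := growth_linear L e).
    assert (t * t <= C * (t * t)) by nra. assert (e * e <= C * (e * e)) by nra.
    assert (D := oblE_decomp n v s c b z). rewrite (Rabs_pos_eq (dot s z)) in D by exact Hz.
    fold t e in D. rewrite Nz in D.
    assert (D2 : R0 <= kap * (dot s z + t + e)) by (unfold kap; nra).
    assert (D3 : Rabs B + 1 <= dot s z + t + e).
    { apply Rmult_le_reg_l with kap; [unfold kap; lra|]. unfold R0 in D2. lra. }
    generalize (Rle_abs B). unfold B at 1. lra. }
  assert (Hface0 : forall z, dot s z = 0 -> L * vnorm z - Phi z <= del / 2).
  { intros z Hz. eapply Rle_trans; [apply Hvert; lra|]. rewrite Hz.
    assert (pos2 (0 - 1) = 0) by (unfold pos2; rewrite Rmax_right by lra; ring).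
    assert (F2 := growth_small K C (del / 4) (Rabs (dot b z)) ltac:(lra) (proj1 HCd)).
    assert (F3 := growth_small L C (del / 4) (vnorm (oblE v s c b z)) ltac:(lra) (proj2 HCd)).
    lra. }
  assert (HPhic : cont_on whole Phi).
  { unfold Phi.
    apply (cont_on_ext n _ (fun z => 1 * (a * dot s z + kk * dot b z) + 1 * (1 * pos2 (dot s z - 1) + C * Q z)));
      [intro; ring|].
    apply cont_on_lin; [apply cont_on_lin; apply cont_on_dot|].
    apply cont_on_lin; [|apply cont_on_oblQ].
    apply cont_on_of_modulus; intro w.
    exists (2 * Rmax (dot s w - 1) 0 * vnorm s), (vnorm s * vnorm s).
    assert (P2 := Rmax_r (dot s w - 1) 0). assert (Ps := vnorm_nonneg n s).
    split; [nra|split; [nra|]]. intro z.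
    assert (U := pos2_upper (dot s w - 1) (dot s z - 1)). assert (V := pos2_lower (dot s w - 1) (dot s z - 1)).
    replace (dot s z - 1 - (dot s w - 1)) with (dot s (vsub z w)) in U, V by (rewrite dot_sub_r; ring).
    assert (CS := cauchy_schwarz_abs n s (vsub z w)). change (vnorm (vsub z w)) with (dist z w) in CS.
    set (q := dot s (vsub z w)) in *.
    assert (Pq := Rabs_pos q). assert (Pd := dist_nonneg n z w).
    assert (Sq : q * q <= vnorm s * vnorm s * (dist z w * dist z w)).
    { replace (q * q) with (Rabs q * Rabs q) by (rewrite <- Rabs_mult; apply Rabs_pos_eq, Rle_0_sqr).
      replace (vnorm s * vnorm s * (dist z w * dist z w)) with ((vnorm s * dist z w) * (vnorm s * dist z w)) by ring.
      apply Rmult_le_compat; assumption. }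
    apply Rabs_le_inv in CS.
    assert (X1 : Rmax (dot s w - 1) 0 * q <= Rmax (dot s w - 1) 0 * (vnorm s * dist z w)) by (apply Rmult_le_compat_l; lra).
    assert (X2 : Rmax (dot s w - 1) 0 * (- (vnorm s * dist z w)) <= Rmax (dot s w - 1) 0 * q) by (apply Rmult_le_compat_l; lra).
    assert (0 <= q * q) by apply Rle_0_sqr.
    apply Rabs_le; split; lra. }
  destruct (oblQ_bound n v s c b) as [KQ [HKQ HQb]]. fold Q in HQb.
  assert (Hsemi : forall w, exists C', 0 <= C' /\ forall z,
     Phi z <= Phi w + dot (G w) (vsub z w) + C' * dot (vsub z w) (vsub z w)).
  { intro w. exists (vnorm s * vnorm s + C * KQ). split; [generalize (vnorm_nonneg n s); nra|]. intro z.
    assert (U := pos2_upper (dot s w - 1) (dot s z - 1)).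
    replace (dot s z - 1 - (dot s w - 1)) with (dot s (vsub z w)) in U by (rewrite dot_sub_r; ring).
    assert (CS := cauchy_schwarz_abs n s (vsub z w)).
    assert (Sq : dot s (vsub z w) * dot s (vsub z w) <= vnorm s * vnorm s * dot (vsub z w) (vsub z w)).
    { rewrite <- (vnorm_sq n (vsub z w)).
      replace (dot s (vsub z w) * dot s (vsub z w)) with (Rabs (dot s (vsub z w)) * Rabs (dot s (vsub z w)))
        by (rewrite <- Rabs_mult; apply Rabs_pos_eq, Rle_0_sqr).
      replace (vnorm s * vnorm s * (vnorm (vsub z w) * vnorm (vsub z w)))
        with ((vnorm s * vnorm (vsub z w)) * (vnorm s * vnorm (vsub z w))) by ring.
      apply Rmult_le_compat; try assumption; apply Rabs_pos. }
    unfold Phi. unfold Q at 1. rewrite (oblQ_expand n v s c b z w). fold Q Qg.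
    assert (QB := HQb (vsub z w)). apply (Rmult_le_compat_l C) in QB; [|lra].
    unfold G. rewrite !dot_add_l, !dot_scale_l.
    replace (dot s z) with (dot s w + dot s (vsub z w)) at 1 by (rewrite dot_sub_r; ring).
    replace (dot b z) with (dot b w + dot b (vsub z w)) at 1 by (rewrite dot_sub_r; ring).
    lra. }
  assert (HGb : exists P, 0 <= P /\ forall w, vnorm w <= R0 -> vnorm (G w) <= P).
  { destruct (oblQg_bound n v s c b) as [KG [HKG HQgb]]. fold Q Qg in HQgb.
    assert (Ps := vnorm_nonneg n s). assert (Pb := vnorm_nonneg n b).
    exists ((Rabs a + 2 * (vnorm s * R0)) * vnorm s + Rabs kk * vnorm b + C * (KG * sqrt (KQ * (R0 * R0)))).
    assert (Pa := Rabs_pos a). assert (Pkk := Rabs_pos kk).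
    assert (S0 := sqrt_pos (KQ * (R0 * R0))).
    split.
    { assert (0 <= vnorm s * R0) by nra. assert (0 <= KG * sqrt (KQ * (R0 * R0))) by nra. nra. }
    intros w Hw. unfold G.
    eapply Rle_trans; [apply vnorm_add|]. apply Rplus_le_compat.
    - eapply Rle_trans; [apply vnorm_add|]. rewrite !vnorm_scale. apply Rplus_le_compat_r.
      apply Rmult_le_compat_r; [exact Ps|]. eapply Rle_trans; [apply Rabs_triang|].
      apply Rplus_le_compat_l. assert (P2 := Rmax_r (dot s w - 1) 0).
      rewrite Rabs_pos_eq by lra. apply Rmult_le_compat_l; [lra|].
      assert (CS := cauchy_schwarz n s w).
      assert (vnorm s * vnorm w <= vnorm s * R0) by (apply Rmult_le_compat_l; assumption).
      apply Rmax_lub; nra.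
    - rewrite vnorm_scale, Rabs_pos_eq by lra. apply Rmult_le_compat_l; [lra|].
      eapply Rle_trans; [apply HQgb|]. apply Rmult_le_compat_l; [exact HKG|].
      apply sqrt_le_1_alt. eapply Rle_trans; [apply HQb|]. apply Rmult_le_compat_l; [exact HKQ|].
      rewrite <- vnorm_sq. apply Rmult_le_compat; try assumption; apply vnorm_nonneg. }
  destruct HGb as [P [HP HGb]].
  assert (HGv : forall w, d - del <= dot (G w) v).
  { intro w. unfold G, Qg. rewrite !dot_add_l, !dot_scale_l, oblQg_dot, HEv, Htan, dot_0_r.
    assert (P2 := Rmax_r (dot s w - 1) 0). fold a.
    destruct Hsv as [[E _]| ->]; [|lra]. rewrite E, dot_0_r. unfold a. rewrite (Hv0 E). lra. }
  assert (HGc : forall w, dot c (G w) = dot b c * (k + del + 2 * C * dot b w)).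
  { intro w. rewrite (dot_comm n c). unfold G, Qg. rewrite !dot_add_l, !dot_scale_l, oblQg_dot, HEc, Hsc, dot_0_r.
    unfold kk. ring. }
  assert (Goal2 : exists y p, closure O y /\ dist y x < eps /\
    H y p <= 0 /\ dot c p <= k + 2 * del /\ d - del <= dot p v).
  { destruct Hsv as [[Ev Es]|Hsv1].
    (* For [v = 0] there is no half-space to keep: [S] is constant, only the sphere is a face, and
       the level [-1/2] lies below the value [0] at the centre. *)
    - assert (S0 : forall w, dot s w = 0) by (intro; rewrite Es; apply dot_0_l).
      apply (blowup_test n O H gamma g u x b c k v d del r L P R0 (-1 / 2) (2 * C) Phi (fun _ => 1) G);
        try assumption; try lra.
      + intros w _ e0 He0. exists 1. split; [lra|]. intros. rewrite Rminus_diag, Rabs_R0. exact He0.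
      + intros w _. apply Hsemi.
      + intros w Hw _ [E|E]; [lra|]. apply Hface1; [rewrite S0; lra|exact E].
      + rewrite (Hv0 Ev). unfold Phi. rewrite S0, Htan, HQe, HEv, Htan, vnorm_0, Rabs_R0.
        unfold pos2. rewrite Rmax_right by lra. lra.
    - apply (blowup_test n O H gamma g u x b c k v d del r L P R0 (del / 2) (2 * C) Phi (fun w => dot s w) G);
        try assumption; try lra.
      + apply cont_on_dot.
      + intros w _. apply Hsemi.
      + intros w Hw Hs [E|E]; [apply Hface0, E|]. specialize (Hface1 w Hs E). lra.
      + unfold Phi. rewrite Hsv1, Htan, HQe, HEv, Htan, vnorm_0, Rabs_R0.
        unfold pos2, a. rewrite Rmax_right by lra. lra. }
  destruct Goal2 as [y [p [G1 [G2 [G3 [G4 G5]]]]]].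
  exists y, p. unfold del in *. repeat split; try assumption; lra.
Qed.

(** * Momenta attached to a direction at a point *)

Definition admissible {n} (O : vec n -> Prop) (H : vec n -> vec n -> R) (gamma : vec n -> vec n)
    (g : vec n -> R) (x p : vec n) : Prop :=
  H x p <= 0 /\ (boundary O x -> dot (gamma x) p <= g x).

(** The momenta of [directional_test] for [eps = 1/(j+1)] are bounded by uniform coercivity; a
    cluster point inherits the three closed conditions by continuity of [H] and of the scalar
    products. *)
Lemma directional_momentum n (O : vec n -> Prop) H gamma g u x b c k v d r L M :
  is_open O -> visc_subsol O H gamma g u -> frame O gamma g x b c k -> closure O x ->
  cont_on_prod (closure O) H ->
  (forall y p, closure O y -> H y p <= 0 -> vnorm p <= M) ->
  0 < r -> 0 <= L -> (forall y, closure O y -> dist y x < r -> Rabs (u y - u x) <= L * dist y x) ->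
  ascends O u x v d -> dot b v = 0 -> (v = vzero -> d = 0) ->
  exists p, admissible O H gamma g x p /\ d <= dot p v.
Proof.
  intros HO Hsub Hfr Cx HH Hco Hr HL Hlip Hasc Htan Hv0.
  assert (T := directional_test n O H gamma g u x b c k v d r L HO Hsub Hfr Cx Hr HL Hlip Hasc Htan Hv0).
  destruct (choice (fun (j : nat) (yp : vec n * vec n) => closure O (fst yp) /\
    dist (fst yp) x < / INR (S j) /\ H (fst yp) (snd yp) <= 0 /\ dot c (snd yp) <= k + / INR (S j) /\
    d - / INR (S j) <= dot (snd yp) v)) as [yp Hyp].
  { intro j. destruct (T (/ INR (S j)) (inv_INR_S_pos j)) as [y [p Hp]]. exists (y, p); exact Hp. }
  destruct (bolzano_weierstrass n (fun j => snd (yp j)) M) as [p [phi Hphi]].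
  { intro j. apply (Hco (fst (yp j))); apply Hyp. }
  assert (Near : forall eps, 0 < eps -> exists q y, closure O y /\ dist q p < eps /\ dist y x < eps /\
    H y q <= 0 /\ dot c q <= k + eps /\ d - eps <= dot q v).
  { intros eps He. destruct (Hphi eps He) as [N HN]. destruct (inv_INR_S_lt eps He) as [N' HN'].
    destruct (HN (max N N') ltac:(lia)) as [K1 K2]. set (j := phi (max N N')) in *.
    specialize (HN' j ltac:(lia)). destruct (Hyp j) as [J1 [J2 [J3 [J4 J5]]]].
    exists (snd (yp j)), (fst (yp j)). repeat split; try assumption; lra. }
  assert (Pc := vnorm_nonneg n c). assert (Pv := vnorm_nonneg n v).
  exists p. split; [split|].
  - apply Rnot_lt_le; intro C. destruct (HH x p Cx (H x p) C) as [e [He Hc]].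
    destruct (Near e He) as [q [y [Cy [Dq [Dy [Hq _]]]]]]. specialize (Hc y q Cy Dy Dq).
    apply Rabs_def2 in Hc. lra.
  - intro Bx. assert (dot c p <= k).
    { apply Rnot_lt_le; intro C. set (e := (dot c p - k) / (2 * (vnorm c + 1))).
      assert (He : 0 < e) by (apply Rdiv_lt_0_compat; lra).
      assert (Ee : e * (vnorm c + 1) = (dot c p - k) / 2) by (unfold e; field; lra).
      destruct (Near e He) as [q [y [Cy [Dq [_ [_ [Hq _]]]]]]].
      assert (CS := cauchy_schwarz n c (vsub p q)). change (vnorm (vsub p q)) with (dist p q) in CS.
      rewrite (dist_sym n p q), dot_sub_r in CS.
      assert (vnorm c * dist q p <= vnorm c * e) by (apply Rmult_le_compat_l; lra). lra. }
    destruct Hfr as [[[Ox _]|[_ [_ [-> ->]]]] _]; [destruct Bx; contradiction|assumption].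
  - apply Rnot_lt_le; intro C. set (e := (d - dot p v) / (2 * (vnorm v + 1))).
    assert (He : 0 < e) by (apply Rdiv_lt_0_compat; lra).
    assert (Ee : e * (vnorm v + 1) = (d - dot p v) / 2) by (unfold e; field; lra).
    destruct (Near e He) as [q [y [Cy [Dq [_ [_ [_ Hq]]]]]]].
    assert (CS := cauchy_schwarz n (vsub q p) v). change (vnorm (vsub q p)) with (dist q p) in CS.
    rewrite dot_sub_l in CS.
    assert (dist q p * vnorm v <= e * vnorm v) by (apply Rmult_le_compat_r; lra). lra.
Qed.

(** * Directions furnished by a curve *)

Lemma fin_common_delta n (P : Fin.t n -> R -> Prop) :
  (forall i, exists e, 0 < e /\ forall h, Rabs h < e -> P i h) ->
  exists e, 0 < e /\ forall h, Rabs h < e -> forall i, P i h.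
Proof.
  induction n as [|n IH]; intro Hi.
  - exists 1; split; [lra|]. intros h _ i; apply Fin.case0; exact i.
  - destruct (IH (fun i => P (Fin.FS i)) (fun i => Hi (Fin.FS i))) as [e1 [He1 H1]].
    destruct (Hi Fin.F1) as [e2 [He2 H2]].
    exists (Rmin e1 e2); split; [apply Rmin_pos; assumption|]. intros h Hh i.
    apply (Fin.caseS' i).
    + apply H2. eapply Rlt_le_trans; [exact Hh|apply Rmin_r].
    + intro j; apply H1. eapply Rlt_le_trans; [exact Hh|apply Rmin_l].
Qed.

Lemma curve_difference_quotient n (eta : R -> vec n) t v :
  (forall i, derivable_pt_lim (fun s => eta s i) t (v i)) ->
  forall eps, 0 < eps -> exists e, 0 < e /\ forall h, h <> 0 -> Rabs h < e ->
    dist (vscale (/ h) (vsub (eta (t + h)) (eta t))) v < eps.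
Proof.
  intros Hd eps He. assert (P := pos_INR n).
  assert (He' : 0 < eps / (INR n + 1)) by (apply Rdiv_lt_0_compat; lra).
  destruct (fin_common_delta n (fun i h => h <> 0 ->
    Rabs ((eta (t + h) i - eta t i) / h - v i) < eps / (INR n + 1))) as [e [He1 H1]].
  { intro i. destruct (Hd i _ He') as [e Hde]. exists e; split; [apply cond_pos|].
    intros h Hh N. apply Hde; assumption. }
  exists e; split; [exact He1|]. intros h N Hh.
  apply Rle_lt_trans with (INR n * (eps / (INR n + 1))).
  - apply vnorm_coord_bound; [lra|]. intro i. left.
    replace (vsub _ v i) with ((eta (t + h) i - eta t i) / h - v i)
      by (unfold vsub, vscale; field; exact N).
    apply H1; assumption.
  - replace eps with ((INR n + 1) * (eps / (INR n + 1))) at 2 by (field; lra). lra.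
Qed.

(* [sg = 1] gives the right derivative, [sg = -1] the left one. *)
Lemma curve_ascends n (O : vec n -> Prop) u (eta : R -> vec n) T t v d sg :
  sg = 1 \/ sg = -1 -> 0 < t < T -> (forall s, 0 <= s <= T -> closure O (eta s)) ->
  (forall i, derivable_pt_lim (fun s => eta s i) t (v i)) ->
  derivable_pt_lim (fun s => u (eta s)) t d ->
  ascends O u (eta t) (vscale sg v) (sg * d).
Proof.
  intros Hsg Ht Hin Hv Hd eps He.
  destruct (curve_difference_quotient n eta t v Hv eps He) as [e1 [He1 H1]].
  destruct (Hd eps He) as [e2 H2]. assert (He2 := cond_pos e2).
  set (m := Rmin (Rmin e1 e2) (Rmin eps (Rmin t (T - t)))).
  assert (Hm : 0 < m) by (unfold m; repeat apply Rmin_pos; lra).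
  assert (M : m <= e1 /\ m <= e2 /\ m <= eps /\ m <= t /\ m <= T - t).
  { unfold m. generalize (Rmin_l (Rmin e1 e2) (Rmin eps (Rmin t (T - t))))
     (Rmin_r (Rmin e1 e2) (Rmin eps (Rmin t (T - t)))) (Rmin_l e1 e2) (Rmin_r e1 e2)
     (Rmin_l eps (Rmin t (T - t))) (Rmin_r eps (Rmin t (T - t))) (Rmin_l t (T - t)) (Rmin_r t (T - t)). lra. }
  set (h := m / 2). assert (Hh : 0 < h < m) by (unfold h; lra).
  assert (N : sg * h <> 0) by (destruct Hsg; subst; lra).
  assert (A : Rabs (sg * h) = h).
  { destruct Hsg; subst; [rewrite Rmult_1_l; apply Rabs_pos_eq; lra|].
    replace (-1 * h) with (- h) by ring. rewrite Rabs_Ropp; apply Rabs_pos_eq; lra. }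
  assert (SS : sg * sg = 1) by (destruct Hsg; subst; ring).
  specialize (H1 (sg * h) N ltac:(lra)). specialize (H2 (sg * h) N ltac:(lra)).
  exists h, (vscale (/ h) (vsub (eta (t + sg * h)) (eta t))).
  assert (Ey : vadd (eta t) (vscale h (vscale (/ h) (vsub (eta (t + sg * h)) (eta t)))) = eta (t + sg * h))
    by (vext; field; lra).
  rewrite Ey. split; [lra|]. split; [|split].
  - replace (vscale (/ h) (vsub (eta (t + sg * h)) (eta t)))
      with (vscale sg (vscale (/ (sg * h)) (vsub (eta (t + sg * h)) (eta t)))).
    2:{ vext. destruct Hsg; subst; field; lra. }
    unfold dist in *. replace (vsub (vscale sg _) (vscale sg v))
      with (vscale sg (vsub (vscale (/ (sg * h)) (vsub (eta (t + sg * h)) (eta t))) v)) by vext.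
    rewrite vnorm_scale. replace (Rabs sg) with 1; [lra|].
    destruct Hsg; subst; [symmetry; apply Rabs_R1|rewrite Rabs_left; lra].
  - apply Hin. destruct Hsg; subst; lra.
  - set (du := u (eta (t + sg * h)) - u (eta t)) in *.
    apply Rabs_def2 in H2. destruct H2 as [H2a H2b].
    assert (E : du / (sg * h) = sg * du / h) by (destruct Hsg; subst; field; lra).
    rewrite E in H2a, H2b.
    replace du with (h * (sg * (sg * du / h))) by (field_simplify; [rewrite <- Rsqr_pow2; unfold Rsqr; rewrite SS; ring|lra]).
    apply Rmult_le_compat_l; [lra|]. destruct Hsg; subst; lra.
Qed.

Lemma admissible_convex n (O : vec n -> Prop) H gamma g x p q lam :
  (forall p q lam, 0 <= lam <= 1 ->
     H x (vadd (vscale lam p) (vscale (1 - lam) q)) <= lam * H x p + (1 - lam) * H x q) ->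
  0 <= lam <= 1 -> admissible O H gamma g x p -> admissible O H gamma g x q ->
  admissible O H gamma g x (vadd (vscale lam p) (vscale (1 - lam) q)).
Proof.
  intros A1 Hl [P1 P2] [Q1 Q2]. split.
  - eapply Rle_trans; [apply A1, Hl|]. nra.
  - intro Bx. specialize (P2 Bx). specialize (Q2 Bx). dots. nra.
Qed.

Lemma convex_combination_value a b d : b <= d <= a ->
  exists lam, 0 <= lam <= 1 /\ lam * a + (1 - lam) * b = d.
Proof.
  intros Hd. destruct (Req_dec a b) as [E|N].
  - exists 0. split; lra.
  - exists ((d - b) / (a - b)). assert (0 < a - b) by lra. split; [|field; lra].
    assert (0 < / (a - b)) by (apply Rinv_0_lt_compat; lra). split.
    + apply Rmult_le_pos; lra.
    + apply Rmult_le_reg_r with (a - b); [lra|]. unfold Rdiv. rewrite Rmult_assoc, Rinv_l; lra.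
Qed.

(* A curve staying in the closure is tangent to the boundary at each differentiability time where it
   touches it, so both [v] and [- v] are directions for [directional_momentum]. *)
Lemma curve_momentum n (O : vec n -> Prop) H gamma g u M r L (eta : R -> vec n) T t v d :
  is_open O -> visc_subsol O H gamma g u -> cont_on_prod (closure O) H ->
  (forall x, closure O x -> exists b c k, frame O gamma g x b c k) ->
  (forall x p q lam, closure O x -> 0 <= lam <= 1 ->
     H x (vadd (vscale lam p) (vscale (1 - lam) q)) <= lam * H x p + (1 - lam) * H x q) ->
  (forall y p, closure O y -> H y p <= 0 -> vnorm p <= M) ->
  0 < r -> 0 <= L ->
  (forall x y, closure O x -> closure O y -> dist y x < r -> Rabs (u y - u x) <= L * dist y x) ->
  0 < t < T -> (forall s, 0 <= s <= T -> closure O (eta s)) ->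
  (forall i, derivable_pt_lim (fun s => eta s i) t (v i)) ->
  derivable_pt_lim (fun s => u (eta s)) t d ->
  exists p, admissible O H gamma g (eta t) p /\ dot p v = d.
Proof.
  intros HO Hsub HH Hfr A1 Hco Hr HL Hlip Ht Hin Hv Hd.
  assert (Cx : closure O (eta t)) by (apply Hin; lra).
  destruct (Hfr _ Cx) as [b [c [k Hf]]].
  assert (As1 := curve_ascends n O u eta T t v d 1 (or_introl eq_refl) Ht Hin Hv Hd).
  assert (As2 := curve_ascends n O u eta T t v d (-1) (or_intror eq_refl) Ht Hin Hv Hd).
  assert (T1 := ascends_tangent n O gamma g u _ b c k _ _ Hf As1).
  assert (T2 := ascends_tangent n O gamma g u _ b c k _ _ Hf As2).
  rewrite dot_scale_r in T1, T2.
  (* With zero velocity there is no direction in which to test. The curve then moves by [o(h)], and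
     the Lipschitz bound on [u] forces [d = 0]. *)
  assert (Hd0 : v = vzero -> d = 0).
  { intros ->. destruct (Req_dec d 0) as [|Nd]; [assumption|].
    assert (Rabs d <= 0); [|generalize (Rabs_pos_lt d Nd); lra].
    apply le_epsilon. intros eps He. rewrite Rplus_0_l.
    set (e := Rmin (eps / (2 * (L + 1))) r).
    assert (He' : 0 < e) by (apply Rmin_pos; [apply Rdiv_lt_0_compat|]; lra).
    assert (Le : e * (L + 1) <= eps / 2).
    { replace (eps / 2) with (eps / (2 * (L + 1)) * (L + 1)) by (field; lra).
      apply Rmult_le_compat_r; [lra|apply Rmin_l]. }
    destruct (curve_difference_quotient n eta t vzero Hv e He') as [e1 [He1 H1]].
    destruct (Hd (eps / 2) ltac:(lra)) as [e2 H2]. assert (He2 := cond_pos e2).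
    set (m := Rmin (Rmin e1 e2) (Rmin 1 (T - t))).
    assert (Hm : 0 < m) by (unfold m; repeat apply Rmin_pos; lra).
    assert (Mm : m <= e1 /\ m <= e2 /\ m <= 1 /\ m <= T - t).
    { unfold m. generalize (Rmin_l (Rmin e1 e2) (Rmin 1 (T - t)))
       (Rmin_r (Rmin e1 e2) (Rmin 1 (T - t))) (Rmin_l e1 e2) (Rmin_r e1 e2)
       (Rmin_l 1 (T - t)) (Rmin_r 1 (T - t)). lra. }
    set (h := m / 2). assert (Hh : 0 < h < m) by (unfold h; lra).
    assert (Ah : Rabs h = h) by (apply Rabs_pos_eq; lra).
    specialize (H1 h ltac:(lra) ltac:(lra)). specialize (H2 h ltac:(lra) ltac:(lra)).
    assert (Ed : dist (eta (t + h)) (eta t) = h * dist (vscale (/ h) (vsub (eta (t + h)) (eta t))) vzero).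
    { unfold dist. replace (vsub (vscale (/ h) (vsub (eta (t + h)) (eta t))) vzero)
        with (vscale (/ h) (vsub (eta (t + h)) (eta t))) by vext.
      rewrite vnorm_scale, Rabs_pos_eq; [field; lra|]. left; apply Rinv_0_lt_compat; lra. }
    assert (De : dist (eta (t + h)) (eta t) < h * e) by (rewrite Ed; apply Rmult_lt_compat_l; lra).
    assert (er : e <= r) by apply Rmin_r.
    specialize (Hlip (eta t) (eta (t + h)) Cx ltac:(apply Hin; lra) ltac:(nra)).
    assert (Q : Rabs ((u (eta (t + h)) - u (eta t)) / h) <= L * e).
    { unfold Rdiv. rewrite Rabs_mult, Rabs_inv, Ah.
      apply Rmult_le_reg_r with h; [lra|]. rewrite Rmult_assoc, Rinv_l, Rmult_1_r by lra.
      eapply Rle_trans; [exact Hlip|]. replace (L * e * h) with (L * (h * e)) by ring.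
      apply Rmult_le_compat_l; lra. }
    set (q := (u (eta (t + h)) - u (eta t)) / h) in *.
    apply Rabs_le_inv in Q. apply Rabs_def2 in H2. apply Rabs_le; lra. }
  destruct (directional_momentum n O H gamma g u (eta t) b c k (vscale 1 v) (1 * d) r L M)
    as [p1 [P1 P2]]; try assumption; auto.
  { rewrite dot_scale_r; lra. }
  { intros E. rewrite Hd0; [ring|]. rewrite <- E; vext. }
  destruct (directional_momentum n O H gamma g u (eta t) b c k (vscale (-1) v) (-1 * d) r L M)
    as [p2 [Q1 Q2]]; try assumption; auto.
  { rewrite dot_scale_r; lra. }
  { intros E. rewrite Hd0; [ring|].
    replace v with (vscale (-1) (vscale (-1) v)) by vext. rewrite E; vext. }
  rewrite dot_scale_r in P2, Q2.
  destruct (convex_combination_value (dot p1 v) (dot p2 v) d) as [lam [Hl El]]; [lra|].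
  exists (vadd (vscale lam p1) (vscale (1 - lam) p2)). split.
  - apply admissible_convex; auto.
  - dots. exact El.
Qed.

(** * Null sets *)

(** A countable cover of total length at most [c]. Unlike the strict bound in [null_set], the
    non-strict bound on partial sums lets costs simply add over unions. *)
Definition covered (E : R -> Prop) (c : R) : Prop :=
  exists a b : nat -> R, (forall k, a k <= b k) /\ (forall x, E x -> exists k, a k < x < b k) /\
    forall N, sum_f_R0 (fun k => b k - a k) N <= c.

Definition lsum {A} (f : A -> R) (l : list A) : R := fold_right (fun x s => f x + s) 0 l.

Lemma lsum_app A (f : A -> R) l l' : lsum f (l ++ l') = lsum f l + lsum f l'.
Proof. induction l as [|x l IH]; simpl; [ring|rewrite IH; ring]. Qed.

Lemma lsum_nonneg A (f : A -> R) l : (forall x, In x l -> 0 <= f x) -> 0 <= lsum f l.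
Proof.
  induction l as [|x l IH]; simpl; intro P; [lra|].
  generalize (P x (or_introl eq_refl)) (IH (fun y Hy => P y (or_intror Hy))); lra.
Qed.

Lemma lsum_le A (f h : A -> R) l : (forall x, In x l -> f x <= h x) -> lsum f l <= lsum h l.
Proof.
  induction l as [|x l IH]; simpl; intro P; [lra|].
  generalize (P x (or_introl eq_refl)) (IH (fun y Hy => P y (or_intror Hy))); lra.
Qed.

Lemma lsum_map A B (f : B -> R) (h : A -> B) l : lsum f (map h l) = lsum (fun x => f (h x)) l.
Proof. induction l as [|x l IH]; simpl; [reflexivity|rewrite IH; reflexivity]. Qed.

Lemma lsum_incl A (f : A -> R) l l' : (forall x, 0 <= f x) -> NoDup l -> incl l l' ->
  lsum f l <= lsum f l'.
Proof.
  intros P. revert l'. induction l as [|x l IH]; intros l' ND Hi; [apply lsum_nonneg; auto|].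
  inversion ND as [|? ? Nx ND']; subst.
  destruct (in_split x l' (Hi x (or_introl eq_refl))) as [l1 [l2 ->]].
  assert (A1 : lsum f l <= lsum f (l1 ++ l2)).
  { apply IH; [exact ND'|]. intros y Hy. specialize (Hi y (or_intror Hy)).
    apply in_app_iff in Hi. apply in_app_iff. destruct Hi as [|[->|]]; auto. contradiction. }
  rewrite lsum_app in *. simpl. lra.
Qed.

Lemma lsum_prod A B (f : A * B -> R) l l' :
  lsum f (list_prod l l') = lsum (fun x => lsum (fun y => f (x, y)) l') l.
Proof.
  induction l as [|x l IH]; simpl; [reflexivity|]. rewrite lsum_app, lsum_map, IH. reflexivity.
Qed.

Lemma sum_f_R0_lsum f N : sum_f_R0 f N = lsum f (seq 0 (S N)).
Proof.
  induction N as [|N IH]; [simpl; ring|].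
  rewrite seq_S, lsum_app, <- IH. simpl. ring.
Qed.

Lemma covered_nonneg E c : covered E c -> 0 <= c.
Proof. intros [a [b [H1 [_ H3]]]]. specialize (H1 0%nat). specialize (H3 0%nat). simpl in H3. lra. Qed.

Lemma covered_mono (E F : R -> Prop) c d : covered E c -> (forall x, F x -> E x) -> c <= d -> covered F d.
Proof.
  intros [a [b [H1 [H2 H3]]]] HF Hc. exists a, b. split; [exact H1|]. split; [auto|].
  intro N; specialize (H3 N); lra.
Qed.

(** The double family of intervals is enumerated by the Cantor pairing. A code is at least as large
    as both of its components, so the first [N + 1] codes lie in a square of side [N + 1], over
    which one sums row by row. *)
Lemma covered_Union (E : nat -> R -> Prop) (c : nat -> R) C :
  (forall i, covered (E i) (c i)) -> (forall N, sum_f_R0 c N <= C) ->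
  covered (fun x => exists i, E i x) C.
Proof.
  intros HE HC. destruct (choice _ HE) as [a Ha]. destruct (choice _ Ha) as [b Hb].
  exists (fun k => a (fst (of_nat k)) (snd (of_nat k))), (fun k => b (fst (of_nat k)) (snd (of_nat k))).
  split; [intro k; apply Hb|]. split.
  - intros x [i Hx]. destruct (Hb i) as [_ [Hc _]]. destruct (Hc x Hx) as [k Hk].
    exists (to_nat (i, k)). rewrite cancel_of_to. exact Hk.
  - intro N. eapply Rle_trans; [|apply (HC N)]. rewrite !sum_f_R0_lsum.
    set (F := fun p : nat * nat => b (fst p) (snd p) - a (fst p) (snd p)).
    assert (PF : forall p, 0 <= F p) by (intros [i j]; unfold F; destruct (Hb i) as [A _]; specialize (A j); simpl; lra).
    rewrite <- (lsum_map _ _ F of_nat).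
    eapply Rle_trans; [apply (lsum_incl _ F _ (list_prod (seq 0 (S N)) (seq 0 (S N))) PF)|].
    + apply NoDup_map_NoDup_ForallPairs; [|apply seq_NoDup].
      intros x y _ _ E0. rewrite <- (cancel_to_of x), <- (cancel_to_of y), E0. reflexivity.
    + intros [i j] Hij. apply in_map_iff in Hij. destruct Hij as [k [Ek Hk]]. apply in_seq in Hk.
      assert (Ek' := cancel_to_of k). rewrite Ek in Ek'.
      assert (B := to_nat_non_decreasing i j). apply in_prod; apply in_seq; lia.
    + rewrite lsum_prod. apply lsum_le; intros i _.
      destruct (Hb i) as [_ [_ Hc]]. specialize (Hc N). rewrite sum_f_R0_lsum in Hc. exact Hc.
Qed.

Lemma covered_empty (E : R -> Prop) : (forall x, ~ E x) -> covered E 0.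
Proof.
  intro N; exists (fun _ => 0), (fun _ => 0). split; [intro; lra|]. split; [intros x Hx; exfalso; apply (N x Hx)|].
  intro M.   induction M as [|M IH]; simpl in *; lra.
Qed.

Lemma covered_itv a b : a <= b -> covered (fun x => a < x < b) (b - a).
Proof.
  intro Hab. exists (fun k => a), (fun k => match k with O => b | _ => a end).
  split; [intros [|k]; lra|]. split; [intros x Hx; exists 0%nat; exact Hx|].
  induction N as [|N IH]; simpl in *; lra.
Qed.

Lemma covered_union (E F : R -> Prop) c d : covered E c -> covered F d -> covered (fun x => E x \/ F x) (c + d).
Proof.
  intros HE HF. assert (Pc := covered_nonneg _ _ HE). assert (Pd := covered_nonneg _ _ HF).
  apply covered_mono with
    (E := fun x => exists i, match i with 0%nat => E | 1%nat => F | _ => fun _ => False end x) (c := c + d).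
  - apply covered_Union with (c := fun i => match i with 0%nat => c | 1%nat => d | _ => 0 end).
    + intros [|[|i]]; auto. apply covered_empty; auto.
    + assert (A : forall N, sum_f_R0 (fun i => match i with 0%nat => c | 1%nat => d | _ => 0 end) (S N) = c + d).
      { induction N as [|N IH]; [reflexivity|]. rewrite tech5, IH. ring. }
      intros [|N]; [simpl; lra|rewrite A; lra].
  - intros x [Hx|Hx]; [exists 0%nat|exists 1%nat]; exact Hx.
  - lra.
Qed.

Lemma covered_point (p eps : R) : 0 < eps -> covered (fun x => x = p) eps.
Proof.
  intro He. apply covered_mono with (1 := covered_itv (p - eps / 2) (p + eps / 2) ltac:(lra)).
  - intros x ->; lra.
  - lra.
Qed.

Lemma null_covered (E : R -> Prop) : null_set E <-> forall eps, 0 < eps -> covered E eps.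
Proof.
  split.
  - intros HE eps He. destruct (HE eps He) as [a [b [H1 [H2 H3]]]]. exists a, b.
    split; [exact H1|]. split; [exact H2|]. intro N; left; apply H3.
  - intros HE eps He. destruct (HE (eps / 2) ltac:(lra)) as [a [b [H1 [H2 H3]]]]. exists a, b.
    split; [exact H1|]. split; [exact H2|]. intro N; specialize (H3 N); lra.
Qed.

Lemma null_mono (E F : R -> Prop) : null_set E -> (forall x, F x -> E x) -> null_set F.
Proof.
  intros HE HF eps He. destruct (HE eps He) as [a [b [H1 [H2 H3]]]]. exists a, b. auto.
Qed.

Lemma null_Union (E : nat -> R -> Prop) : (forall i, null_set (E i)) -> null_set (fun x => exists i, E i x).
Proof.
  intros HE. apply null_covered. intros eps He.
  apply covered_Union with (c := fun i => eps * (/ 2) ^ (S i)).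
  - intro i. apply null_covered; [apply HE|]. apply Rmult_lt_0_compat; [exact He|apply pow_lt; lra].
  - intro N. assert (A : sum_f_R0 (fun i => eps * (/ 2) ^ (S i)) N = eps * (1 - (/ 2) ^ (S N))).
    { induction N as [|N IH]; [simpl; lra|]. rewrite tech5, IH. simpl. field. }
    rewrite A. assert (0 < (/ 2) ^ (S N)) by (apply pow_lt; lra). nra.
Qed.

Lemma null_union (E F : R -> Prop) : null_set E -> null_set F -> null_set (fun x => E x \/ F x).
Proof.
  intros HE HF. apply null_covered. intros eps He.
  replace eps with (eps / 2 + eps / 2) by field.
  apply covered_union; apply null_covered; auto; lra.
Qed.

Lemma null_point p : null_set (fun x => x = p).
Proof. apply null_covered; intros; apply covered_point; assumption. Qed.

(** * A maximal inequality for monotone functions *)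

Definition disj (I J : R * R) : Prop := snd I <= fst J \/ snd J <= fst I.

Lemma FOP_filter A (P : A -> A -> Prop) (f : A -> bool) l : ForallOrdPairs P l -> ForallOrdPairs P (filter f l).
Proof.
  induction 1 as [|x l Hx Hl IH]; simpl; [constructor|].
  destruct (f x); [|exact IH]. constructor; [|exact IH].
  rewrite Forall_forall in *. intros y Hy. apply filter_In in Hy. apply Hx, Hy.
Qed.

Lemma lsum_filter A (f : A -> R) (k : A -> bool) l :
  lsum f l = lsum f (filter k l) + lsum f (filter (fun x => negb (k x)) l).
Proof. induction l as [|x l IH]; simpl; [ring|]. rewrite IH. destruct (k x); simpl; ring. Qed.

(** The list is not sorted, so the induction is on its length: the head interval separates the
    others into those on its left and those on its right, and the increments telescope. *)
Lemma disjoint_increments (A : R -> R) l : forall p q,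
  p <= q -> (forall x y, p <= x -> x <= y -> y <= q -> A x <= A y) ->
  ForallOrdPairs disj l -> (forall I, In I l -> p <= fst I <= snd I /\ snd I <= q) ->
  lsum (fun I => A (snd I) - A (fst I)) l <= A q - A p.
Proof.
  remember (length l) as m eqn:Em. assert (Hm : (length l <= m)%nat) by lia. clear Em.
  revert l Hm. induction m as [|m IH]; intros l Hm p q Hpq HA Hd Hin.
  - destruct l; [simpl; specialize (HA p q); lra|simpl in Hm; lia].
  - destruct l as [|[a b] l]; [simpl; specialize (HA p q); lra|].
    inversion Hd as [|? ? Hx Hd']; subst. rewrite Forall_forall in Hx.
    destruct (Hin (a, b) (or_introl eq_refl)) as [[Ha Hab] Hb]. simpl in Ha, Hab, Hb.
    set (k := fun J : R * R => if Rle_dec (snd J) a then true else false).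
    simpl. rewrite (lsum_filter _ _ k l).
    simpl in Hm.
    assert (F1 := filter_length_le k l). assert (F2 := filter_length_le (fun x => negb (k x)) l).
    assert (B1 : lsum (fun I => A (snd I) - A (fst I)) (filter k l) <= A a - A p).
    { apply IH; [lia|lra| |apply FOP_filter; exact Hd'|].
      - intros; apply HA; lra.
      - intros J HJ. apply filter_In in HJ. destruct HJ as [HJ1 HJ2].
        specialize (Hin J (or_intror HJ1)). unfold k in HJ2. destruct (Rle_dec (snd J) a); [lra|discriminate]. }
    assert (B2 : lsum (fun I => A (snd I) - A (fst I)) (filter (fun x => negb (k x)) l) <= A q - A b).
    { apply IH; [lia|lra| |apply FOP_filter; exact Hd'|].
      - intros; apply HA; lra.
      - intros J HJ. apply filter_In in HJ. destruct HJ as [HJ1 HJ2].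
        specialize (Hin J (or_intror HJ1)). specialize (Hx J HJ1). unfold k in HJ2. unfold disj in Hx. simpl in Hx.
        destruct (Rle_dec (snd J) a); [discriminate|]. lra. }
    lra.
Qed.

(* Greedy Vitali selection: each new interval has more than half the largest available length, so the
   selected intervals, enlarged five times, cover the whole family. *)
Lemma maximal_cover (A : R -> R) (Fam : R -> R -> Prop) p q beta :
  p <= q -> 0 < beta -> (forall x y, p <= x -> x <= y -> y <= q -> A x <= A y) ->
  (forall a b, Fam a b -> p <= a /\ a < b /\ b <= q /\ beta * (b - a) <= A b - A a) ->
  covered (fun x => exists a b, Fam a b /\ a < x < b) (5 * (A q - A p) / beta).
Proof.
  intros Hpq Hbeta HA HF.
  set (free := fun (l : list (R * R)) (J : R * R) => Fam (fst J) (snd J) /\ Forall (fun I => disj I J) l).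
  (* Once no interval of the family is disjoint from the list, the degenerate interval [(p, p)]
     serves as a filler of length zero, so the selection is an infinite sequence in all cases. *)
  destruct (choice (fun (l : list (R * R)) (J : R * R) =>
     (free l J /\ forall J', free l J' -> snd J' - fst J' <= 2 * (snd J - fst J)) \/
     ((forall J', ~ free l J') /\ J = (p, p)))) as [next Hnext].
  { intro l. destruct (classic (exists J, free l J)) as [[J0 HJ0]|N].
    - destruct (completeness (fun c => exists J, free l J /\ c = snd J - fst J)) as [s [Hs1 Hs2]].
      + exists (q - p). intros c [J [[HJ _] ->]]. apply HF in HJ. lra.
      + exists (snd J0 - fst J0), J0; auto.
      + assert (Hs0 : 0 < s).
        { assert (snd J0 - fst J0 <= s) by (apply Hs1; exists J0; auto).
          destruct HJ0 as [HJ0 _]. apply HF in HJ0. lra. }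
        destruct (classic (exists J, free l J /\ s / 2 < snd J - fst J)) as [[J [HJ HJs]]|N].
        * exists J; left; split; [exact HJ|]. intros J' HJ'.
          assert (snd J' - fst J' <= s) by (apply Hs1; exists J'; auto). lra.
        * exfalso. assert (s <= s / 2); [|lra]. apply Hs2. intros c [J [HJ ->]].
          apply Rnot_lt_le; intro C. apply N. exists J; auto.
    - exists (p, p); right; split; [|reflexivity]. intros J HJ; apply N; exists J; exact HJ. }
  set (build := fix build (k : nat) : list (R * R) :=
    match k with O => [] | S k => next (build k) :: build k end).
  set (s := fun k => next (build k)).
  assert (Hs : forall k, p <= fst (s k) <= snd (s k) /\ snd (s k) <= q /\
     beta * (snd (s k) - fst (s k)) <= A (snd (s k)) - A (fst (s k))).
  { intro k. unfold s. destruct (Hnext (build k)) as [[[HJ _] _]|[_ ->]].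
    - apply HF in HJ. lra.
    - simpl. lra. }
  assert (Hin : forall k I, In I (build k) -> exists j, (j < k)%nat /\ I = s j).
  { induction k as [|k IH]; simpl; intros I HI; [contradiction|].
    destruct HI as [<-|HI]; [exists k; split; [lia|reflexivity]|].
    destruct (IH I HI) as [j [Hj Ej]]. exists j; split; [lia|exact Ej]. }
  assert (Hdis : forall k, ForallOrdPairs disj (build k)).
  { induction k as [|k IH]; simpl; constructor; [|exact IH].
    destruct (Hnext (build k)) as [[[_ HJ] _]|[_ E]].
    - revert HJ. apply Forall_impl. unfold disj; tauto.
    - rewrite E. apply Forall_forall; intros I HI. destruct (Hin k I HI) as [j [_ ->]].
      left; simpl. apply Hs. }
  assert (Hsum : forall k, lsum (fun I => beta * (snd I - fst I)) (build k) <= A q - A p).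
  { intro k. eapply Rle_trans; [apply lsum_le|apply (disjoint_increments A (build k) p q Hpq HA (Hdis k))].
    - intros I HI. destruct (Hin k I HI) as [j [_ ->]]. apply Hs.
    - intros I HI. destruct (Hin k I HI) as [j [_ ->]]. specialize (Hs j). lra. }
  (* An interval meeting [s k] and at most twice as long stays within two lengths of it on either
     side; hence the factor [5 = 1 + 2 + 2]. *)
  exists (fun k => fst (s k) - 2 * (snd (s k) - fst (s k))), (fun k => snd (s k) + 2 * (snd (s k) - fst (s k))).
  split; [intro k; specialize (Hs k); lra|]. split.
  - intros x [a [b [HFab Hx]]].
    assert (Hlong : forall k, Forall (fun I => disj I (a, b)) (build k) -> b - a <= 2 * (snd (s k) - fst (s k))).
    { intros k Hk. unfold s. destruct (Hnext (build k)) as [[_ Hmax]|[N _]].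
      - apply (Hmax (a, b)). split; [exact HFab|exact Hk].
      - exfalso. apply (N (a, b)). split; [exact HFab|exact Hk]. }
    assert (Hfirst : forall k, Forall (fun I => disj I (a, b)) (build k) \/
       exists j, Forall (fun I => disj I (a, b)) (build j) /\ ~ disj (s j) (a, b)).
    { induction k as [|k [IH|IH]]; simpl; [left; constructor| |right; exact IH].
      destruct (classic (disj (s k) (a, b))); [left; constructor; assumption|right; exists k; auto]. }
    destruct (classic (exists j, Forall (fun I => disj I (a, b)) (build j) /\ ~ disj (s j) (a, b)))
      as [[j [Hj1 Hj2]]|N].
    + exists j. specialize (Hlong j Hj1). unfold disj in Hj2. simpl in Hj2.
      apply not_or_and in Hj2. destruct Hj2 as [D1 D2]. lra.
    + exfalso.
      assert (Hall : forall k, Forall (fun I => disj I (a, b)) (build k)).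
      { intro k. destruct (Hfirst k); [assumption|contradiction]. }
      (* If [(a, b)] stayed disjoint from every selected interval, each of them would have length at
         least [(b - a) / 2], and the sums would exceed [A q - A p]. *)
      assert (Hgrow : forall k, INR k * (beta * ((b - a) / 2)) <= lsum (fun I => beta * (snd I - fst I)) (build k)).
      { induction k as [|k IH]; [simpl; lra|]. rewrite S_INR. simpl build. simpl lsum.
        change (next (build k)) with (s k).
        assert (beta * ((b - a) / 2) <= beta * (snd (s k) - fst (s k))).
        { apply Rmult_le_compat_l; [lra|]. specialize (Hlong k (Hall k)). lra. }
        lra. }
      apply HF in HFab. set (w := beta * ((b - a) / 2)) in *.
      assert (Hw : 0 < w) by (apply Rmult_lt_0_compat; lra).
      destruct (INR_unbounded ((A q - A p) / w)) as [k Hk].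
      specialize (Hgrow k). specialize (Hsum k).
      apply (Rmult_lt_compat_r w) in Hk; [|exact Hw].
      replace ((A q - A p) / w * w) with (A q - A p) in Hk by (field; lra). lra.
  - intro N.
    assert (E : forall N, sum_f_R0 (fun k => snd (s k) + 2 * (snd (s k) - fst (s k))
        - (fst (s k) - 2 * (snd (s k) - fst (s k)))) N
        = 5 / beta * lsum (fun I => beta * (snd I - fst I)) (build (S N))).
    { clear N. induction N as [|N IH].
      - simpl. change (next []) with (s 0%nat). field; lra.
      - rewrite tech5, IH. change (build (S (S N))) with (s (S N) :: build (S N)). simpl lsum. field; lra. }
    rewrite E. replace (5 * (A q - A p) / beta) with (5 / beta * (A q - A p)) by (field; lra).
    apply Rmult_le_compat_l; [|apply Hsum]. left; apply Rdiv_lt_0_compat; lra.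
Qed.

(** * Absolutely continuous functions are differentiable almost everywhere *)

Definition variation (f : R -> R) (l : list (R * R)) : R :=
  lsum (fun ab => Rabs (f (snd ab) - f (fst ab))) l.

Definition chain_in (p q : R) (l : list (R * R)) : Prop :=
  itv_chain p l /\ Forall (fun ab => snd ab <= q) l.

Lemma chain_snoc l : forall p x a b, chain_in p x l -> p <= x -> x <= a -> a <= b ->
  chain_in p b (l ++ [(a, b)]).
Proof.
  induction l as [|[c d] l IH]; intros p x a b [Hl HF] Hpx Hxa Hab.
  - split; simpl; [lra|]. constructor; [simpl; lra|constructor].
  - simpl in Hl. inversion HF as [|? ? H1 H2]; subst. simpl in H1.
    destruct (IH d x a b) as [I1 I2]; [split; tauto|tauto|assumption|assumption|].
    split; simpl; [tauto|]. constructor; [simpl; lra|exact I2].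
Qed.

Lemma chain_weaken p q q' l : chain_in p q l -> q <= q' -> chain_in p q' l.
Proof. intros [A B] Hq; split; [exact A|]. revert B; apply Forall_impl; intros; lra. Qed.

(** [V x] is the supremum of [variation f] over chains in [[p, x]]; appending [[a, b]] to a chain in
    [[p, a]] gives the bound on increments. A chain may leave gaps between its intervals. *)
Lemma variation_function (f : R -> R) p q B : p <= q ->
  (forall l, chain_in p q l -> variation f l <= B) ->
  exists V : R -> R, 0 <= V p /\
    (forall a b, p <= a -> a <= b -> b <= q -> Rabs (f b - f a) <= V b - V a) /\
    forall eps, 0 < eps -> exists l, chain_in p q l /\ V q - eps < variation f l.
Proof.
  intros Hpq HB.
  destruct (choice (fun x v => x <= q -> p <= x ->
      is_lub (fun c => exists l, chain_in p x l /\ c = variation f l) v)) as [V HV].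
  { intro x. destruct (Rle_dec x q) as [Hx|]; [|exists 0; intros; lra].
    destruct (completeness (fun c => exists l, chain_in p x l /\ c = variation f l)) as [v Hv].
    - exists B; intros c [l [Hl ->]]. apply HB. apply chain_weaken with x; assumption.
    - exists 0, []. split; [split; [exact I|constructor]|reflexivity].
    - exists v; intros; exact Hv. }
  exists V. split; [|split].
  - apply (HV p Hpq (Rle_refl p)). exists []. split; [split; [exact I|constructor]|reflexivity].
  - intros a b Ha Hab Hb.
    assert (Va := HV a ltac:(lra) Ha). assert (Vb := HV b Hb ltac:(lra)).
    assert (V a <= V b - Rabs (f b - f a)); [|lra].
    apply Va. intros c [l [Hl ->]].
    assert (variation f (l ++ [(a, b)]) <= V b).
    { apply Vb. exists (l ++ [(a, b)]). split; [apply chain_snoc with a; auto; lra|reflexivity]. }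
    unfold variation in *. rewrite lsum_app in H. simpl in H. lra.
  - intros eps He. assert (Vq := HV q (Rle_refl q) Hpq).
    apply NNPP; intro N. assert (V q <= V q - eps); [|lra]. apply Vq.
    intros c [l [Hl ->]]. apply Rnot_lt_le; intro C. apply N. exists l; auto.
Qed.

(** For [f] minus a linear function of slope [c], this says that slopes of [f] over intervals
    shrinking around [x] return both to at least [c + alpha] and to at most [c - alpha]. *)
Definition oscillates (f : R -> R) (alpha x : R) : Prop :=
  forall delta, 0 < delta ->
    (exists a b, x - delta < a < x /\ x < b < x + delta /\ alpha * (b - a) <= f b - f a) /\
    (exists a b, x - delta < a < x /\ x < b < x + delta /\ f b - f a <= - (alpha * (b - a))).

(** Oscillation provides slopes of both signs, so intervals against the sign of [f b - f a] may be
    chosen. On these [V - f], respectively [V + f], grows at rate at least [alpha]; it is monotone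
    and its total increment is [V b - V a - Rabs (f b - f a)]. The first bound uses [V] alone and
    serves the gaps of a chain. *)
Lemma oscillates_gap (f V : R -> R) alpha a b :
  a <= b -> 0 < alpha ->
  (forall x y, a <= x -> x <= y -> y <= b -> Rabs (f y - f x) <= V y - V x) ->
  covered (fun x => a < x < b /\ oscillates f alpha x) (5 * (V b - V a) / alpha) /\
  covered (fun x => a < x < b /\ oscillates f alpha x) (5 * (V b - V a - Rabs (f b - f a)) / alpha).
Proof.
  intros Hab Ha HV.
  set (inc := fun c d => a <= c /\ c < d /\ d <= b /\ alpha * (d - c) <= f d - f c).
  set (dec := fun c d => a <= c /\ c < d /\ d <= b /\ f d - f c <= - (alpha * (d - c))).
  assert (Hinc : forall x, a < x < b /\ oscillates f alpha x -> exists c d, inc c d /\ c < x < d).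
  { intros x [Hx Ho]. destruct (Ho (Rmin (x - a) (b - x)) ltac:(apply Rmin_pos; lra)) as [[c [d [H1 [H2 H3]]]] _].
    generalize (Rmin_l (x - a) (b - x)) (Rmin_r (x - a) (b - x)); intros.
    exists c, d. unfold inc. lra. }
  assert (Hdec : forall x, a < x < b /\ oscillates f alpha x -> exists c d, dec c d /\ c < x < d).
  { intros x [Hx Ho]. destruct (Ho (Rmin (x - a) (b - x)) ltac:(apply Rmin_pos; lra)) as [_ [c [d [H1 [H2 H3]]]]].
    generalize (Rmin_l (x - a) (b - x)) (Rmin_r (x - a) (b - x)); intros.
    exists c, d. unfold dec. lra. }
  split; [|destruct (Rle_dec 0 (f b - f a)) as [Hs|Hs%Rnot_le_lt]].
  - refine (covered_mono _ _ _ _ (maximal_cover V inc a b alpha Hab Ha _ _) Hinc (Rle_refl _)).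
    + intros x y H1 H2 H3. specialize (HV x y H1 H2 H3). generalize (Rabs_pos (f y - f x)); lra.
    + intros c d [H1 [H2 [H3 H4]]]. specialize (HV c d H1 ltac:(lra) H3). generalize (Rle_abs (f d - f c)); lra.
  - rewrite (Rabs_pos_eq _ Hs).
    refine (covered_mono _ _ _ _ (maximal_cover (fun x => V x - f x) dec a b alpha Hab Ha _ _) Hdec _).
    + intros x y H1 H2 H3. specialize (HV x y H1 H2 H3). generalize (Rle_abs (f y - f x)); lra.
    + intros c d [H1 [H2 [H3 H4]]]. specialize (HV c d H1 ltac:(lra) H3). generalize (Rabs_pos (f d - f c)); lra.
    + right; f_equal; ring.
  - rewrite (Rabs_left _ Hs).
    refine (covered_mono _ _ _ _ (maximal_cover (fun x => V x + f x) inc a b alpha Hab Ha _ _) Hinc _).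
    + intros x y H1 H2 H3. specialize (HV x y H1 H2 H3). apply Rabs_le_inv in HV. lra.
    + intros c d [H1 [H2 [H3 H4]]]. specialize (HV c d H1 ltac:(lra) H3). generalize (Rabs_pos (f d - f c)); lra.
    + right; f_equal; ring.
Qed.

(* Austin's argument: between consecutive points of a nearly optimal chain, either [V - f] or [V + f]
   has small increment, yet it grows at rate [alpha] around each oscillation point. *)
Lemma oscillates_chain (f V : R -> R) alpha q l : 0 < alpha ->
  forall lo, lo <= q -> chain_in lo q l ->
  (forall x y, lo <= x -> x <= y -> y <= q -> Rabs (f y - f x) <= V y - V x) ->
  forall eps, 0 < eps ->
  covered (fun x => lo < x < q /\ oscillates f alpha x) (5 * (V q - V lo - variation f l) / alpha + eps).
Proof.
  intro Ha. induction l as [|[a b] l IH]; intros lo Hlo [Hl HF] HV eps He.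
  - refine (covered_mono _ _ _ _ (proj1 (oscillates_gap f V alpha lo q Hlo Ha HV)) (fun x H => H) _).
    unfold variation; simpl. rewrite Rminus_0_r. lra.
  - simpl in Hl. destruct Hl as [L1 [L2 L3]]. inversion HF as [|? ? F1 F2]; subst. simpl in F1.
    assert (C1 := proj1 (oscillates_gap f V alpha lo a L1 Ha (fun x y h1 h2 h3 => HV x y h1 h2 ltac:(lra)))).
    assert (C2 := proj2 (oscillates_gap f V alpha a b L2 Ha (fun x y h1 h2 h3 => HV x y ltac:(lra) h2 ltac:(lra)))).
    assert (C3 := IH b F1 (conj L3 F2) (fun x y h1 h2 h3 => HV x y ltac:(lra) h2 h3) (eps / 2) ltac:(lra)).
    (* The endpoints belong to none of the open pieces; they take one half of [eps], the tail of the
       chain the other. *)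
    assert (Ca := covered_point a (eps / 4) ltac:(lra)). assert (Cb := covered_point b (eps / 4) ltac:(lra)).
    refine (covered_mono _ _ _ _ (covered_union _ _ _ _ C1 (covered_union _ _ _ _ C2
       (covered_union _ _ _ _ C3 (covered_union _ _ _ _ Ca Cb)))) _ _).
    + intros x [Hx Ho]. destruct (Rtotal_order x a) as [?|[?|?]]; [tauto|tauto|].
      destruct (Rtotal_order x b) as [?|[?|?]]; tauto.
    + right. unfold variation. simpl. field. lra.
Qed.

Lemma oscillates_null (f : R -> R) p q B alpha : p <= q -> 0 < alpha ->
  (forall l, chain_in p q l -> variation f l <= B) ->
  null_set (fun x => p < x < q /\ oscillates f alpha x).
Proof.
  intros Hpq Ha HB. destruct (variation_function f p q B Hpq HB) as [V [V0 [V1 V2]]].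
  apply null_covered. intros eps He.
  destruct (V2 (eps * alpha / 10)) as [l [Hl El]]; [apply Rdiv_lt_0_compat; nra|].
  refine (covered_mono _ _ _ _ (oscillates_chain f V alpha q l Ha p Hpq Hl V1 (eps / 2) ltac:(lra)) (fun x H => H) _).
  assert (5 * (V q - V p - variation f l) / alpha <= eps / 2); [|lra].
  apply Rmult_le_reg_r with alpha; [exact Ha|].
  replace (5 * (V q - V p - variation f l) / alpha * alpha) with (5 * (V q - V p - variation f l)) by (field; lra).
  lra.
Qed.

(** * Slopes compared with rational linear functions *)

Lemma itv_chain_length l : forall p q, p <= q -> chain_in p q l ->
  0 <= fold_right (fun ab s => snd ab - fst ab + s) 0 l <= q - p.
Proof.
  induction l as [|[a b] l IH]; intros p q Hpq [Hl HF]; simpl; [lra|].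
  simpl in Hl. inversion HF as [|? ? F1 F2]; subst. simpl in F1.
  specialize (IH b q F1 (conj (proj2 (proj2 Hl)) F2)). lra.
Qed.

Lemma variation_sub_linear (f : R -> R) c l : forall p, itv_chain p l ->
  variation (fun x => f x - c * x) l <=
    variation f l + Rabs c * fold_right (fun ab s => snd ab - fst ab + s) 0 l.
Proof.
  induction l as [|[a b] l IH]; intros p Hl; unfold variation in *; simpl; [lra|].
  simpl in Hl. specialize (IH b (proj2 (proj2 Hl))).
  replace (f b - c * b - (f a - c * a)) with ((f b - f a) + - (c * (b - a))) by ring.
  generalize (Rabs_triang (f b - f a) (- (c * (b - a)))).
  rewrite Rabs_Ropp, Rabs_mult, (Rabs_pos_eq (b - a)) by lra. lra.
Qed.

(** Every rational has this form. With three naturals as parameters, a union over rationals is an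
    iterated union over [nat]. *)
Definition ratio (i j k : nat) : R := (INR i - INR j) / INR (S k).

Lemma ratio_dense a b : a < b -> exists i j k, a < ratio i j k < b.
Proof.
  intro Hab. destruct (inv_INR_S_lt (b - a)) as [k Hk]; [lra|]. specialize (Hk k (le_n k)).
  assert (P := inv_INR_S_pos k). set (w := / INR (S k)) in *.
  assert (Ew : w * INR (S k) = 1) by (unfold w; apply Rinv_l; apply not_0_INR; lia).
  destruct (archimed (a * INR (S k))) as [U1 U2]. set (z := up (a * INR (S k))) in *.
  assert (Hz : exists i j, IZR z = INR i - INR j).
  { destruct (Z.le_gt_cases 0 z).
    - exists (Z.to_nat z), 0%nat. rewrite INR_IZR_INZ, Znat.Z2Nat.id by lia. simpl; ring.
    - exists 0%nat, (Z.to_nat (- z)). rewrite (INR_IZR_INZ (Z.to_nat _)), Znat.Z2Nat.id by lia.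
      rewrite opp_IZR. simpl; ring. }
  destruct Hz as [i [j Hij]]. exists i, j, k. unfold ratio, Rdiv. fold w. rewrite <- Hij.
  assert (A1 : a * INR (S k) * w < IZR z * w) by (apply Rmult_lt_compat_r; lra).
  assert (A2 : (IZR z) * w <= (a * INR (S k) + 1) * w) by (apply Rmult_le_compat_r; lra).
  replace (a * INR (S k) * w) with (a * (w * INR (S k))) in A1 by ring.
  replace ((a * INR (S k) + 1) * w) with (a * (w * INR (S k)) + w) in A2 by ring.
  rewrite Ew in A1, A2. lra.
Qed.

Definition quot (f : R -> R) (x h : R) : R := (f (x + h) - f x) / h.

(* A one-sided difference quotient is turned into a slope on an interval around [x] by moving the
   endpoint [x] slightly. *)
Lemma quot_interval (f : R -> R) x m m' :
  (forall eps, 0 < eps -> exists d, 0 < d /\ forall y, Rabs (y - x) < d -> Rabs (f y - f x) < eps) ->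
  m' < m ->
  (forall delta, 0 < delta -> exists h, h <> 0 /\ Rabs h < delta /\ m < quot f x h) ->
  forall delta, 0 < delta ->
    exists a b, x - delta < a < x /\ x < b < x + delta /\ m' * (b - a) <= f b - f a.
Proof.
  intros Hc Hm Hq delta Hd. destruct (Hq delta Hd) as [h [Hh0 [Hhd Hh]]].
  set (k := Rabs h). assert (Hk : 0 < k) by (apply Rabs_pos_lt; exact Hh0). fold k in Hhd.
  (* Lowering the slope from [m] to [m'] frees [2 * e]: one [e] pays for the change of [f] at the
     moved endpoint, the other for the additional length [eta]. *)
  set (e := (m - m') * k / 2). assert (He : 0 < e) by (unfold e; apply Rdiv_lt_0_compat; [|lra]; apply Rmult_lt_0_compat; lra).
  destruct (Hc e He) as [d [Hd1 Hd2]].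
  assert (Pm := Rabs_pos m').
  set (eta := Rmin (Rmin d delta) (e / (Rabs m' + 1)) / 2).
  assert (Heta : 0 < eta).
  { unfold eta. apply Rdiv_lt_0_compat; [|lra]. repeat apply Rmin_pos; try assumption. apply Rdiv_lt_0_compat; lra. }
  assert (M : 2 * eta <= d /\ 2 * eta <= delta /\ 2 * eta <= e / (Rabs m' + 1)).
  { unfold eta. generalize (Rmin_l (Rmin d delta) (e / (Rabs m' + 1))) (Rmin_r (Rmin d delta) (e / (Rabs m' + 1)))
      (Rmin_l d delta) (Rmin_r d delta). lra. }
  assert (Me : m' * eta <= e).
  { apply Rle_trans with (Rabs m' * eta); [apply Rmult_le_compat_r; [lra|apply Rle_abs]|].
    destruct M as [_ [_ M]]. apply (Rmult_le_compat_r (Rabs m' + 1)) in M; [|lra].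
    replace (e / (Rabs m' + 1) * (Rabs m' + 1)) with e in M by (field; lra). nra. }
  assert (Ek : (m - m') * k = 2 * e) by (unfold e; field).
  destruct (Rlt_le_dec 0 h) as [Hp|Hn].
  - assert (Eh : k = h) by (apply Rabs_pos_eq; lra). rewrite Eh in *.
    exists (x - eta), (x + h). split; [lra|]. split; [lra|].
    assert (F := Hd2 (x - eta) ltac:(replace (x - eta - x) with (- eta) by ring; rewrite Rabs_Ropp, Rabs_pos_eq; lra)).
    apply Rabs_def2 in F.
    assert (G : m * h < f (x + h) - f x).
    { unfold quot in Hh. apply (Rmult_lt_compat_r h) in Hh; [|lra].
      replace ((f (x + h) - f x) / h * h) with (f (x + h) - f x) in Hh by (field; lra). exact Hh. }
    lra.
  - assert (Eh : k = - h) by (unfold k; rewrite Rabs_left; lra).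
    exists (x + h), (x + eta). split; [lra|]. split; [lra|].
    assert (F := Hd2 (x + eta) ltac:(replace (x + eta - x) with eta by ring; rewrite Rabs_pos_eq; lra)).
    apply Rabs_def2 in F.
    assert (G : m * (- h) < f x - f (x + h)).
    { unfold quot in Hh. apply (Rmult_lt_compat_r (- h)) in Hh; [|lra].
      replace ((f (x + h) - f x) / h * - h) with (f x - f (x + h)) in Hh by (field; lra). exact Hh. }
    rewrite Eh in Ek. lra.
Qed.

Lemma quot_interval_neg (f : R -> R) x m m' :
  (forall eps, 0 < eps -> exists d, 0 < d /\ forall y, Rabs (y - x) < d -> Rabs (f y - f x) < eps) ->
  m < m' ->
  (forall delta, 0 < delta -> exists h, h <> 0 /\ Rabs h < delta /\ quot f x h < m) ->
  forall delta, 0 < delta ->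
    exists a b, x - delta < a < x /\ x < b < x + delta /\ f b - f a <= m' * (b - a).
Proof.
  intros Hc Hm Hq delta Hd.
  destruct (quot_interval (fun y => - f y) x (- m) (- m')) with (delta := delta) as [a [b [Ha [Hb Hab]]]].
  - intros eps He. destruct (Hc eps He) as [d [Hd1 Hd2]]. exists d; split; [exact Hd1|]. intros y Hy.
    replace (- f y - - f x) with (- (f y - f x)) by ring. rewrite Rabs_Ropp. auto.
  - lra.
  - intros e He. destruct (Hq e He) as [h [H1 [H2 H3]]]. exists h. split; [exact H1|]. split; [exact H2|].
    unfold quot in *. replace ((- f (x + h) - - f x) / h) with (- ((f (x + h) - f x) / h)) by (field; exact H1). lra.
  - exact Hd.
  - exists a, b. split; [exact Ha|]. split; [exact Hb|]. lra.
Qed.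

(** [L] is the upper derivative: the supremum of the levels exceeded by difference quotients at
    arbitrarily small steps, finite because slopes across [x] are bounded by [beta]. If quotients
    also fell below [L - eps / 2] at arbitrarily small steps, [f] would oscillate about a rational
    slope in between. *)
Lemma derivable_of_no_oscillation (f : R -> R) x beta :
  (forall eps, 0 < eps -> exists d, 0 < d /\ forall y, Rabs (y - x) < d -> Rabs (f y - f x) < eps) ->
  (exists d, 0 < d /\ forall a b, x - d < a < x -> x < b < x + d -> Rabs (f b - f a) < beta * (b - a)) ->
  (forall i j k m, ~ oscillates (fun y => f y - ratio i j k * y) (/ INR (S m)) x) ->
  exists v, derivable_pt_lim f x v.
Proof.
  intros Hc [d0 [Hd0 Hb]] Hosc.
  set (freq_gt := fun m => forall delta, 0 < delta -> exists h, h <> 0 /\ Rabs h < delta /\ m < quot f x h).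
  set (freq_lt := fun m => forall delta, 0 < delta -> exists h, h <> 0 /\ Rabs h < delta /\ quot f x h < m).
  assert (N1 : ~ freq_gt (beta + 1)).
  { intro F. destruct (quot_interval f x (beta + 1) beta Hc ltac:(lra) F d0 Hd0) as [a [b [Ha [Hb' Hab]]]].
    specialize (Hb a b Ha Hb'). generalize (Rle_abs (f b - f a)); lra. }
  assert (N2 : ~ freq_lt (- beta - 1)).
  { intro F. destruct (quot_interval_neg f x (- beta - 1) (- beta) Hc ltac:(lra) F d0 Hd0) as [a [b [Ha [Hb' Hab]]]].
    specialize (Hb a b Ha Hb'). apply Rabs_def2 in Hb. lra. }
  assert (Ev_le : forall m, ~ freq_gt m -> exists d, 0 < d /\ forall h, h <> 0 -> Rabs h < d -> quot f x h <= m).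
  { intros m Hm. apply NNPP; intro C. apply Hm. intros d Hd. apply NNPP; intro C2. apply C.
    exists d; split; [exact Hd|]. intros h H1 H2. apply Rnot_lt_le; intro H3. apply C2. exists h; auto. }
  assert (Ev_ge : forall m, ~ freq_lt m -> exists d, 0 < d /\ forall h, h <> 0 -> Rabs h < d -> m <= quot f x h).
  { intros m Hm. apply NNPP; intro C. apply Hm. intros d Hd. apply NNPP; intro C2. apply C.
    exists d; split; [exact Hd|]. intros h H1 H2. apply Rnot_lt_le; intro H3. apply C2. exists h; auto. }
  destruct (completeness freq_gt) as [L [HL1 HL2]].
  - exists (beta + 1). intros m Hm. apply Rnot_lt_le; intro C. apply N1. intros d Hd.
    destruct (Hm d Hd) as [h [H1 [H2 H3]]]. exists h. split; [exact H1|]. split; [exact H2|lra].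
  - exists (- beta - 2). intros d Hd. destruct (Ev_ge _ N2) as [d' [Hd' H']].
    exists (Rmin d d' / 2). assert (Pm := Rmin_pos d d' Hd Hd').
    assert (A : Rabs (Rmin d d' / 2) = Rmin d d' / 2) by (apply Rabs_pos_eq; lra).
    generalize (Rmin_l d d') (Rmin_r d d'); intros M1 M2.
    split; [lra|]. rewrite A. split; [lra|].
    specialize (H' (Rmin d d' / 2) ltac:(lra) ltac:(rewrite A; lra)). lra.
  - exists L. intros eps He.
    assert (U : ~ freq_gt (L + eps / 2)) by (intro F; specialize (HL1 _ F); lra).
    assert (W : ~ freq_lt (L - eps / 2)).
    { intro F.
      (* With [al < eps / 16], the slope [c + al] stays below [L - eps / 8] and [c - al] above
         [L - eps / 2]; the strict margins are what passing from quotients to intervals consumes. *)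
      destruct (ratio_dense (L - 3 * eps / 8) (L - eps / 4)) as [i [j [k Hr]]]; [lra|].
      destruct (inv_INR_S_lt (eps / 16)) as [m Hm]; [lra|]. specialize (Hm m (le_n m)).
      assert (Pm := inv_INR_S_pos m). set (al := / INR (S m)) in *. set (c := ratio i j k) in *.
      apply (Hosc i j k m). fold c al. intros d Hd. split.
      - assert (F2 : freq_gt (L - eps / 8)).
        { apply NNPP; intro C. assert (L <= L - eps / 8); [|lra]. apply HL2. intros m' Hm'.
          apply Rnot_lt_le; intro C2. apply C. intros e1 He1. destruct (Hm' e1 He1) as [h [H1 [H2 H3]]].
          exists h. split; [exact H1|]. split; [exact H2|lra]. }
        destruct (quot_interval f x (L - eps / 8) (c + al) Hc ltac:(lra) F2 d Hd) as [a [b [Ha [Hb' Hab]]]].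
        exists a, b. split; [exact Ha|]. split; [exact Hb'|]. lra.
      - destruct (quot_interval_neg f x (L - eps / 2) (c - al) Hc ltac:(lra) F d Hd) as [a [b [Ha [Hb' Hab]]]].
        exists a, b. split; [exact Ha|]. split; [exact Hb'|]. lra. }
    destruct (Ev_le _ U) as [d1 [Hd1 H1]]. destruct (Ev_ge _ W) as [d2 [Hd2 H2]].
    exists (mkposreal _ (Rmin_pos d1 d2 Hd1 Hd2)). simpl. intros h Hh Hd.
    specialize (H1 h Hh (Rlt_le_trans _ _ _ Hd (Rmin_l _ _))).
    specialize (H2 h Hh (Rlt_le_trans _ _ _ Hd (Rmin_r _ _))).
    unfold quot in H1, H2. apply Rabs_def1; lra.
Qed.

(** Two null sets are discarded: the points around which [V] has intervals of arbitrarily large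
    slope, whose covers cost [5 * (V q - V p) / k], and the countable union over rational slopes and
    over [alpha = 1/(m+1)] of the oscillation sets. *)
Lemma bounded_variation_derivable_ae (f : R -> R) p q B : p <= q ->
  (forall l, chain_in p q l -> variation f l <= B) ->
  (forall x, p < x < q -> forall eps, 0 < eps ->
     exists d, 0 < d /\ forall y, Rabs (y - x) < d -> Rabs (f y - f x) < eps) ->
  null_set (fun x => p < x < q /\ ~ exists v, derivable_pt_lim f x v).
Proof.
  intros Hpq HB Hc.
  destruct (variation_function f p q B Hpq HB) as [V [V0 [V1 _]]].
  assert (Vmono : forall x y, p <= x -> x <= y -> y <= q -> V x <= V y).
  { intros x y H1 H2 H3. specialize (V1 x y H1 H2 H3). generalize (Rabs_pos (f y - f x)); lra. }
  set (steep := fun beta x => exists a b, (p <= a /\ a < b /\ b <= q /\ beta * (b - a) <= V b - V a) /\ a < x < b).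
  assert (Nsteep : null_set (fun x => forall k, steep (INR (S k)) x)).
  { apply null_covered; intros eps He.
    destruct (inv_INR_S_lt (eps / (5 * (V q - V p) + 1))) as [k Hk].
    { apply Rdiv_lt_0_compat; [exact He|]. specialize (Vmono p q); lra. }
    specialize (Hk k (le_n k)). assert (Vp := Vmono p q ltac:(lra) Hpq ltac:(lra)).
    assert (Pk : 0 < INR (S k)) by (apply lt_0_INR; lia).
    refine (covered_mono _ _ _ _ (maximal_cover V (fun a b => p <= a /\ a < b /\ b <= q /\ INR (S k) * (b - a) <= V b - V a)
       p q (INR (S k)) Hpq Pk Vmono (fun a b H => H)) (fun x H => H k) _).
    apply (Rmult_lt_compat_r (5 * (V q - V p) + 1)) in Hk; [|lra].
    replace (eps / (5 * (V q - V p) + 1) * (5 * (V q - V p) + 1)) with eps in Hk by (field; lra).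
    assert (0 < / INR (S k)) by apply inv_INR_S_pos. unfold Rdiv. lra. }
  assert (Nosc : null_set (fun x => exists i j k m, p < x < q /\ oscillates (fun y => f y - ratio i j k * y) (/ INR (S m)) x)).
  { apply null_Union; intro i. apply null_Union; intro j. apply null_Union; intro k. apply null_Union; intro m.
    apply (oscillates_null _ p q (B + Rabs (ratio i j k) * (q - p))); [exact Hpq|apply inv_INR_S_pos|].
    intros l Hl. eapply Rle_trans; [apply (variation_sub_linear f (ratio i j k) l p); apply Hl|].
    apply Rplus_le_compat; [apply HB, Hl|]. apply Rmult_le_compat_l; [apply Rabs_pos|].
    apply itv_chain_length; assumption. }
  apply null_mono with (1 := null_union _ _ Nsteep Nosc).
  intros x [Hx Hnd]. apply NNPP; intro C. apply not_or_and in C. destruct C as [C1 C2].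
  apply Hnd. apply not_all_ex_not in C1. destruct C1 as [k Hk].
  apply (derivable_of_no_oscillation f x (INR (S k)) (Hc x Hx)).
  - exists (Rmin (x - p) (q - x)). split; [apply Rmin_pos; lra|]. intros a b Ha Hb.
    generalize (Rmin_l (x - p) (q - x)) (Rmin_r (x - p) (q - x)); intros.
    apply Rnot_le_lt; intro C. apply Hk. exists a, b. split; [|lra].
    specialize (V1 a b ltac:(lra) ltac:(lra) ltac:(lra)). lra.
  - intros i j k' m Ho. apply C2. exists i, j, k', m. auto.
Qed.

(** * Pieces of bounded variation of an absolutely continuous function *)

Definition abs_cont_R (T : R) (f : R -> R) : Prop :=
  forall eps, 0 < eps -> exists d, 0 < d /\ forall l, disjoint_itvs T l ->
    fold_right (fun ab s => snd ab - fst ab + s) 0 l < d -> variation f l < eps.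

Lemma abs_cont_R_continuous T f : abs_cont_R T f -> forall x eps, 0 <= x <= T -> 0 < eps ->
  exists d, 0 < d /\ forall y, 0 <= y <= T -> Rabs (y - x) < d -> Rabs (f y - f x) < eps.
Proof.
  intros Hf x eps Hx He. destruct (Hf eps He) as [d [Hd Hl]]. exists d; split; [exact Hd|].
  intros y Hy Hyx. destruct (Rle_dec x y) as [Hxy|Hxy%Rnot_le_lt].
  - specialize (Hl [(x, y)]). unfold variation in Hl; simpl in Hl. apply Rabs_def2 in Hyx.
    assert (Rabs (f y - f x) + 0 < eps); [|lra]. apply Hl; [|lra].
    split; [simpl; lra|constructor; [simpl; lra|constructor]].
  - specialize (Hl [(y, x)]). unfold variation in Hl; simpl in Hl. apply Rabs_def2 in Hyx.
    rewrite <- Rabs_Ropp. replace (- (f y - f x)) with (f x - f y) by ring.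
    assert (Rabs (f x - f y) + 0 < eps); [|lra]. apply Hl; [|lra].
    split; [simpl; lra|constructor; [simpl; lra|constructor]].
Qed.

Lemma itv_chain_lower p p' l : itv_chain p l -> p' <= p -> itv_chain p' l.
Proof. destruct l as [|[a b] l]; simpl; [tauto|]. intros; lra || (repeat split; try tauto; lra). Qed.

(** On a window of length [d / 2] every chain has total length below the [d] associated with [1], so
    the variation there is at most [1]. Windows of this length exhaust [[0, T]]; their endpoints are
    countably many points, and windows starting beyond [T] are empty. *)
Lemma abs_cont_R_derivable_ae T f : 0 < T -> abs_cont_R T f ->
  null_set (fun t => 0 <= t <= T /\ ~ exists v, derivable_pt_lim f t v).
Proof.
  intros HT Hf. destruct (Hf 1 ltac:(lra)) as [d [Hd Hl]].
  set (w := d / 2). assert (Hw : 0 < w) by (unfold w; lra).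
  set (lo := fun i => INR i * w). set (hi := fun i => Rmin (lo (S i)) T).
  assert (Npiece : forall i, null_set (fun t => lo i < t < hi i /\ ~ exists v, derivable_pt_lim f t v)).
  { intro i. assert (Plo : 0 <= lo i) by (apply Rmult_le_pos; [apply pos_INR|lra]).
    assert (Hhi : hi i <= T) by apply Rmin_r.
    assert (Hhi2 : hi i <= lo i + w).
    { unfold hi. eapply Rle_trans; [apply Rmin_l|]. unfold lo; rewrite S_INR; lra. }
    destruct (Rle_dec (lo i) (hi i)) as [Hi|Hi].
    2:{ apply null_mono with (1 := null_point 0). intros t Ht; lra. }
    apply (bounded_variation_derivable_ae f (lo i) (hi i) 1 Hi).
    - intros l [L1 L2]. left. apply Hl.
      + split; [apply itv_chain_lower with (lo i); assumption|].
        revert L2; apply Forall_impl; intros; lra.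
      + destruct (itv_chain_length l (lo i) (hi i) Hi (conj L1 L2)). unfold w in *. lra.
    - intros x Hx eps He. destruct (abs_cont_R_continuous T f Hf x eps ltac:(lra) He) as [e [He1 He2]].
      exists (Rmin e (Rmin x (T - x))). split; [repeat apply Rmin_pos; lra|]. intros y Hy.
      generalize (Rmin_l e (Rmin x (T - x))) (Rmin_r e (Rmin x (T - x))) (Rmin_l x (T - x)) (Rmin_r x (T - x)).
      intros. assert (Hy' := Hy). apply Rabs_def2 in Hy'. apply He2; lra. }
  apply null_mono with (1 := null_union _ _ (null_Union _ Npiece)
    (null_union _ _ (null_Union _ (fun i => null_point (lo i))) (null_point T))).
  intros t [Ht Hnd].
  assert (exists i, lo i <= t < lo (S i)) as [i Hi].
  { assert (forall m, t < lo m -> exists i, lo i <= t < lo (S i)) as Hfind.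
    { induction m as [|m IH]; intro Hm; [unfold lo in Hm; simpl in Hm; lra|].
      destruct (Rlt_le_dec t (lo m)); [auto|exists m; lra]. }
    destruct (INR_unbounded (t / w)) as [m Hm]. apply (Hfind m). unfold lo.
    apply (Rmult_lt_compat_r w) in Hm; [|exact Hw]. replace (t / w * w) with t in Hm by (field; lra). exact Hm. }
  destruct (Req_dec t T) as [E|N]; [right; right; exact E|].
  destruct (Req_dec t (lo i)) as [E|N2]; [right; left; exists i; exact E|].
  left. exists i. split; [|exact Hnd]. split; [lra|]. unfold hi. apply Rmin_glb_lt; lra.
Qed.

(** * Measurability *)

Lemma lmeas_prop (P : Prop) : lmeas (fun _ => P).
Proof.
  assert (E : lmeas (fun _ => False)) by (apply (lm_ext (fun x => 0 < x < 0)); [apply lm_itv|intro; lra]).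
  destruct (classic P).
  - apply (lm_ext (fun _ => ~ False)); [apply (lm_compl _ E)|tauto].
  - apply (lm_ext (fun _ => False)); [exact E|tauto].
Qed.

Lemma lmeas_cap (A : nat -> R -> Prop) : (forall k, lmeas (A k)) -> lmeas (fun x => forall k, A k x).
Proof.
  intro HA. apply (lm_ext (fun x => ~ exists k, ~ A k x)).
  - apply (lm_compl (fun x => exists k, ~ A k x)). apply (lm_union (fun k x => ~ A k x)).
    intro k; apply (lm_compl (A k)), HA.
  - intro x; split; [|intros H [k Hk]; auto].
    intros H k. apply NNPP; intro C; apply H; exists k; exact C.
Qed.

Lemma lmeas_or (A B : R -> Prop) : lmeas A -> lmeas B -> lmeas (fun x => A x \/ B x).
Proof.
  intros HA HB. apply (lm_ext (fun x => exists k : nat, match k with O => A | _ => B end x)).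
  - apply (lm_union (fun k => match k with O => A | _ => B end)). intros [|k]; assumption.
  - intro x; split; [intros [[|k] Hk]; auto|intros [H|H]; [exists 0%nat|exists 1%nat]; exact H].
Qed.

Lemma lmeas_and (A B : R -> Prop) : lmeas A -> lmeas B -> lmeas (fun x => A x /\ B x).
Proof.
  intros HA HB. apply (lm_ext (fun x => forall k : nat, match k with O => A | _ => B end x)).
  - apply (lmeas_cap (fun k => match k with O => A | _ => B end)). intros [|k]; assumption.
  - intro x; split; [intro H; split; [apply (H 0%nat)|apply (H 1%nat)]|intros [H1 H2] [|k]; assumption].
Qed.

Lemma measurable_le S f c : measurable_on S f -> lmeas (fun t => S t /\ f t <= c).
Proof.
  intro Hf. apply (lm_ext (fun t => forall k, S t /\ f t < c + / INR (Datatypes.S k))).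
  - apply lmeas_cap; intro k; apply Hf.
  - intro t; split.
    + intro H. split; [apply (H 0%nat)|]. apply Rnot_lt_le; intro C.
      destruct (inv_INR_S_lt (f t - c)) as [k Hk]; [lra|]. specialize (Hk k (le_n k)).
      destruct (H k). lra.
    + intros [H1 H2] k. generalize (inv_INR_S_pos k). split; [exact H1|lra].
Qed.

Lemma measurable_of_le S f : (forall c, lmeas (fun t => S t /\ f t <= c)) -> measurable_on S f.
Proof.
  intros Hf c. apply (lm_ext (fun t => exists k, S t /\ f t <= c - / INR (Datatypes.S k))).
  - apply (lm_union (fun k t => S t /\ f t <= c - / INR (Datatypes.S k))); intro k; apply Hf.
  - intro t; split.
    + intros [k [H1 H2]]. generalize (inv_INR_S_pos k). split; [exact H1|lra].
    + intros [H1 H2]. destruct (inv_INR_S_lt (c - f t)) as [k Hk]; [lra|].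
      exists k. specialize (Hk k (le_n k)). split; [exact H1|lra].
Qed.

Lemma measurable_gt S f c : lmeas S -> measurable_on S f -> lmeas (fun t => S t /\ c < f t).
Proof.
  intros HS Hf. apply (lm_ext (fun t => S t /\ ~ (S t /\ f t <= c))).
  - apply lmeas_and; [exact HS|]. apply (lm_compl (fun t => S t /\ f t <= c)), measurable_le, Hf.
  - intro t; split; intros [H1 H2]; (split; [exact H1|]).
    + apply Rnot_le_lt; tauto.
    + intros [_ H3]; lra.
Qed.

Lemma measurable_ext S f h : measurable_on S f -> (forall t, S t -> f t = h t) -> measurable_on S h.
Proof.
  intros Hf E c. apply (lm_ext (fun t => S t /\ f t < c)); [apply Hf|].
  intro t; split; intros [H1 H2]; split; try assumption; rewrite E in * by assumption; assumption.
Qed.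

Lemma measurable_Rmax S f h : measurable_on S f -> measurable_on S h -> measurable_on S (fun t => Rmax (f t) (h t)).
Proof.
  intros Hf Hh c. apply (lm_ext (fun t => (S t /\ f t < c) /\ (S t /\ h t < c))).
  - apply lmeas_and; [apply Hf|apply Hh].
  - intro t; split.
    + intros [[H1 H2] [_ H3]]. split; [exact H1|apply Rmax_lub_lt; assumption].
    + intros [H1 H2]. generalize (Rmax_l (f t) (h t)) (Rmax_r (f t) (h t)). repeat split; try assumption; lra.
Qed.

Lemma measurable_abs_sub S f a : lmeas S -> measurable_on S f -> measurable_on S (fun t => Rabs (a - f t)).
Proof.
  intros HS Hf c. apply (lm_ext (fun t => (S t /\ f t < a + c) /\ (S t /\ a - c < f t))).
  - apply lmeas_and; [apply Hf|apply measurable_gt; assumption].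
  - intro t; split.
    + intros [[H1 H2] [_ H3]]. split; [exact H1|]. apply Rabs_def1; lra.
    + intros [H1 H2]. apply Rabs_def2 in H2. repeat split; try assumption; lra.
Qed.

(** [A] is, within [S], the union of the rational intervals on which it holds at all points of [S].
    Whether an interval qualifies does not depend on [t], so that clause is a constant
    proposition. *)
Lemma lmeas_rel_open (S A : R -> Prop) : lmeas S ->
  (forall t, S t -> A t -> exists d, 0 < d /\ forall y, S y -> Rabs (y - t) < d -> A y) ->
  lmeas (fun t => S t /\ A t).
Proof.
  intros HS HA.
  apply (lm_ext (fun t => S t /\ exists i j k i' j' k', ratio i j k < t < ratio i' j' k' /\
      (forall y, S y -> ratio i j k < y < ratio i' j' k' -> A y))).
  - apply lmeas_and; [exact HS|].
    do 6 (match goal with |- lmeas (fun t => exists i, @?A t i) => apply (lm_union (fun i t => A t i)); intro end).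
    apply lmeas_and; [apply lm_itv|apply lmeas_prop].
  - intro t; split.
    + intros [H1 [i [j [k [i' [j' [k' [H2 H3]]]]]]]]. auto.
    + intros [H1 H2]. split; [exact H1|].
      destruct (HA t H1 H2) as [d [Hd Hy]].
      destruct (ratio_dense (t - d) t) as [i [j [k Hr]]]; [lra|].
      destruct (ratio_dense t (t + d)) as [i' [j' [k' Hr']]]; [lra|].
      exists i, j, k, i', j', k'. split; [lra|]. intros y Sy Hyr. apply Hy; [exact Sy|apply Rabs_def1; lra].
Qed.

Lemma measurable_cont (S : R -> Prop) (f : R -> R) : lmeas S ->
  (forall x, S x -> forall eps, 0 < eps -> exists d, 0 < d /\ forall y, S y -> Rabs (y - x) < d -> Rabs (f y - f x) < eps) ->
  measurable_on S f.
Proof.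
  intros HS Hf c. apply lmeas_rel_open; [exact HS|]. intros t St Ht.
  destruct (Hf t St (c - f t)) as [d [Hd Hy]]; [lra|]. exists d; split; [exact Hd|].
  intros y Sy Dy. specialize (Hy y Sy Dy). apply Rabs_def2 in Hy. lra.
Qed.

Lemma measurable_split (S A : R -> Prop) f :
  measurable_on (fun t => S t /\ A t) f -> measurable_on (fun t => S t /\ ~ A t) f -> measurable_on S f.
Proof.
  intros H1 H2 c. apply (lm_ext (fun t => ((S t /\ A t) /\ f t < c) \/ ((S t /\ ~ A t) /\ f t < c))).
  - apply lmeas_or; [apply H1|apply H2].
  - intro t. destruct (classic (A t)); tauto.
Qed.

Lemma measurable_limit S (f : nat -> R -> R) (h : R -> R) : lmeas S ->
  (forall k, measurable_on S (f k)) ->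
  (forall t, S t -> forall eps, 0 < eps -> exists N, forall k, (N <= k)%nat -> Rabs (f k t - h t) < eps) ->
  measurable_on S h.
Proof.
  intros HS Hf Hl. intro c.
  apply (lm_ext (fun t => S t /\ exists m N, forall k, ~ (N <= k)%nat \/ (S t /\ f k t <= c - / INR (Datatypes.S m)))).
  - apply lmeas_and; [exact HS|].
    apply (lm_union (fun m t => exists N, forall k, ~ (N <= k)%nat \/ (S t /\ f k t <= c - / INR (Datatypes.S m)))); intro m.
    apply (lm_union (fun N t => forall k, ~ (N <= k)%nat \/ (S t /\ f k t <= c - / INR (Datatypes.S m)))); intro N.
    apply lmeas_cap; intro k. apply lmeas_or; [apply lmeas_prop|apply measurable_le, Hf].
  - intro t; split; intros [H1 H2]; (split; [exact H1|]).
    + destruct H2 as [m [N H2]]. assert (Pm := inv_INR_S_pos m).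
      destruct (Hl t H1 (/ INR (Datatypes.S m)) Pm) as [N' HN'].
      specialize (HN' (max N N') ltac:(lia)). destruct (H2 (max N N')) as [|[_ H3]]; [lia|].
      apply Rabs_def2 in HN'. lra.
    + destruct (inv_INR_S_lt ((c - h t) / 2)) as [m Hm]; [lra|]. specialize (Hm m (le_n m)).
      destruct (Hl t H1 ((c - h t) / 2)) as [N HN]; [lra|]. exists m, N. intro k.
      destruct (classic (N <= k)%nat) as [Hk|]; [right|left; assumption].
      specialize (HN k Hk). apply Rabs_def2 in HN. split; [exact H1|lra].
Qed.

(** The derivative is the limit of the quotients with step [1/(k+1)]. As continuity of [F] is known
    only on [[0, T]], its argument is clamped by [cl]; at a given [t < T] the clamp is inactive for
    large [k]. *)
Lemma measurable_derivative (S : R -> Prop) T (F D : R -> R) : lmeas S ->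
  (forall t, S t -> 0 < t < T) ->
  (forall x eps, 0 <= x <= T -> 0 < eps -> exists d, 0 < d /\
     forall y, 0 <= y <= T -> Rabs (y - x) < d -> Rabs (F y - F x) < eps) ->
  (forall t, S t -> derivable_pt_lim F t (D t)) -> measurable_on S D.
Proof.
  intros HS HST HF HD.
  set (cl := fun t => Rmax 0 (Rmin t T)).
  assert (Hid : forall t, 0 <= t <= T -> cl t = t).
  { intros t Ht. unfold cl. rewrite Rmin_left, Rmax_right; lra. }
  assert (Hcl : forall x y, Rabs (cl y - cl x) <= Rabs (y - x)).
  { intros x y. unfold cl, Rmax, Rmin.
    destruct (Rle_dec y T) as [?|?%Rnot_le_lt], (Rle_dec x T) as [?|?%Rnot_le_lt];
    repeat match goal with |- context [Rle_dec ?a ?b] => destruct (Rle_dec a b) as [?|?%Rnot_le_lt] end;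
      unfold Rabs; repeat destruct (Rcase_abs _); lra. }
  destruct (classic (exists t, S t)) as [[t0 Ht0]|Nt].
  2:{ intro c. apply (lm_ext (fun _ => False)); [apply lmeas_prop|]. intro t; split; [tauto|].
      intros [H _]. apply Nt; exists t; exact H. }
  assert (HT : 0 < T) by (specialize (HST t0 Ht0); lra).
  assert (Hr : forall t, 0 <= cl t <= T).
  { intro t. unfold cl. split; [apply Rmax_l|]. apply Rmax_lub; [lra|apply Rmin_r]. }
  assert (HFc : forall x eps, 0 < eps -> exists d, 0 < d /\
     forall y, Rabs (y - x) < d -> Rabs (F (cl y) - F (cl x)) < eps).
  { intros x eps He. destruct (HF (cl x) eps (Hr x) He) as [d [Hd Hy]]. exists d; split; [exact Hd|].
    intros y Dy. apply Hy; [apply Hr|]. eapply Rle_lt_trans; [apply Hcl|exact Dy]. }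
  apply (measurable_limit S (fun k t => (F (cl (t + / INR (Datatypes.S k))) - F (cl t)) / / INR (Datatypes.S k))).
  - exact HS.
  - intro k. assert (Pk := inv_INR_S_pos k). set (h := / INR (Datatypes.S k)) in *.
    apply measurable_cont; [exact HS|]. intros x _ eps He.
    destruct (HFc x (eps * h / 2)) as [d1 [Hd1 H1]]; [nra|].
    destruct (HFc (x + h) (eps * h / 2)) as [d2 [Hd2 H2]]; [nra|].
    exists (Rmin d1 d2); split; [apply Rmin_pos; assumption|]. intros y _ Hy.
    specialize (H1 y (Rlt_le_trans _ _ _ Hy (Rmin_l _ _))).
    specialize (H2 (y + h) ltac:(replace (y + h - (x + h)) with (y - x) by ring; exact (Rlt_le_trans _ _ _ Hy (Rmin_r _ _)))).
    apply Rabs_def2 in H1. apply Rabs_def2 in H2.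
    set (A := F (cl (y + h)) - F (cl y)). set (B := F (cl (x + h)) - F (cl x)).
    replace (A / h - B / h) with ((A - B) / h) by (field; lra).
    unfold Rdiv. rewrite Rabs_mult, Rabs_inv, (Rabs_pos_eq h) by lra.
    apply Rmult_lt_reg_r with h; [exact Pk|]. rewrite Rmult_assoc, Rinv_l, Rmult_1_r by lra.
    unfold A, B. apply Rabs_def1; lra.
  - intros t Ht eps He. destruct (HD t Ht eps He) as [d Hd]. assert (Pd := cond_pos d).
    specialize (HST t Ht).
    destruct (inv_INR_S_lt (Rmin d (T - t))) as [N HN]; [apply Rmin_pos; lra|].
    exists N; intros k Hk. specialize (HN k Hk). assert (Pk := inv_INR_S_pos k).
    generalize (Rmin_l d (T - t)) (Rmin_r d (T - t)); intros.
    rewrite !Hid by lra. apply Hd; [lra|]. rewrite Rabs_pos_eq; lra.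
Qed.

(** * Measurable selection *)

Lemma dense_sequence_coords n : exists e : nat -> vec n, forall q eps, 0 < eps ->
  exists k, forall i, Rabs (e k i - q i) < eps.
Proof.
  induction n as [|n [e He]].
  - exists (fun _ => vzero). intros q eps _. exists 0%nat. intro i; apply Fin.case0; exact i.
  - set (rt := fun k => ratio (fst (of_nat k)) (fst (of_nat (snd (of_nat k)))) (snd (of_nat (snd (of_nat k))))).
    exists (fun k i => Fin.caseS' i (fun _ => R) (rt (fst (of_nat k))) (e (snd (of_nat k)))).
    intros q eps Heps.
    destruct (He (fun i => q (Fin.FS i)) eps Heps) as [k2 Hk2].
    destruct (ratio_dense (q Fin.F1 - eps) (q Fin.F1 + eps)) as [i [j [m Hr]]]; [lra|].
    exists (to_nat (to_nat (i, to_nat (j, m)), k2)). rewrite cancel_of_to. cbn [fst snd].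
    intro l. apply (Fin.caseS' l); [|exact Hk2]. cbn [Fin.caseS'].
    unfold rt. repeat (rewrite cancel_of_to; cbn [fst snd]). apply Rabs_def1; lra.
Qed.

Lemma dense_sequence n : exists e : nat -> vec n, forall q eps, 0 < eps -> exists k, dist (e k) q < eps.
Proof.
  destruct (dense_sequence_coords n) as [e He]. exists e. intros q eps Heps. assert (P := pos_INR n).
  assert (E : 0 < eps / (INR n + 1)) by (apply Rdiv_lt_0_compat; lra).
  destruct (He q _ E) as [k Hk]. exists k.
  apply Rle_lt_trans with (INR n * (eps / (INR n + 1))).
  - apply vnorm_coord_bound; [lra|]. intro i; left; apply Hk.
  - replace eps with ((INR n + 1) * (eps / (INR n + 1))) at 2 by (field; lra). lra.
Qed.

Lemma nonpos_closed n (h : vec n -> R) q : cont_on whole h ->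
  (forall eps, 0 < eps -> exists y, h y <= eps /\ dist y q < eps) -> h q <= 0.
Proof.
  intros Hc Hq. apply Rnot_lt_le; intro C. destruct (Hc q I (h q / 2)) as [d [Hd Hy]]; [lra|].
  destruct (Hq (Rmin d (h q / 2))) as [y [H1 H2]]; [apply Rmin_pos; lra|].
  specialize (Hy y I (Rlt_le_trans _ _ _ H2 (Rmin_l _ _))). apply Rabs_def2 in Hy.
  generalize (Rmin_r d (h q / 2)); lra.
Qed.

(** [a t] is the minimum of the [i]-th coordinate over the compact set [h t <= 0]. It is at most [c]
    exactly when, for every [k], some point of a fixed dense sequence satisfies both constraints up
    to [1/(k+1)]; a cluster point of such points satisfies them exactly. Approximate points need not
    obey the bound [M], so [M + 1] is imposed on them. *)
Lemma minimal_coordinate n (S : R -> Prop) (h : R -> vec n -> R) M (i : Fin.t n) :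
  lmeas S -> (forall q, measurable_on S (fun t => h t q)) ->
  (forall t, S t -> cont_on whole (h t)) -> (forall t, S t -> exists q, h t q <= 0) ->
  (forall t q, S t -> h t q <= 0 -> vnorm q <= M) ->
  exists a : R -> R, measurable_on S a /\ forall t, S t ->
    (exists q, h t q <= 0 /\ q i = a t).
Proof.
  intros HS Hm Hc Hne Hb.
  destruct (choice (fun t a => S t -> (exists q, h t q <= 0 /\ q i = a) /\ forall q, h t q <= 0 -> a <= q i)) as [a Ha].
  { intro t. destruct (classic (S t)) as [St|]; [|exists 0; tauto].
    destruct (compact_max n (fun q => h t q <= 0) (fun q => - q i) M) as [q [Hq1 Hq2]].
    - intros q Hq; apply (Hb t q St Hq).
    - intros q Hq. apply nonpos_closed; [apply Hc, St|]. intros eps He. destruct (Hq eps He) as [y [H1 H2]].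
      exists y; split; [lra|exact H2].
    - intros x _ eps He. exists eps; split; [exact He|]. intros y _ Hy.
      replace (- y i - - x i) with (- (y i - x i)) by ring. rewrite Rabs_Ropp.
      eapply Rle_lt_trans; [apply dist_coord|exact Hy].
    - apply Hne, St.
    - exists (q i). intros _. split; [exists q; auto|]. intros y Hy. specialize (Hq2 y Hy). lra. }
  exists a. split; [|intros t St; apply (Ha t St)].
  destruct (dense_sequence n) as [e He].
  apply measurable_of_le. intro c.
  apply (lm_ext (fun t => S t /\ forall k, exists j,
     (e j i < c + / INR (Datatypes.S k) /\ vnorm (e j) <= M + 1) /\ (S t /\ h t (e j) < / INR (Datatypes.S k)))).
  - apply lmeas_and; [exact HS|]. apply lmeas_cap; intro k.
    apply (lm_union (fun j t => (e j i < c + / INR (Datatypes.S k) /\ vnorm (e j) <= M + 1) /\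
        (S t /\ h t (e j) < / INR (Datatypes.S k)))); intro j.
    apply lmeas_and; [apply lmeas_prop|apply Hm].
  - intro t; split; intros [St H]; (split; [exact St|]); destruct (Ha t St) as [[q [Q1 Q2]] Hmin].
    + destruct (choice _ H) as [jj Hjj].
      destruct (bolzano_weierstrass n (fun k => e (jj k)) (M + 1)) as [l [phi Hphi]].
      { intro k; apply Hjj. }
      assert (Hl : h t l <= 0).
      { apply nonpos_closed; [apply Hc, St|]. intros eps Heps. destruct (Hphi eps Heps) as [N HN].
        destruct (inv_INR_S_lt eps Heps) as [N' HN']. destruct (HN (max N N') ltac:(lia)) as [K1 K2].
        specialize (HN' (phi (max N N')) ltac:(lia)). destruct (Hjj (phi (max N N'))) as [_ [_ K3]].
        exists (e (jj (phi (max N N')))). split; [lra|exact K2]. }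
      apply Rle_trans with (l i); [apply Hmin, Hl|]. apply le_epsilon. intros eps Heps.
      destruct (Hphi (eps / 2) ltac:(lra)) as [N HN].
      destruct (inv_INR_S_lt (eps / 2) ltac:(lra)) as [N' HN']. destruct (HN (max N N') ltac:(lia)) as [K1 K2].
      specialize (HN' (phi (max N N')) ltac:(lia)). destruct (Hjj (phi (max N N'))) as [[K3 _] _].
      generalize (dist_coord n (e (jj (phi (max N N')))) l i). intro K4. apply Rabs_le_inv in K4. lra.
    + intro k. assert (Pk := inv_INR_S_pos k).
      destruct (Hc t St q I (/ INR (Datatypes.S k)) Pk) as [d [Hd Hy]].
      destruct (He q (Rmin d (Rmin 1 (/ INR (Datatypes.S k))))) as [j Hj]; [repeat apply Rmin_pos; lra|].
      generalize (Rmin_l d (Rmin 1 (/ INR (Datatypes.S k)))) (Rmin_r d (Rmin 1 (/ INR (Datatypes.S k))))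
        (Rmin_l 1 (/ INR (Datatypes.S k))) (Rmin_r 1 (/ INR (Datatypes.S k))). intros.
      exists j. specialize (Hy (e j) I ltac:(lra)). apply Rabs_def2 in Hy.
      assert (B := dist_coord n (e j) q i). apply Rabs_le_inv in B.
      assert (C := vnorm_dist_le n (e j) q). specialize (Hb t q St Q1).
      repeat split; try assumption; lra.
Qed.

Lemma fin_enum n : exists l : list (Fin.t n), forall i, In i l.
Proof.
  induction n as [|n [l Hl]].
  - exists []. intro i; apply Fin.case0; exact i.
  - exists (Fin.F1 :: map Fin.FS l). intro i. apply (Fin.caseS' i); [left; reflexivity|].
    intro j; right; apply in_map, Hl.
Qed.

Lemma cont_on_Rmax n (P : vec n -> Prop) f h : cont_on P f -> cont_on P h -> cont_on P (fun x => Rmax (f x) (h x)).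
Proof.
  intros Hf Hh x Px eps He. destruct (Hf x Px eps He) as [d1 [D1 F1]]. destruct (Hh x Px eps He) as [d2 [D2 F2]].
  exists (Rmin d1 d2); split; [apply Rmin_pos; assumption|]. intros y Py Hy.
  specialize (F1 y Py (Rlt_le_trans _ _ _ Hy (Rmin_l _ _))).
  specialize (F2 y Py (Rlt_le_trans _ _ _ Hy (Rmin_r _ _))).
  apply Rabs_def2 in F1. apply Rabs_def2 in F2. unfold Rmax.
  destruct (Rle_dec (f y) (h y)) as [A|A%Rnot_le_lt], (Rle_dec (f x) (h x)) as [B|B%Rnot_le_lt]; apply Rabs_def1; lra.
Qed.

(* Lexicographic minimum: the coordinates are fixed one after the other at their minimal value. *)
Lemma measurable_selection n (S : R -> Prop) (h : R -> vec n -> R) M :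
  lmeas S -> (forall q, measurable_on S (fun t => h t q)) ->
  (forall t, S t -> cont_on whole (h t)) -> (forall t, S t -> exists q, h t q <= 0) ->
  (forall t q, S t -> h t q <= 0 -> vnorm q <= M) ->
  exists p : R -> vec n, (forall i, measurable_on S (fun t => p t i)) /\ forall t, S t -> h t (p t) <= 0.
Proof.
  intros HS Hm Hc Hne Hb.
  assert (Hl : forall l : list (Fin.t n), exists h' : R -> vec n -> R,
    (forall q, measurable_on S (fun t => h' t q)) /\ (forall t, S t -> cont_on whole (h' t)) /\
    (forall t, S t -> exists q, h' t q <= 0) /\ (forall t q, h t q <= h' t q) /\
    forall i, In i l -> exists a, measurable_on S a /\ forall t q, S t -> h' t q <= 0 -> q i = a t).
  { induction l as [|i l [h' [I1 [I2 [I3 [I4 I5]]]]]].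
    - exists h. repeat split; auto; [intros; lra|]. intros i [].
    - destruct (minimal_coordinate n S h' M i HS I1 I2 I3) as [a [Ha1 Ha2]].
      { intros t q St Hq. apply (Hb t q St). eapply Rle_trans; [apply I4|exact Hq]. }
      (* Adding the absolute value inside the maximum restricts the sublevel set to the slice where
         coordinate [i] equals its minimum. *)
      exists (fun t q => Rmax (h' t q) (Rabs (q i - a t))). split; [|split; [|split; [|split]]].
      + intro q. apply measurable_Rmax; [apply I1|apply measurable_abs_sub; assumption].
      + intros t St. apply cont_on_Rmax; [apply I2, St|]. intros x _ eps He. exists eps; split; [exact He|].
        intros y _ Hy. eapply Rle_lt_trans; [apply Rabs_triang_inv2|].
        replace (y i - a t - (x i - a t)) with (y i - x i) by ring.
        eapply Rle_lt_trans; [apply dist_coord|exact Hy].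
      + intros t St. destruct (Ha2 t St) as [q [Q1 Q2]]. exists q. rewrite Q2, Rminus_diag, Rabs_R0.
        apply Rmax_lub; lra.
      + intros t q. eapply Rle_trans; [apply I4|apply Rmax_l].
      + intros j [<-|Hj].
        * exists a. split; [exact Ha1|]. intros t q St Hq.
          generalize (Rmax_r (h' t q) (Rabs (q i - a t))). intro B.
          assert (B2 : Rabs (q i - a t) <= 0) by lra. apply Rabs_le_inv in B2. lra.
        * destruct (I5 j Hj) as [a' [A1 A2]]. exists a'. split; [exact A1|]. intros t q St Hq.
          apply A2; [exact St|]. generalize (Rmax_l (h' t q) (Rabs (q i - a t))); lra. }
  (* With all coordinates listed, the sublevel set of [h' t] is a single point, so any choice in it
     has the measurable coordinates found above. *)
  destruct (fin_enum n) as [l Hall]. destruct (Hl l) as [h' [I1 [I2 [I3 [I4 I5]]]]].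
  destruct (choice (fun t q => S t -> h' t q <= 0)) as [p Hp].
  { intro t. destruct (classic (S t)) as [St|]; [|exists vzero; tauto].
    destruct (I3 t St) as [q Hq]. exists q; auto. }
  exists p. split.
  - intro i. destruct (I5 i (Hall i)) as [a [A1 A2]]. apply (measurable_ext S a); [exact A1|].
    intros t St. symmetry. apply A2; auto.
  - intros t St. eapply Rle_trans; [apply I4|apply Hp, St].
Qed.

(** * Curves *)

Definition length_sum {n} (eta : R -> vec n) (l : list (R * R)) : R :=
  fold_right (fun ab s => dist (eta (snd ab)) (eta (fst ab)) + s) 0 l.

Lemma length_sum_nonneg n (eta : R -> vec n) l : 0 <= length_sum eta l.
Proof. induction l as [|[a b] l IH]; simpl; [lra|generalize (dist_nonneg n (eta b) (eta a)); lra]. Qed.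

Lemma abs_cont_coord n T (eta : R -> vec n) i : abs_cont_on T eta -> abs_cont_R T (fun s => eta s i).
Proof.
  intros Ha eps He. destruct (Ha eps He) as [d [Hd Hl]]. exists d; split; [exact Hd|].
  intros l H1 H2. eapply Rle_lt_trans; [|exact (Hl l H1 H2)].
  clear. induction l as [|[a b] l IH]; unfold variation in *; simpl; [lra|].
  generalize (dist_coord n (eta b) (eta a) i); lra.
Qed.

(** The Lipschitz bound holds only for points closer than [r]. Making the total displacement along
    the chain smaller than [r] makes each single displacement smaller as well. *)
Lemma abs_cont_lipschitz_comp n (C : vec n -> Prop) u T (eta : R -> vec n) r L :
  0 < r -> 0 <= L ->
  (forall x y, C x -> C y -> dist y x < r -> Rabs (u y - u x) <= L * dist y x) ->
  (forall s, 0 <= s <= T -> C (eta s)) -> abs_cont_on T eta -> abs_cont_R T (fun s => u (eta s)).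
Proof.
  intros Hr HL Hlip Hin Ha eps He.
  destruct (Ha (Rmin r (eps / (L + 1)))) as [d [Hd Hl]].
  { apply Rmin_pos; [exact Hr|apply Rdiv_lt_0_compat; lra]. }
  exists d; split; [exact Hd|]. intros l H1 H2. specialize (Hl l H1 H2). fold (length_sum eta l) in Hl.
  assert (A1 := Rlt_le_trans _ _ _ Hl (Rmin_l _ _)). assert (A2 := Rlt_le_trans _ _ _ Hl (Rmin_r _ _)).
  apply Rle_lt_trans with (L * length_sum eta l).
  - destruct H1 as [C1 C2]. clear H2 Hl A2. revert C1 A1.
    assert (Hlo : forall lo, 0 <= lo -> itv_chain lo l -> length_sum eta l < r ->
      variation (fun s => u (eta s)) l <= L * length_sum eta l); [|intros; apply (Hlo 0); auto; lra].
    induction l as [|[a b] l IH]; intros lo Plo C1 A1; unfold variation in *; simpl in *; [lra|].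
    inversion C2 as [|? ? F1 F2]; subst. simpl in F1. destruct C1 as [G1 [G2 G3]].
    assert (P1 := length_sum_nonneg n eta l). assert (P2 := dist_nonneg n (eta b) (eta a)).
    specialize (IH F2 b ltac:(lra) G3 ltac:(lra)).
    destruct l as [|[c e] l'].
    + simpl in *. specialize (Hlip (eta a) (eta b) ltac:(apply Hin; lra) ltac:(apply Hin; lra) ltac:(lra)). lra.
    + specialize (Hlip (eta a) (eta b) ltac:(apply Hin; lra) ltac:(apply Hin; lra) ltac:(lra)). lra.
  - apply (Rmult_lt_compat_r (L + 1)) in A2; [|lra].
    replace (eps / (L + 1) * (L + 1)) with eps in A2 by (field; lra).
    generalize (length_sum_nonneg n eta l). lra.
Qed.

Lemma abs_cont_continuous n T (eta : R -> vec n) : abs_cont_on T eta -> forall x eps, 0 <= x <= T -> 0 < eps ->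
  exists d, 0 < d /\ forall y, 0 <= y <= T -> Rabs (y - x) < d -> dist (eta y) (eta x) < eps.
Proof.
  intros Hf x eps Hx He. destruct (Hf eps He) as [d [Hd Hl]]. exists d; split; [exact Hd|].
  intros y Hy Hyx. apply Rabs_def2 in Hyx. destruct (Rle_dec x y) as [Hxy|Hxy%Rnot_le_lt].
  - specialize (Hl [(x, y)]). simpl in Hl.
    assert (dist (eta y) (eta x) + 0 < eps); [|lra]. apply Hl; [|lra].
    split; [simpl; lra|constructor; [simpl; lra|constructor]].
  - specialize (Hl [(y, x)]). simpl in Hl. rewrite dist_sym.
    assert (dist (eta x) (eta y) + 0 < eps); [|lra]. apply Hl; [|lra].
    split; [simpl; lra|constructor; [simpl; lra|constructor]].
Qed.

Lemma dot_derivable n (q : vec n) (eta : R -> vec n) t v :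
  (forall i, derivable_pt_lim (fun s => eta s i) t (v i)) ->
  derivable_pt_lim (fun s => dot q (eta s)) t (dot q v).
Proof.
  unfold dot. induction n as [|n IH]; intros Hv; simpl; [apply derivable_pt_lim_const|].
  apply (derivable_pt_lim_plus (fun s => q Fin.F1 * eta s Fin.F1)
    (fun s => sumFin n (fun i => q (Fin.FS i) * eta s (Fin.FS i)))).
  - apply (derivable_pt_lim_scal (fun s => eta s Fin.F1)), Hv.
  - apply (IH (fun i => q (Fin.FS i)) (fun s i => eta s (Fin.FS i)) (fun i => v (Fin.FS i))).
    intro i; apply Hv.
Qed.

Lemma null_fin n (E : Fin.t n -> R -> Prop) : (forall i, null_set (E i)) -> null_set (fun x => exists i, E i x).
Proof.
  induction n as [|n IH]; intro HE.
  - apply null_mono with (1 := null_point 0). intros x [i _]. apply Fin.case0; exact i.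
  - apply null_mono with (1 := null_union _ _ (HE Fin.F1) (IH _ (fun i => HE (Fin.FS i)))).
    intros x [i Hi]. revert Hi. apply (Fin.caseS' i); [left; assumption|]. intros j Hj; right; exists j; exact Hj.
Qed.

(** * The momentum along the curve as a measurable selection *)

Theorem theorem2p1 (n : nat) (Omega : vec n -> Prop)
  (H : vec n -> vec n -> R) (g : vec n -> R) (gamma : vec n -> vec n)
  (* standing assumptions *)
  (HOmega : is_domain Omega) (HObdd : is_bounded Omega)
  (HHcont : cont_on_prod (closure Omega) H)
  (Hgcont : cont_on (boundary Omega) g)
  (Hgamcont : vcont_on (boundary Omega) gamma)
  (* (A1) convexity *)
  (A1 : forall x p q lam, closure Omega x -> 0 <= lam <= 1 ->
     H x (vadd (vscale lam p) (vscale (1 - lam) q))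
       <= lam * H x p + (1 - lam) * H x q)
  (* (A2) coercivity *)
  (A2 : forall x, closure Omega x -> forall M, exists Rad,
     forall p, vnorm p >= Rad -> H x p >= M)
  (* (A3) C^1 domain *)
  (A3 : is_C1_domain Omega)
  (* (A4) obliqueness *)
  (A4 : forall x nu, boundary Omega x -> outer_unit_normal Omega x nu ->
     dot nu (gamma x) > 0)
  (Hcrit : critical_value_zero Omega H gamma g)
  (u : vec n -> R) (Hu : visc_subsol Omega H gamma g u)
  (T : R) (HT : T > 0) (eta : R -> vec n)
  (Heta_ac : abs_cont_on T eta)
  (Heta_in : forall t, 0 <= t <= T -> closure Omega (eta t)) :
  exists p : R -> vec n,
    Linf_on (fun t => 0 <= t <= T) p /\
    ae_on (fun t => 0 <= t <= T) (fun t =>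
      exists v : vec n,
        (forall i, derivable_pt_lim (fun s => eta s i) t (v i)) /\
        derivable_pt_lim (fun s => u (eta s)) t (dot (p t) v)) /\
    ae_on (fun t => 0 <= t <= T) (fun t => H (eta t) (p t) <= 0) /\
    ae_on (fun t => 0 <= t <= T /\ boundary Omega (eta t))
      (fun t => dot (gamma (eta t)) (p t) <= g (eta t)).
Proof.
  destruct HOmega as [HO _].
  destruct (coercive_uniform n Omega H HObdd HHcont A1 A2) as [M [HM Hco]].
  assert (Hfr : forall x, closure Omega x -> exists b c k, frame Omega gamma g x b c k)
    by (intros x Cx; apply frame_exists; assumption).
  destruct (lipschitz_uniform n Omega u HObdd) as [r [L [Hr [HL Hlip]]]].
  { intros x0 Cx0. destruct (Hfr x0 Cx0) as [b [c [k Hf]]].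
    apply (lipschitz_near n Omega H gamma g u x0 b c k M); assumption. }
  assert (ACu := abs_cont_lipschitz_comp n (closure Omega) u T eta r L Hr HL Hlip Heta_in Heta_ac).
  assert (Hec := abs_cont_continuous n T eta Heta_ac).
  set (bad := fun t => (exists i, 0 <= t <= T /\ ~ exists v, derivable_pt_lim (fun s => eta s i) t v) \/
     (0 <= t <= T /\ ~ exists v, derivable_pt_lim (fun s => u (eta s)) t v)).
  assert (Hbad : null_set bad).
  { apply null_union; [|apply abs_cont_R_derivable_ae; assumption].
    apply (null_fin n (fun i t => 0 <= t <= T /\ ~ exists v, derivable_pt_lim (fun s => eta s i) t v)).
    intro i. apply abs_cont_R_derivable_ae; [exact HT|apply abs_cont_coord; assumption]. }
  (* The endpoints are left out because tangency at a boundary point uses the curve on both sides of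
     [t]. *)
  set (S := fun t => 0 < t < T /\ ~ bad t).
  assert (HS : lmeas S) by (apply lmeas_and; [apply lm_itv|apply (lm_compl bad), lm_null, Hbad]).
  assert (HSI : forall t, S t -> 0 <= t <= T) by (intros t [Ht _]; lra).
  assert (HNS : null_set (fun t => 0 <= t <= T /\ ~ S t)).
  { apply null_mono with (1 := null_union _ _ Hbad (null_union _ _ (null_point 0) (null_point T))).
    intros t [Ht Hn]. apply NNPP; intro C. apply Hn. split; [|tauto].
    assert (t <> 0) by tauto. assert (t <> T) by tauto. lra. }
  destruct (choice (fun t (vd : vec n * R) => S t ->
     (forall i, derivable_pt_lim (fun s => eta s i) t (fst vd i)) /\
     derivable_pt_lim (fun s => u (eta s)) t (snd vd))) as [vd Hvd].
  { intro t. destruct (classic (S t)) as [St|]; [|exists (vzero, 0); tauto].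
    assert (St' := St). destruct St' as [Ht Hnb].
    destruct (choice (fun i v => derivable_pt_lim (fun s => eta s i) t v)) as [v Hv].
    { intro i. apply NNPP; intro C. apply Hnb; left; exists i; split; [lra|exact C]. }
    assert (exists d, derivable_pt_lim (fun s => u (eta s)) t d) as [d Hd].
    { apply NNPP; intro C. apply Hnb; right; split; [lra|exact C]. }
    exists (v, d). auto. }
  destruct (choice (fun t (b : bool) => b = true <-> boundary Omega (eta t))) as [onb Honb].
  { intro t. destruct (classic (boundary Omega (eta t))); [exists true|exists false]; split; auto; discriminate. }
  (* The value [-1] makes the boundary constraint hold at interior times. *)
  set (hB := fun t q => if onb t then dot (gamma (eta t)) q - g (eta t) else -1).
  (* All requirements become one sublevel set [h t q <= 0], with [h] continuous in [q] and
     measurable in [t]; the equation for the derivative enters as an absolute value. *)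
  set (h := fun t q => Rmax (H (eta t) q) (Rmax (Rabs (0 - (dot q (fst (vd t)) - snd (vd t)))) (hB t q))).
  assert (Hadm : forall t q, h t q <= 0 <-> admissible Omega H gamma g (eta t) q /\ dot q (fst (vd t)) = snd (vd t)).
  { intros t q. unfold h, admissible. split.
    - intro Hh.
      assert (B1 := Rle_trans _ _ _ (Rmax_l _ _) Hh). assert (B2 := Rle_trans _ _ _ (Rmax_r _ _) Hh).
      assert (B3 := Rle_trans _ _ _ (Rmax_l _ _) B2). assert (B4 := Rle_trans _ _ _ (Rmax_r _ _) B2).
      apply Rabs_le_inv in B3. split; [split; [exact B1|]|lra].
      intro Bd. apply (Honb t) in Bd. unfold hB in B4. rewrite Bd in B4. lra.
    - intros [[B1 B2] B3]. apply Rmax_lub; [exact B1|]. apply Rmax_lub.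
      + rewrite B3. replace (0 - (snd (vd t) - snd (vd t))) with 0 by ring. rewrite Rabs_R0; lra.
      + unfold hB. destruct (onb t) eqn:E; [|lra]. apply (Honb t) in E. specialize (B2 E). lra. }
  destruct (measurable_selection n S h M HS) as [p [Hp1 Hp2]].
  - intro q. apply measurable_Rmax; [|apply measurable_Rmax].
    + apply measurable_cont; [exact HS|]. intros x Sx eps He.
      destruct (HHcont (eta x) q (Heta_in x (HSI x Sx)) eps He) as [d [Hd Hc]].
      destruct (Hec x d (HSI x Sx) Hd) as [d' [Hd' Hc']]. exists d'; split; [exact Hd'|].
      intros y Sy Dy. apply Hc; [apply Heta_in, HSI, Sy|apply Hc'; auto|rewrite dist_refl; exact Hd].
    + apply measurable_abs_sub; [exact HS|].
      (* For fixed [q], the discrepancy between [dot q v] and the derivative of [u o eta] is itself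
         a derivative, so the velocity need not be shown measurable by itself. *)
      apply (measurable_derivative S T (fun t => dot q (eta t) - u (eta t))); [exact HS|intros t [Ht _]; exact Ht| |].
      * intros x eps Hx He. assert (Pq := vnorm_nonneg n q).
        destruct (Hec x (eps / (2 * (vnorm q + 1))) Hx ltac:(apply Rdiv_lt_0_compat; lra)) as [d1 [Hd1 C1]].
        destruct (abs_cont_R_continuous T _ ACu x (eps / 2) Hx ltac:(lra)) as [d2 [Hd2 C2]].
        exists (Rmin d1 d2); split; [apply Rmin_pos; assumption|]. intros y Hy Dy.
        specialize (C1 y Hy (Rlt_le_trans _ _ _ Dy (Rmin_l _ _))).
        specialize (C2 y Hy (Rlt_le_trans _ _ _ Dy (Rmin_r _ _))). cbv beta in C2.
        assert (CS := cauchy_schwarz_abs n q (vsub (eta y) (eta x))). rewrite dot_sub_r in CS.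
        change (vnorm (vsub (eta y) (eta x))) with (dist (eta y) (eta x)) in CS.
        apply (Rmult_lt_compat_r (vnorm q + 1)) in C1; [|lra].
        replace (eps / (2 * (vnorm q + 1)) * (vnorm q + 1)) with (eps / 2) in C1 by (field; lra).
        assert (Pd := dist_nonneg n (eta y) (eta x)).
        apply Rabs_le_inv in CS. apply Rabs_def2 in C2. apply Rabs_def1; lra.
      * intros t St. destruct (Hvd t St) as [V1 V2].
        apply (derivable_pt_lim_minus (fun t => dot q (eta t)) (fun t => u (eta t))); [|exact V2].
        apply dot_derivable, V1.
    (* [gamma] and [g] are continuous only on the boundary, so the times are split. Those with
       [eta t] in [Omega] form a relatively open set, and the boundary times are its complement in
       [S]. *)
    + assert (HSb : lmeas (fun t => S t /\ boundary Omega (eta t))).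
      { apply (lm_ext (fun t => S t /\ ~ (S t /\ Omega (eta t)))).
        - apply lmeas_and; [exact HS|]. apply (lm_compl (fun t => S t /\ Omega (eta t))).
          apply lmeas_rel_open; [exact HS|]. intros t St Ot. destruct (HO _ Ot) as [d [Hd Hin]].
          destruct (Hec t d (HSI t St) Hd) as [d' [Hd' C]]. exists d'; split; [exact Hd'|].
          intros y Sy Dy. apply Hin, C; auto.
        - intro t; split; intros [St Ht]; (split; [exact St|]).
          + split; [apply Heta_in, HSI, St|tauto].
          + intros [_ Ot]. apply Ht, Ot. }
      apply (measurable_split S (fun t => boundary Omega (eta t))).
      * apply (measurable_ext _ (fun t => dot (gamma (eta t)) q - g (eta t))).
        2:{ intros t [_ Bt]. unfold hB. apply (Honb t) in Bt. rewrite Bt. reflexivity. }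
        apply measurable_cont; [exact HSb|]. intros x [Sx Bx] eps He. assert (Pq := vnorm_nonneg n q).
        destruct (Hgamcont (eta x) Bx (eps / (2 * (vnorm q + 1)))) as [e1 [He1 C1]]; [apply Rdiv_lt_0_compat; lra|].
        destruct (Hgcont (eta x) Bx (eps / 2)) as [e2 [He2 C2]]; [lra|].
        destruct (Hec x (Rmin e1 e2) (HSI x Sx) (Rmin_pos _ _ He1 He2)) as [d [Hd C]].
        exists d; split; [exact Hd|]. intros y [Sy By] Dy. specialize (C y (HSI y Sy) Dy).
        specialize (C1 _ By (Rlt_le_trans _ _ _ C (Rmin_l _ _))).
        specialize (C2 _ By (Rlt_le_trans _ _ _ C (Rmin_r _ _))).
        assert (CS := cauchy_schwarz_abs n (vsub (gamma (eta y)) (gamma (eta x))) q). rewrite dot_sub_l in CS.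
        change (vnorm (vsub (gamma (eta y)) (gamma (eta x)))) with (dist (gamma (eta y)) (gamma (eta x))) in CS.
        apply (Rmult_lt_compat_r (vnorm q + 1)) in C1; [|lra].
        replace (eps / (2 * (vnorm q + 1)) * (vnorm q + 1)) with (eps / 2) in C1 by (field; lra).
        assert (Pd := dist_nonneg n (gamma (eta y)) (gamma (eta x))).
        apply Rabs_le_inv in CS. apply Rabs_def2 in C2. apply Rabs_def1; lra.
      * apply (measurable_ext _ (fun _ => -1)).
        2:{ intros t [_ Bt]. unfold hB. destruct (onb t) eqn:E; [|reflexivity]. exfalso; apply Bt, Honb, E. }
        intro c. apply (lm_ext (fun t => (S t /\ ~ (S t /\ boundary Omega (eta t))) /\ -1 < c)).
        -- apply lmeas_and; [|apply lmeas_prop]. apply lmeas_and; [exact HS|].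
           apply (lm_compl (fun t => S t /\ boundary Omega (eta t))), HSb.
        -- intro t; tauto.
  - intros t St. apply cont_on_Rmax; [|apply cont_on_Rmax].
    + intros q _ eps He. destruct (HHcont (eta t) q (Heta_in t (HSI t St)) eps He) as [d [Hd Hc]].
      exists d; split; [exact Hd|]. intros y _ Dy.
      apply Hc; [apply Heta_in, HSI, St|rewrite dist_refl; exact Hd|exact Dy].
    + apply (cont_on_comp_R n whole (fun q => 0 - (dot q (fst (vd t)) - snd (vd t))) Rabs).
      * apply (cont_on_ext n _ (fun q => (-1) * dot (fst (vd t)) q + 1 * snd (vd t)));
          [intro q; rewrite (dot_comm n q); ring|].
        apply cont_on_lin; [apply cont_on_dot|]. intros x _ eps He; exists 1; split; [lra|].
        intros; rewrite Rminus_diag, Rabs_R0; exact He.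
      * intros x _. apply Rcontinuity_abs.
    + unfold hB. destruct (onb t).
      * apply (cont_on_ext n _ (fun q => 1 * dot (gamma (eta t)) q + (-1) * g (eta t))); [intro q; ring|].
        apply cont_on_lin; [apply cont_on_dot|]. intros x _ eps He; exists 1; split; [lra|].
        intros; rewrite Rminus_diag, Rabs_R0; exact He.
      * intros x _ eps He; exists 1; split; [lra|]. intros; rewrite Rminus_diag, Rabs_R0; exact He.
  - intros t St. destruct (Hvd t St) as [V1 V2].
    destruct (curve_momentum n Omega H gamma g u M r L eta T t (fst (vd t)) (snd (vd t)) HO Hu HHcont Hfr A1
      Hco Hr HL Hlip (proj1 St) Heta_in V1 V2) as [q [Q1 Q2]].
    exists q. apply Hadm. auto.
  - intros t q St Hq. apply Hadm in Hq. apply (Hco (eta t)); [apply Heta_in, HSI, St|apply Hq].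
  - assert (Hae : forall (I P : R -> Prop), (forall t, I t -> 0 <= t <= T) -> (forall t, I t -> S t -> P t) -> ae_on I P).
    { intros I P HI HP. apply null_mono with (1 := HNS). intros t [It Nt]. split; [auto|]. intro St; auto. }
    assert (Hq : forall t, S t -> admissible Omega H gamma g (eta t) (p t) /\ dot (p t) (fst (vd t)) = snd (vd t))
      by (intros t St; apply Hadm, Hp2, St).
    exists p. split; [split|split; [|split]].
    (* Off [S] the selected values are arbitrary, which is harmless because every subset of a null
       set is in [lmeas]. *)
    + intros i c. apply (lm_ext (fun t => (S t /\ p t i < c) \/ ((0 <= t <= T /\ ~ S t) /\ p t i < c))).
      * apply lmeas_or; [apply Hp1|]. apply lm_null. apply null_mono with (1 := HNS). tauto.
      * intro t. specialize (HSI t). destruct (classic (S t)); tauto.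
    + exists M. apply Hae; [auto|]. intros t It St. apply (Hco (eta t)); [auto|apply Hq, St].
    + apply Hae; [auto|]. intros t It St. exists (fst (vd t)). destruct (Hvd t St) as [V1 V2].
      split; [exact V1|]. destruct (Hq t St) as [_ E]. rewrite E. exact V2.
    + apply Hae; [auto|]. intros t It St. apply Hq, St.
    + apply Hae; [tauto|]. intros t [It Bt] St. apply Hq; assumption.
Qed.
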